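(* Assume that there exist $K_1>0$ and $R>1$ such that $$\langle b(t,x),x\rangle\le-K_1|x|^2\log|x|,\qquad t\in I,\ |x|\ge R.$$ Then the evolution operator $G(t,s)$ is supercontractive.
   Context: Setting. $I$ is an open right halfline, and for $t\in I$, $(\mathcal A(t)\zeta)(x)=\mathrm{Tr}(Q(t)D^2\zeta(x))+\langle b(t,x),\nabla\zeta(x)\rangle$, $x\in\mathbb R^d$, where $Q=[q_{ij}]$ and $b=(b_1,\dots,b_d)$. Standing assumptions: (i) for some $\theta\in(0,1)$, $q_{ij}\in C^{\theta/2}_{\rm loc}(I)$ and $b_i\in C^{\theta/2,\theta}_{\rm loc}(I\times\mathbb R^d)$ (locally parabolic H\''older); (ii) $Q(t)$ is symmetric and there are $0<\eta_0<\Lambda$ with $\eta_0|\xi|^2\le\langle Q(t)\xi,\xi\rangle\le\Lambda|\xi|^2$ for all $t\in I$, $\xi\in\mathbb R^d$; (iii) there are a positive $\varphi\in C^2(\mathbb R^d)$ with $\varphi(x)\to+\infty$ as $|x|\to+\infty$ and constants $a,\gamma>0$ with $(\mathcal A(t)\varphi)(x)\le a-\gamma\varphi(x)$ for all $(t,x)\in I\times\mathbb R^d$; (iv) the first order spatial derivatives of $b_i$ exist and belong to $C^{\theta/2,\theta}_{\rm loc}(I\times\mathbb R^d)$, and there is $r_0<0$ with $\langle\nabla_xb(t,x)\xi,\xi\rangle\le r_0|\xi|^2$ for all $(t,x)\in I\times\mathbb R^d$, $\xi\in\mathbb R^d$. For $s\in I$ and $f\in C_b(\mathbb R^d)$, $G(\cdot,s)f\in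 C_b([s,+\infty)\times\mathbb R^d)\cap C^{1+\theta/2,2+\theta}_{\rm loc}((s,+\infty)\times\mathbb R^d)$ denotes the unique bounded classical solution of $D_tu=\mathcal A(t)u$ in $(s,+\infty)\times\mathbb R^d$, $u(s,\cdot)=f$. Under these assumptions there is a unique family $\{\mu_t:t\in I\}$ of Borel probability measures which is tight (for every $\varepsilon>0$ there is $R>0$ with $\mu_t(B(0,R))\ge1-\varepsilon$ for all $t\in I$) and satisfies $\int G(t,s)f\,d\mu_t=\int f\,d\mu_s$ for all $t>s$ in $I$, $f\in C_b(\mathbb R^d)$ (the tight evolution system of measures). $G(t,s)$ extends to a contraction from $L^p(\mathbb R^d,\mu_s)$ to $L^p(\mathbb R^d,\mu_t)$ for every $p\in[1,+\infty)$, still denoted $G(t,s)$. $\|G(t,s)\|_{p\to q}$ is the operator norm from $L^p(\mathbb R^d,\mu_s)$ to $L^q(\mathbb R^d,\mu_t)$. $G(t,s)$ is called supercontractive if it maps $L^p(\mathbb R^d,\mu_s)$ into $L^q(\mathbb R^d,\mu_t)$ for any $1<p<q<+\infty$ and $t>s$ in $I$, and (for each such $p,q$) there is a positive decreasing function $C_{p,q}:(0,+\infty)\to(0,+\infty)$ with $\lim_{r\to0^+}C_{p,q}(r)=+\infty$ and $\|G(t,s)\|_{p\to q}\le C_{p,q}(t-s)$ for all $s<t$ in $I$. *)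

(* Defs.v *)
From HB Require Import structures.
From mathcomp Require Import all_boot all_order all_algebra.
From mathcomp Require Import all_classical all_reals all_analysis.

Set Implicit Arguments.
Unset Strict Implicit.
Unset Printing Implicit Defensive.

Import Order.TTheory GRing.Theory Num.Theory.
Import numFieldNormedType.Exports.

Local Open Scope classical_set_scope.
Local Open Scope ring_scope.

Section Space.
Variables (R : realType) (d : nat).
Notation V := 'rV[R]_d.

(* The library norm `|x| on row vectors is the sup norm; |x| is Euclidean in
   what follows. *)
Definition dotp (x y : V) : R := \sum_i x 0 i * y 0 i.
Definition enorm (x : V) : R := Num.sqrt (dotp x x).

Definition pderivable (i : 'I_d) (f : V -> R) (x : V) : Prop :=
  derivable f x (delta_mx 0 i).
Definition partial (i : 'I_d) (f : V -> R) (x : V) : R :=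
  'D_(delta_mx 0 i) f x.

Definition grad (f : V -> R) (x : V) : V := \row_i partial i f x.
Definition hess (f : V -> R) (x : V) : 'M[R]_d :=
  \matrix_(i, j) partial i (partial j f) x.

Definition C2 (f : V -> R) : Prop :=
  [/\ continuous f,
      forall i x, pderivable i f x,
      forall i, continuous (partial i f),
      forall i j x, pderivable i (partial j f) x
    & forall i j, continuous (partial i (partial j f))].

Definition Cb (f : V -> R) : Prop :=
  continuous f /\ exists M : R, forall x, `|f x| <= M.

Definition holder_time_loc (al : R) (J : set R) (g : R -> R) : Prop :=
  forall K : set R, compact K -> K `<=` J ->
  exists M : R, forall t s, K t -> K s -> `|g t - g s| <= M * `|t - s| `^ al.

(* C^{theta/2,theta}_loc(J x R^d) *)
Definition parabolic_holder_loc (theta : R) (J : set R) (u : R -> V -> R)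
  : Prop :=
  forall K : set (R * V), compact K -> K `<=` J `*` [set: V] ->
  exists M : R, forall t x s y, K (t, x) -> K (s, y) ->
    `|u t x - u s y| <=
      M * (`|t - s| `^ (theta / 2) + enorm (x - y) `^ theta).

(* C^{1+theta/2,2+theta}_loc(J x R^d) *)
Definition parabolic_holder2_loc (theta : R) (J : set R) (u : R -> V -> R)
  : Prop :=
  [/\ forall t x, J t -> derivable (fun r => u r x) t 1,
      forall t x i, J t -> pderivable i (u t) x,
      forall t x i j, J t -> pderivable i (partial j (u t)) x
    & [/\ parabolic_holder_loc theta J u,
          parabolic_holder_loc theta J (fun t x => derive1 (fun r => u r x) t),
          forall i, parabolic_holder_loc theta J (fun t => partial i (u t))
        & forall i j,
            parabolic_holder_loc theta J
              (fun t => partial i (partial j (u t)))]].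

Definition kolmogorov (Q : R -> 'M[R]_d) (b : R -> V -> V) (t : R)
    (f : V -> R) (x : V) : R :=
  \tr (Q t *m hess f x) + dotp (b t x) (grad f x).

Record standing_assumptions (theta : R) (I : set R) (Q : R -> 'M[R]_d)
    (b : R -> V -> V) : Prop := {
  theta_range : 0 < theta < 1;
  Q_holder : forall i j, holder_time_loc (theta / 2) I (fun t => Q t i j);
  b_holder : forall i, parabolic_holder_loc theta I (fun t x => b t x 0 i);
  Q_sym : forall t, I t -> (Q t)^T = Q t;
  Q_elliptic : exists eta0 Lambda : R, 0 < eta0 < Lambda /\
    forall t (xi : V), I t ->
      eta0 * enorm xi ^+ 2 <= dotp (xi *m (Q t)^T) xi <= Lambda * enorm xi ^+ 2;
  lyapunov : exists (phi : V -> R) (a gamma : R),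
    [/\ C2 phi,
        forall x, 0 < phi x,
        forall M : R, exists r : R, forall x, r <= enorm x -> M <= phi x,
        0 < a /\ 0 < gamma
      & forall t x, I t -> kolmogorov Q b t phi x <= a - gamma * phi x];
  b_derivable : forall t x i j, I t -> pderivable j (fun y => b t y 0 i) x;
  db_holder : forall i j,
    parabolic_holder_loc theta I (fun t => partial j (fun y => b t y 0 i));
  b_dissipative : exists r0 : R, r0 < 0 /\
    forall t x (xi : V), I t ->
      \sum_i \sum_j partial j (fun y => b t y 0 i) x * xi 0 j * xi 0 i
        <= r0 * enorm xi ^+ 2
}.

Record bounded_classical_solution (theta : R) (Q : R -> 'M[R]_d)
    (b : R -> V -> V) (s : R) (f : V -> R) (u : R -> V -> R) : Prop := {
  sol_continuous :
    {within `[s, +oo[ `*` [set: V], continuous (fun z : R * V => u z.1 z.2)};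
  sol_bounded : exists M : R, forall t x, s <= t -> `|u t x| <= M;
  sol_regular : parabolic_holder2_loc theta `]s, +oo[ u;
  sol_equation : forall t x, s < t ->
    derive1 (fun r => u r x) t = kolmogorov Q b t (u t) x;
  sol_initial : forall x, u s x = f x
}.

Definition is_evolution_operator (theta : R) (I : set R) (Q : R -> 'M[R]_d)
    (b : R -> V -> V) (G : R -> R -> (V -> R) -> (V -> R)) : Prop :=
  forall s f, I s -> Cb f ->
    bounded_classical_solution theta Q b s f (fun t => G t s f).

Definition borelRd := g_sigma_algebraType (@open V).

Definition tight_evolution_system (I : set R)
    (G : R -> R -> (V -> R) -> (V -> R))
    (mu : R -> probability borelRd R) : Prop :=
  (forall eps : R, 0 < eps -> exists2 r : R, 0 < r &
     forall t, I t -> ((1 - eps)%:E <= mu t [set x | (enorm x < r)%R])%E) /\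
  (forall s t f, I s -> s < t -> Cb f ->
     (\int[mu t]_x (G t s f x)%:E = \int[mu s]_x (f x)%:E)%E).

(* T t s acts on representatives of classes in L^p(mu_s), p >= 1. It is
   well defined on classes, by linearity and contractivity, and it is determined
   up to mu_t-null sets because Cb is dense in L^p(mu_s). *)
Record is_Lp_extension (I : set R) (G : R -> R -> (V -> R) -> (V -> R))
    (mu : R -> probability borelRd R)
    (T : R -> R -> (V -> R) -> (V -> R)) : Prop := {
  ext_Cb : forall s t f, I s -> s < t -> Cb f ->
    {ae mu t, forall x, T t s f x = G t s f x};
  ext_Lp : forall (p : R) s t f, 1 <= p -> I s -> s < t ->
    f \in Lfun (mu s) p%:E -> T t s f \in Lfun (mu t) p%:E;
  ext_linear : forall (p : R) s t f g (c : R), 1 <= p -> I s -> s < t ->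
    f \in Lfun (mu s) p%:E -> g \in Lfun (mu s) p%:E ->
    {ae mu t, forall x,
       T t s (fun y => c * f y + g y) x = c * T t s f x + T t s g x};
  ext_contraction : forall (p : R) s t f, 1 <= p -> I s -> s < t ->
    f \in Lfun (mu s) p%:E ->
    ('N[mu t]_p%:E [EFin \o T t s f] <= 'N[mu s]_p%:E [EFin \o f])%E
}.

Definition Lp_opnorm (p q : R) (m n : probability borelRd R)
    (S : (V -> R) -> (V -> R)) : \bar R :=
  ereal_sup [set ('N[n]_q%:E [EFin \o S f])%E | f in
    [set f : V -> R | f \in Lfun m p%:E /\ ('N[m]_p%:E [EFin \o f] <= 1)%E]].

Definition supercontractive (I : set R) (mu : R -> probability borelRd R)
    (T : R -> R -> (V -> R) -> (V -> R)) : Prop :=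
  forall p q : R, 1 < p -> p < q ->
    (forall s t f, I s -> s < t ->
       f \in Lfun (mu s) p%:E -> T t s f \in Lfun (mu t) q%:E) /\
    exists C : R -> R,
      [/\ forall r, 0 < r -> 0 < C r,
          forall r r', 0 < r -> r < r' -> C r' < C r,
          C r @[r --> 0^'+] --> +oo
        & forall s t, I s -> s < t ->
            (Lp_opnorm p q (mu s) (mu t) (T t s) <= (C (t - s))%:E)%E].

End Space.

(* Main.v *)
Require Import Defs.
From mathcomp Require Import all_boot all_order all_algebra.
From mathcomp Require Import all_classical all_reals all_analysis.
From mathcomp Require Import ring lra measurable_realfun simple_functions.

Import Order.TTheory GRing.Theory Num.Theory.
Import numFieldNormedType.Exports.

Local Open Scope classical_set_scope.
Local Open Scope ring_scope.

(** Supercontractivity comes from two facts, a dimension-free Harnack inequality for G(t,s) and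
the uniform boundedness in t of all the Gaussian moments of mu_t.

Harnack inequality ([harnack]). For p > 1 there is c > 0 such that, for f >= del > 0 with ln f
Lipschitz, u = G(t,s)f and v = G(t,s)(f^p),
<<
  u(t,x)^p <= v(t,y) exp(c |x - y|^2 / (t - s)).
>>
It is a maximum principle in the doubled space R^d x R^d for the function
p ln u(t,x) - ln v(t,y) - c |x - y|^2 / (t - s). At a maximum the gradients of p ln u and ln v are
both 2c(x - y)/(t - s). The equation of a logarithm has a quadratic gradient term, and with weight
1/p for p ln u and 1 for ln v these leave -(1 - 1/p) times the square of that common gradient in
the metric Q(t), which beats the time derivative of |x - y|^2 / (t - s). The second-derivative test
is applied only along the diagonal directions (xi, xi), on which |x - y|^2 is constant, so that
the penalty costs no second-order term, and its drift is 2 <b(x) - b(y), x - y> <= 0. Neither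
gradient estimates nor a representation of G(t,s) are involved. Coercivity is restored
by a small multiple of |x|^2 + |y|^2 ([coupling_estimate], [harnack_no_interior_max]).

Gaussian moments ([exp_integrable]). The drift condition makes A(t) exp(l |x|^2) very
negative at infinity for every l. Inside the ball where the condition says nothing, <b(t,x), x>
may be unbounded as t varies, so the Lyapunov function is taken constant on a large ball: it is
exp(l z) minus its Taylor polynomial of degree 2, z = (|x|^2 - rho)^+. It satisfies
A psi <= a - psi ([lyap_drift]), hence G(t,s) min(psi,n) <= exp(s - t) psi + a; integrating
against mu_t and letting t go to infinity, tightness gives mu_s(psi) <= a for every s.

Conclusion. Integrating the Harnack inequality in y over a ball of mu_t-mass at least 1/2 and
using the invariance of (mu_t) gives
|G(t,s)f(x)|^p <= 2 exp(c' (1 + |x|^2) / (t - s)) mu_s(|f|^p), up to an arbitrarily small shift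
of |f| ([evolution_pointwise_bound]); raising to the power q/p and integrating in x gives the
L^p to L^q bound for bounded Lipschitz f ([evolution_Lq_bound]), uniformly for t - s >= r. These
f are dense in L^p(mu_s) ([lipschitz_dense]), and the bound passes to the extension by truncation
([extension_bound]). *)

(** * Euclidean products and traces of products *)

Section Algebra.
Context {R : realType}.

Section Dot.
Context {d : nat}.
Implicit Types (x y z xi : 'rV[R]_d) (A B M : 'M[R]_d).

Lemma dotp_mx x y : dotp x y = (x *m y^T) 0 0.
Proof. by rewrite /dotp mxE; apply: eq_bigr => i _; rewrite mxE. Qed.

Lemma dotpC x y : dotp x y = dotp y x.
Proof. by apply: eq_bigr => i _; rewrite mulrC. Qed.

Lemma dotpDl x y z : dotp (x + y) z = dotp x z + dotp y z.
Proof. by rewrite !dotp_mx mulmxDl mxE. Qed.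

Lemma dotpZl a x y : dotp (a *: x) y = a * dotp x y.
Proof. by rewrite !dotp_mx -scalemxAl mxE. Qed.

Lemma dotpNl x y : dotp (- x) y = - dotp x y.
Proof. by rewrite !dotp_mx mulNmx mxE. Qed.

Lemma dotpBl x y z : dotp (x - y) z = dotp x z - dotp y z.
Proof. by rewrite dotpDl dotpNl. Qed.

Lemma dotpDr x y z : dotp z (x + y) = dotp z x + dotp z y.
Proof. by rewrite dotpC dotpDl !(dotpC z). Qed.

Lemma dotpZr a x y : dotp y (a *: x) = a * dotp y x.
Proof. by rewrite dotpC dotpZl dotpC. Qed.

Lemma dotpNr x y : dotp y (- x) = - dotp y x.
Proof. by rewrite dotpC dotpNl dotpC. Qed.

Lemma dotpBr x y z : dotp z (x - y) = dotp z x - dotp z y.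
Proof. by rewrite dotpDr dotpNr. Qed.

Lemma dotp0l x : dotp 0 x = 0.
Proof. by rewrite dotp_mx mul0mx mxE. Qed.

Lemma dotp_ge0 x : 0 <= dotp x x.
Proof. by apply: sumr_ge0 => i _; rewrite -expr2 sqr_ge0. Qed.

Lemma enormE x : enorm x ^+ 2 = dotp x x.
Proof. by rewrite sqr_sqrtr ?dotp_ge0. Qed.

Lemma enorm_ge0 x : 0 <= enorm x.
Proof. exact: sqrtr_ge0. Qed.

Lemma normr_le_enorm x : `|x| <= enorm x.
Proof.
rewrite /Num.Def.normr/= mx_normrE; apply/bigmax_leP; split; first exact: enorm_ge0.
move=> -[i j] _ /=; rewrite -sqrtr_sqr ler_wsqrtr // ord1 /dotp (bigD1 j) //=.
by rewrite -expr2 lerDl sumr_ge0 // => k _; rewrite -expr2 sqr_ge0.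
Qed.

Lemma dotp_delta x i : dotp x (delta_mx 0 i) = x 0 i.
Proof.
rewrite /dotp (bigD1 i) //= mxE !eqxx mulr1 big1 ?addr0 // => j ji.
by rewrite mxE (negbTE ji) andbF mulr0.
Qed.

Lemma dotp_young x y (k : R) : 0 < k -> 2 * dotp x y <= k * dotp x x + k^-1 * dotp y y.
Proof.
move=> k0; have := dotp_ge0 (k *: x - y).
rewrite !(dotpBl, dotpBr, dotpZl, dotpZr) (dotpC y x) => h.
have : 0 <= k^-1 * (k * (k * dotp x x) - k * dotp x y - (k * dotp x y - dotp y y)).
  by apply: mulr_ge0; [rewrite invr_ge0 ltW|lra].
have -> : k^-1 * (k * (k * dotp x x) - k * dotp x y - (k * dotp x y - dotp y y)) =
  k * dotp x x + k^-1 * dotp y y - 2 * dotp x y by field; rewrite gt_eqF.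
by rewrite subr_ge0.
Qed.

Lemma qformE A x y : dotp (x *m A) y = \sum_i \sum_j x 0 j * A j i * y 0 i.
Proof. by apply: eq_bigr => i _; rewrite mxE big_distrl. Qed.

Lemma qform_trmx A x y : dotp (x *m A^T) y = dotp (y *m A) x.
Proof.
rewrite !qformE exchange_big; apply: eq_bigr => i _; apply: eq_bigr => j _.
by rewrite mxE; ring.
Qed.

End Dot.

Lemma tr_mulmxE n (A B : 'M[R]_n) : \tr (A *m B) = \sum_i \sum_j A i j * B j i.
Proof. by apply: eq_bigr => i _; rewrite mxE. Qed.

(** The case of a rank-one A = v^T v is the hypothesis on M. Lagrange's reduction splits such a
  piece off A and leaves the Schur complement, a positive form in one variable less. *)
Lemma tr_mulmx_le0 n (A M : 'M[R]_n) : A^T = A ->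
  (forall x : 'rV[R]_n, x != 0 -> 0 < dotp (x *m A) x) ->
  (forall x : 'rV[R]_n, dotp (x *m M) x <= 0) -> \tr (A *m M) <= 0.
Proof.
elim: n => [|n IH] in A M * => Asym Apos Mneg.
  by rewrite /mxtrace big_ord0.
have Aji i j : A j i = A i j by rewrite -{1}Asym mxE.
set a := A 0 0.
have a0 : 0 < a.
  have := Apos (delta_mx 0 0); rewrite dotp_delta -rowE mxE; apply.
  by apply/eqP => /matrixP/(_ 0 0)/eqP; rewrite !mxE !eqxx oner_eq0.
pose v : 'rV[R]_n.+1 := row 0 A.
pose S : 'M[R]_n := \matrix_(i, j) (A (lift 0 i) (lift 0 j) - a^-1 * v 0 (lift 0 i) * v 0 (lift 0 j)).
pose M' : 'M[R]_n := \matrix_(i, j) M (lift 0 i) (lift 0 j).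
have trE : \tr (A *m M) = a^-1 * dotp (v *m M) v + \tr (S *m M').
  rewrite !tr_mulmxE qformE [X in _ = a^-1 * X + _]exchange_big !big_ord_recl /= !mxE -/a.
  have -> : \sum_i \sum_j S i j * M' j i = \sum_i \sum_j A (lift 0 i) (lift 0 j) * M (lift 0 j) (lift 0 i)
     - a^-1 * \sum_i \sum_j A 0 (lift 0 i) * A 0 (lift 0 j) * M (lift 0 j) (lift 0 i).
    rewrite mulr_sumr -sumrB; apply: eq_bigr => i _; rewrite mulr_sumr -sumrB.
    by apply: eq_bigr => j _; rewrite !mxE; ring.
  have -> : \sum_(i < n) \sum_j A (lift 0 i) j * M j (lift 0 i) =
     \sum_(i < n) A (lift 0 i) 0 * M 0 (lift 0 i) +
     \sum_(i < n) \sum_(j < n) A (lift 0 i) (lift 0 j) * M (lift 0 j) (lift 0 i).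
    by rewrite -big_split; apply: eq_bigr => i _; rewrite big_ord_recl.
  have -> : \sum_(i < n) \sum_j v 0 (lift 0 i) * M (lift 0 i) j * v 0 j =
     a * \sum_(i < n) v 0 (lift 0 i) * M (lift 0 i) 0 +
     \sum_(i < n) \sum_(j < n) A 0 (lift 0 i) * A 0 (lift 0 j) * M (lift 0 j) (lift 0 i).
    rewrite [X in _ = _ + X]exchange_big mulr_sumr -big_split; apply: eq_bigr => i _ /=.
    rewrite big_ord_recl mxE [X in _ + X = _](_ : _ =
      \sum_(j < n) A 0 (lift 0 j) * A 0 (lift 0 i) * M (lift 0 i) (lift 0 j)); last first.
      by apply: eq_bigr => j _; rewrite !mxE; ring.
    by rewrite !mxE -/a; ring.
  have -> : \sum_(i < n) v 0 (lift 0 i) * M (lift 0 i) 0 = \sum_(i < n) A 0 (lift 0 i) * M (lift 0 i) 0.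
    by apply: eq_bigr => i _; rewrite mxE.
  have -> : \sum_(i < n) A (lift 0 i) 0 * M 0 (lift 0 i) = \sum_(i < n) A 0 (lift 0 i) * M 0 (lift 0 i).
    by apply: eq_bigr => i _; rewrite Aji.
  have -> : \sum_(i < n) a * M 0 (lift 0 i) * v 0 (lift 0 i) = a * \sum_(i < n) A 0 (lift 0 i) * M 0 (lift 0 i).
    by rewrite mulr_sumr; apply: eq_bigr => i _; rewrite !mxE; ring.
  by field; rewrite gt_eqF.
rewrite trE -[leRHS]addr0 lerD //.
  by rewrite mulr_ge0_le0 // invr_ge0 ltW.
apply: IH => [|y y0|y].
- by apply/matrixP => i j; rewrite !mxE Aji; ring.
(* y is completed by the first coordinate that minimises the form A *)
- pose w := \sum_j v 0 (lift 0 j) * y 0 j.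
  pose x : 'rV[R]_n.+1 := \row_i (if unlift 0 i is Some j then y 0 j else - a^-1 * w).
  have x00 : x 0 0 = - a^-1 * w by rewrite mxE unlift_none.
  have x0l j : x 0 (lift 0 j) = y 0 j by rewrite mxE liftK.
  have : x != 0.
    apply: contra_neq y0 => x0; apply/matrixP => i j.
    by rewrite ord1 -x0l x0 !mxE.
  move=> /Apos; congr (_ < _).
  rewrite !qformE big_ord_recl big_ord_recl -/a x00.
  have -> : \sum_(i < n) x 0 (lift 0 i) * A (lift 0 i) 0 * (- a^-1 * w) = (- a^-1 * w) * w.
    by rewrite -mulr_suml [LHS]mulrC; congr (_ * _); apply: eq_bigr => i _; rewrite x0l mxE Aji mulrC.
  have -> : \sum_(i < n) \sum_j x 0 j * A j (lift 0 i) * x 0 (lift 0 i) =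
    (- a^-1 * w) * w + \sum_(i < n) \sum_(j < n) y 0 j * A (lift 0 j) (lift 0 i) * y 0 i.
    rewrite {2}/w mulr_sumr -big_split; apply: eq_bigr => i _ /=.
    rewrite big_ord_recl x00 x0l !mxE; congr (_ + _); first by ring.
    by apply: eq_bigr => j _; rewrite x0l.
  have -> : \sum_i \sum_j y 0 j * S j i * y 0 i =
     \sum_(i < n) \sum_(j < n) y 0 j * A (lift 0 j) (lift 0 i) * y 0 i - a^-1 * (w * w).
    rewrite {1}/w big_distrl /= mulr_sumr -sumrB; apply: eq_bigr => i _.
    rewrite /w !mulr_sumr -sumrB; apply: eq_bigr => j _.
    by rewrite !mxE; ring.
  by field; rewrite gt_eqF.
- pose x : 'rV[R]_n.+1 := \row_i (if unlift 0 i is Some j then y 0 j else 0).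
  have x00 : x 0 0 = 0 by rewrite mxE unlift_none.
  have x0l j : x 0 (lift 0 j) = y 0 j by rewrite mxE liftK.
  have := Mneg x; congr (_ <= _).
  rewrite !qformE big_ord_recl big1 ?add0r; last by move=> i _; rewrite x00 mulr0.
  apply: eq_bigr => i _; rewrite big_ord_recl x00 !mul0r add0r.
  by apply: eq_bigr => j _; rewrite !x0l mxE.
Qed.

End Algebra.

(** * Directional derivatives and jets along lines *)

Section Calculus.
Context {R : realType}.

Lemma is_derive_epsP {V : normedModType R} (f : V -> R) x v (l : R) :
  (forall e : R, 0 < e -> exists2 del : R, 0 < del & forall h : R, h != 0 -> `|h| < del ->
     `|h^-1 * (f (h *: v + x) - f x) - l| <= e) <-> is_derive x v f l.
Proof.
split=> [H|[dfv <-] e e0].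
  have lE : (fun h => h^-1 *: (f (h *: v + x) - f x)) @ 0^' --> l.
    apply/cvgrPdist_le => e e0; have [del del0 Hd] := H _ e0.
    exists del => //= h; rewrite /ball_ /= sub0r normrN => hd h0.
    by rewrite distrC; apply: Hd.
  split; first by apply/cvg_ex; exists l.
  by apply: cvg_lim.
have : (fun h => h^-1 *: (f (h *: v + x) - f x)) @ 0^' --> 'D_v f x.
  exact: dfv.
move=> /cvgrPdist_le/(_ _ e0)[del /= del0 Hd].
exists del => // h h0 hd; rewrite distrC; apply: Hd => //.
by rewrite /ball_ /= sub0r normrN.
Qed.

Lemma is_derive_line {V : normedModType R} (f : V -> R) (a v : V) (r l : R) :
  is_derive (r *: v + a) v f l -> is_derive r 1 (fun t => f (t *: v + a)) l.
Proof.
move=> /is_derive_epsP H; apply/is_derive_epsP => e /H[del del0 Hd].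
exists del => // h h0 hd; have := Hd h h0 hd.
by rewrite scalerDl -addrA [h *: 1]mulr1.
Qed.

Lemma mvt_from0 (f df : R -> R) : (forall x : R, is_derive x 1 f (df x)) ->
  forall b : R, exists2 c : R, 0 <= c <= 1 & f b - f 0 = df (c * b) * b.
Proof.
move=> fdf b.
have dfb (x : R) : is_derive x 1 (fun r => f (r * b)) (df (x * b) * b).
  apply: (@is_derive1_comp R f (fun r => r * b)).
  have -> : (fun r : R => r * b) = b \*: id by apply/funext => r /=; rewrite mulrC.
  by apply: is_derive_eq; rewrite [LHS]mulr1.
have [|c] := @MVT_segment R (fun r => f (r * b)) _ 0 1 ler01 (fun x _ => dfb x).
  by apply: derivable_within_continuous => x _; have [] := dfb x.
rewrite in_itv /= mul1r mul0r subr0 mulr1 => c01 E; exists c => //.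
Qed.

(** The increment along h(v + w) is the increment along hv followed by one along hw; the mean
  value theorem expresses the latter by Dw at a point close to x, whence the continuity
  requirement on Dw alone. *)
Lemma is_deriveDdir {V : normedModType R} (f : V -> R) (v w : V) (Dv Dw : V -> R) :
  (forall x, is_derive x v f (Dv x)) -> (forall x, is_derive x w f (Dw x)) ->
  continuous Dw -> forall x, is_derive x (v + w) f (Dv x + Dw x).
Proof.
move=> fv fw cw x; apply/is_derive_epsP => e e0.
have e20 : 0 < e / 2 by rewrite divr_gt0.
have [d1 d10 Hd1] := (is_derive_epsP _ _ _ _).2 (fv x) _ e20.
have /cvgrPdist_le/(_ _ e20)/nbhs_ballP[d2 /= d20 Hd2] := cw x.
pose N := `|v| + `|w| + 1.
have N0 : 0 < N by rewrite ltr_wpDl // addr_ge0.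
exists (Num.min d1 (d2 / N)); first by rewrite lt_min d10 divr_gt0.
move=> h h0; rewrite lt_min => /andP[hd1 hd2].
have [c /andP[c0 c1] Ec] := mvt_from0 _ _ (fun r => is_derive_line f (h *: v + x) w r _ (fw _)) h.
rewrite scale0r add0r in Ec.
have -> : h^-1 * (f (h *: (v + w) + x) - f x) - (Dv x + Dw x) =
  (h^-1 * (f (h *: v + x) - f x) - Dv x) + (Dw ((c * h) *: w + (h *: v + x)) - Dw x).
  have -> : h *: (v + w) + x = h *: w + (h *: v + x) by rewrite scalerDr addrCA !addrA.
  have -> : Dw ((c * h) *: w + (h *: v + x)) = h^-1 * (f (h *: w + (h *: v + x)) - f (h *: v + x)).
    by rewrite Ec mulrCA mulVf ?mulr1.
  ring.
rewrite (le_trans (ler_normD _ _)) // [leRHS](splitr e) lerD //; first exact: Hd1.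
rewrite distrC; apply: Hd2 => /=.
rewrite -ball_normE /= distrC addrA addrK.
rewrite (le_lt_trans (ler_normD _ _)) // !normrZ.
move: hd2; rewrite ltr_pdivlMr //; apply: le_lt_trans.
rewrite (ger0_norm c0) /N !mulrDr mulr1.
have := ler_piMl (mulr_ge0 (normr_ge0 h) (normr_ge0 w)) c1.
rewrite !mulrA => ?.
by have := normr_ge0 h; lra.
Qed.

Lemma is_deriveZdir {V : normedModType R} (f : V -> R) (v : V) (k : R) x (D : R) :
  is_derive x v f D -> is_derive x (k *: v) f (k * D).
Proof.
move=> fv; have [->|k0] := eqVneq k 0.
  by rewrite scale0r mul0r; exact: is_derive0.
apply/is_derive_epsP => e e0.
have ek0 : 0 < e / `|k| by rewrite divr_gt0 ?normr_gt0.
have [d1 d10 Hd1] := (is_derive_epsP _ _ _ _).2 (fv) _ ek0.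
exists (d1 / `|k|); first by rewrite divr_gt0 ?normr_gt0.
move=> h h0; rewrite ltr_pdivlMr ?normr_gt0 // => hd.
have := Hd1 (h * k); rewrite mulf_neq0 // normrM => /(_ isT hd).
rewrite ler_pdivlMr ?normr_gt0 // -normrM scalerA; congr (`|_| <= _).
by field; rewrite h0.
Qed.

Section Partials.
Context {d : nat}.
Implicit Types (f : 'rV[R]_d -> R) (x xi : 'rV[R]_d).

(** The coordinate directions are given; directions of differentiability are closed under scaling
  and, by [is_deriveDdir], under sums. *)
Lemma is_derive_grad f : (forall i x, pderivable i f x) ->
  (forall i, continuous (partial i f)) ->
  forall x xi, is_derive x xi f (dotp (grad f x) xi).
Proof.
move=> df cf x xi.
suff H (s : seq 'I_d) : (forall y, is_derive y (\sum_(i <- s) xi 0 i *: delta_mx 0 i) f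
    (\sum_(i <- s) xi 0 i * partial i f y)).
  have := H (index_enum 'I_d) x.
  by rewrite -row_sum_delta; congr is_derive; apply: eq_bigr => i _; rewrite mxE mulrC.
elim: s => [|i s IH] y; first by rewrite !big_nil; exact: is_derive0.
have Dfi z : is_derive z (xi 0 i *: delta_mx 0 i) f (xi 0 i * partial i f z).
  by apply: is_deriveZdir; apply: derivableP; exact: df.
rewrite !big_cons addrC [X in is_derive _ _ _ X]addrC; move: y.
apply: (@is_deriveDdir _ _ _ _ (fun y => \sum_(j <- s) xi 0 j * partial j f y)
  (fun z => xi 0 i * partial i f z)) => //.
by move=> z; exact: (cvgMl_tmp (cf i z)).
Qed.

End Partials.

(** [p] and [q] are the first and second derivatives at 0; the first derivative is asked to exist
  everywhere. *)
Definition jet (phi : R -> R) (p q : R) := exists phi1 : R -> R,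
  [/\ forall r : R, is_derive r 1 phi (phi1 r), phi1 0 = p & is_derive (0 : R) 1 phi1 q].

Lemma jet_eq phi p q p' q' : jet phi p q -> p = p' -> q = q' -> jet phi p' q'.
Proof. by move=> ? <- <-. Qed.

Lemma jet_cst c : jet (fun=> c) 0 0.
Proof. by exists (fun=> 0); split => [r||] //; exact: is_derive_cst. Qed.

Lemma jet_id c : jet (fun r => r + c) 1 0.
Proof.
exists (fun=> 1); split=> [r||] //; last exact: is_derive_cst.
exact: is_derive_shift.
Qed.

Lemma jetD phi p q psi p' q' : jet phi p q -> jet psi p' q' ->
  jet (fun r => phi r + psi r) (p + p') (q + q').
Proof.
move=> [f1 [Hf <- Hq]] [g1 [Hg <- Hq']]; exists (fun r => f1 r + g1 r); split => //.
  by move=> r; apply: is_deriveD.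
exact: is_deriveD.
Qed.

Lemma jetZ c phi p q : jet phi p q -> jet (fun r => c * phi r) (c * p) (c * q).
Proof.
move=> [f1 [Hf <- Hq]]; exists (fun r => c * f1 r); split => //.
  by move=> r; apply: is_deriveZ.
exact: is_deriveZ.
Qed.

Lemma jetB phi p q psi p' q' : jet phi p q -> jet psi p' q' ->
  jet (fun r => phi r - psi r) (p - p') (q - q').
Proof.
move=> [f1 [Hf <- Hq]] [g1 [Hg <- Hq']]; exists (fun r => f1 r - g1 r); split => //.
  by move=> r; apply: is_deriveB.
exact: is_deriveB.
Qed.

Lemma jetM phi p q psi p' q' : jet phi p q -> jet psi p' q' ->
  jet (fun r => phi r * psi r) (phi 0 * p' + psi 0 * p)
    (phi 0 * q' + psi 0 * q + 2 * p * p').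
Proof.
move=> [f1 [Hf <- Hq]] [g1 [Hg <- Hq']].
exists (fun r => phi r * g1 r + psi r * f1 r); split => //.
  by move=> r; apply: is_deriveM.
have H1 : is_derive (0 : R) 1 (fun r => phi r * g1 r) (phi 0 *: q' + g1 0 *: f1 0).
  exact: is_deriveM.
have H2 : is_derive (0 : R) 1 (fun r => psi r * f1 r) (psi 0 *: q + f1 0 *: g1 0).
  exact: is_deriveM.
have H := @is_deriveD _ _ _ _ _ _ _ _ _ H1 H2.
apply: (is_derive_eq H).
by rewrite /GRing.scale /=; ring.
Qed.

Lemma jet_comp (F F1 : R -> R) F2 phi p q : jet phi p q ->
  (forall r : R, is_derive (phi r) 1 F (F1 (phi r))) -> is_derive (phi 0) 1 F1 F2 ->
  jet (fun r => F (phi r)) (F1 (phi 0) * p) (F2 * p ^+ 2 + F1 (phi 0) * q).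
Proof.
move=> [f1 [Hf <- Hq]] HF HF1.
exists (fun r => F1 (phi r) * f1 r); split => //.
  by move=> r; apply: (is_derive1_comp (f := F)).
have H1 : is_derive (0 : R) 1 (fun r => F1 (phi r)) (F2 * f1 0).
  exact: (is_derive1_comp (f := F1)).
have H2 := @is_deriveM _ _ _ _ _ _ _ _ H1 Hq.
apply: (is_derive_eq H2).
by rewrite /GRing.scale /=; ring.
Qed.

Lemma jet_ln phi p q : jet phi p q -> (forall r, 0 < phi r) ->
  jet (fun r => ln (phi r)) (p / phi 0) (q / phi 0 - (p / phi 0) ^+ 2).
Proof.
move=> jp pos.
have := @jet_comp (@ln R) (fun x => x^-1) (- (phi 0) ^- 2) phi p q jp.
move=> H; apply: jet_eq; first apply: H.
- by move=> r; exact: is_derive1_ln.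
- have := @is_deriveV R id (phi 0) 1 1; rewrite gt_eqF // => /(_ isT (is_derive_id _ _)).
  by move/is_derive_eq; apply; rewrite [LHS]mulr1.
- by rewrite mulrC.
- by field; rewrite gt_eqF.
Qed.

(** If q > 0 then the derivative is positive just to the right of 0, and the mean value theorem
  contradicts maximality. *)
Lemma jet_max phi p q : jet phi p q -> (forall r, phi r <= phi 0) -> p = 0 /\ q <= 0.
Proof.
move=> [f1 [Hf <- Hq]] phimax.
have in11 : (0 : R) \in `]-1, 1[ by rewrite in_itv /=; lra.
have f10 : f1 0 = 0.
  have H1 : is_derive (0 : R) 1 phi 0.
    apply: (@derive1_at_max _ _ (-1) 1) => //.
  have [_ <-] := Hf 0.
  by have [_ ->] := H1.
split=> //; rewrite leNgt; apply/negP => q0.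
have q20 : 0 < q / 2 by rewrite divr_gt0.
have [del del0 Hd] := (is_derive_epsP _ _ _ _).2 (Hq) _ q20.
have h0 : 0 < del / 2 by rewrite divr_gt0.
have [|c] := @MVT R phi f1 0 (del / 2) h0 (fun x _ => Hf x).
  by apply: derivable_within_continuous => x _; have [] := Hf x.
rewrite in_itv /= => /andP[c0 cd]; rewrite subr0 => E.
have := Hd c; rewrite gt_eqF // gtr0_norm // [c *: _]mulr1 addr0 f10 subr0 => /(_ isT).
have -> : c < del by lra.
move=> /(_ isT); rewrite ler_norml => /andP[+ _].
have -> : (- (q / 2) <= c^-1 * f1 c - q) = (q / 2 <= c^-1 * f1 c) by apply/idP/idP; lra.
rewrite ler_pdivlMl // => f1c.
have := phimax (del / 2); rewrite -subr_le0 E; apply/negP; rewrite -ltNge mulr_gt0 //.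
by apply: lt_le_trans f1c; rewrite mulr_gt0.
Qed.

End Calculus.

Arguments jet_eq {R phi p q p' q'}.
Arguments jetD {R phi p q psi p' q'}.
Arguments jetB {R phi p q psi p' q'}.
Arguments jetM {R phi p q psi p' q'}.
Arguments jetZ {R} c {phi p q}.
Arguments jet_max {R phi p q}.

(** * Functions of time and space *)

Section Continuity.
Context {R : realType} {E : topologicalType}.
Implicit Types F G : E -> R.

Lemma contD F G : continuous F -> continuous G -> continuous (fun z => F z + G z).
Proof. by move=> cF cG z; apply: continuousD; [exact: cF|exact: cG]. Qed.

Lemma contB F G : continuous F -> continuous G -> continuous (fun z => F z - G z).
Proof. by move=> cF cG z; apply: continuousB; [exact: cF|exact: cG]. Qed.

Lemma contM F G : continuous F -> continuous G -> continuous (fun z => F z * G z).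
Proof. by move=> cF cG z; apply: continuousM; [exact: cF|exact: cG]. Qed.

Lemma contC (c : R) : continuous (fun _ : E => c).
Proof. exact: cst_continuous. Qed.

Lemma cont_ln (F : E -> R) : continuous F ->
  (forall z, 0 < F z) -> continuous (fun z => ln (F z)).
Proof. by move=> cF F0 z; exact: (continuous_comp (cF z) (continuous_ln (F0 z))). Qed.

Lemma contV (F : E -> R) : continuous F ->
  (forall z, F z != 0) -> continuous (fun z => (F z)^-1).
Proof. by move=> cF F0 z; apply: cvgV; [exact: F0|exact: cF]. Qed.

Lemma cont_comp (E' : topologicalType) (F : E -> R) (g : E' -> E) : continuous F ->
  continuous g -> continuous (fun z => F (g z)).
Proof. by move=> cF cg z; exact: (continuous_comp (cg z) (cF (g z))). Qed.

End Continuity.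

Section SpaceTime.
Context {R : realType} {d : nat}.
Notation V := 'rV[R]_d.
Implicit Types (f : V -> R) (x y xi : V) (s t T th tau : R).

(** Jets are taken line by line, which is all that second-derivative tests see; H stands for the
  Hessian but need not be symmetric. *)
Definition vjet f x (g : V) (H : 'M[R]_d) :=
  forall xi, jet (fun r => f (r *: xi + x)) (dotp g xi) (dotp (xi *m H) xi).

(** Apply [is_derive_grad] to f and then to each of its partial derivatives. *)
Lemma vjet_C2 f x : (forall i y, pderivable i f y) ->
  (forall i, continuous (partial i f)) ->
  (forall i j y, pderivable i (partial j f) y) ->
  (forall i j, continuous (partial i (partial j f))) -> vjet f x (grad f x) (hess f x).
Proof.
move=> df cf ddf cdf xi.
exists (fun r => dotp (grad f (r *: xi + x)) xi); split => [r||].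
- by apply: is_derive_line; exact: is_derive_grad.
- by rewrite scale0r add0r.
- have H i : is_derive (0 : R) 1 (fun r => partial i f (r *: xi + x) * xi 0 i)
      (xi 0 i * dotp (grad (partial i f) x) xi).
    rewrite (_ : (fun r => _) = (fun r => xi 0 i * partial i f (r *: xi + x))); last first.
      by apply/funext => r; rewrite mulrC.
    apply: is_deriveZ; apply: is_derive_line; rewrite scale0r add0r.
    by apply: (is_derive_grad (partial i f)) => [j y|j]; [exact: ddf|exact: cdf].
  have {}H := @is_derive_sum _ _ _ _ _ _ _ _ H.
  have -> : (fun r => dotp (grad f (r *: xi + x)) xi) =
     \sum_(i < d) (fun r => partial i f (r *: xi + x) * xi 0 i).
    apply/funext => r; rewrite fct_sumE; apply: eq_bigr => i _.
    by rewrite mxE.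
  apply: (is_derive_eq H); rewrite qformE; apply: eq_bigr => i _.
  rewrite mulr_sumr; apply: eq_bigr => j _.
  by rewrite !mxE; ring.
Qed.

Lemma jet_sq (a xi : V) :
  jet (fun r => dotp (r *: xi + a) (r *: xi + a)) (2 * dotp a xi) (2 * dotp xi xi).
Proof.
have -> : (fun r => dotp (r *: xi + a) (r *: xi + a)) = (fun r =>
   dotp xi xi * ((r + 0) * (r + 0)) + (2 * dotp a xi * (r + 0) + dotp a a)).
  apply/funext => r; rewrite !(dotpDl, dotpDr, dotpZl, dotpZr) (dotpC xi a); ring.
have H := jetD (jetZ (dotp xi xi) (jetM (jet_id 0) (jet_id 0)))
   (jetD (jetZ (2 * dotp a xi) (jet_id 0)) (jet_cst (dotp a a))).
by apply: (jet_eq H); ring.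
Qed.

Lemma vjetD f1 f2 x g1 g2 H1 H2 : vjet f1 x g1 H1 -> vjet f2 x g2 H2 ->
  vjet (fun y => f1 y + f2 y) x (g1 + g2) (H1 + H2).
Proof.
move=> J1 J2 xi; rewrite mulmxDr !dotpDl; exact: jetD.
Qed.

Lemma vjetZ c f x g H : vjet f x g H -> vjet (fun y => c * f y) x (c *: g) (c *: H).
Proof.
move=> J xi; rewrite -scalemxAr !dotpZl; exact: jetZ.
Qed.

Lemma vjet_cst c x : vjet (fun=> c) x 0 0.
Proof. by move=> xi; rewrite mulmx0 !dotp0l; exact: jet_cst. Qed.

Lemma vjet_sq x : vjet (fun y => dotp y y) x (2 *: x) 2%:M.
Proof. by move=> xi; rewrite mul_mx_scalar !dotpZl; exact: jet_sq. Qed.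

Lemma vjetB f1 f2 x g1 g2 H1 H2 : vjet f1 x g1 H1 -> vjet f2 x g2 H2 ->
  vjet (fun y => f1 y - f2 y) x (g1 - g2) (H1 - H2).
Proof.
move=> J1 J2 xi; rewrite mulmxBr !dotpBl; exact: jetB.
Qed.

Lemma dotp_eq (g h : V) : (forall xi, dotp g xi = dotp h xi) -> g = h.
Proof.
by move=> E; apply/matrixP => i j; rewrite ord1 -!dotp_delta E.
Qed.

Lemma vjet_max f x g H : vjet f x g H -> (forall y, f y <= f x) ->
  g = 0 /\ forall xi, dotp (xi *m H) xi <= 0.
Proof.
move=> J fmax.
have J' xi : dotp g xi = 0 /\ dotp (xi *m H) xi <= 0.
  by apply: jet_max (J xi) _ => r; rewrite scale0r add0r.
split; last by move=> xi; have [] := J' xi.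
by apply: dotp_eq => xi; rewrite dotp0l; have [] := J' xi.
Qed.

(** Only times before t are compared with t, so that t may be the right end of the time interval. *)
Lemma is_derive_left_max (w : R -> R) (s t l : R) : is_derive t 1 w l -> s < t ->
  (forall r, s <= r -> r <= t -> w r <= w t) -> 0 <= l.
Proof.
move=> dw st wmax; rewrite leNgt; apply/negP => l0.
have l20 : 0 < - l / 2 by rewrite divr_gt0 // oppr_gt0.
have [del del0 Hd] := (is_derive_epsP _ _ _ _).2 dw _ l20.
pose h := - Num.min (del / 2) (t - s).
have h0 : h < 0 by rewrite oppr_lt0 lt_min divr_gt0 // subr_gt0.
have hd : `|h| < del by rewrite normrN gtr0_norm -?oppr_lt0 // gt_min; apply/orP; left; lra.
have hs : s <= h + t.
  have : Num.min (del / 2) (t - s) <= t - s by rewrite ge_min lexx orbT.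
  by rewrite /h; lra.
have := Hd h (ltr0_neq0 h0) hd; rewrite [h *: _]mulr1 ler_norml => /andP[_].
have : 0 <= h^-1 * (w (h + t) - w t).
  apply: mulr_le0; first by rewrite invr_le0 ltW.
  by rewrite subr_le0 wmax // gerDr ltW.
by lra.
Qed.

Lemma continuous_dotp (T : topologicalType) (f g : T -> V) : continuous f ->
  continuous g -> continuous (fun z => dotp (f z) (g z)).
Proof.
move=> cf cg; suff H (e : seq 'I_d) : continuous (fun z => \sum_(i <- e) f z 0 i * g z 0 i).
  exact: H.
elim: e => [|i e IH].
  rewrite (_ : (fun z => _) = cst 0); first exact: cst_continuous.
  by apply/funext => z; rewrite big_nil.
rewrite (_ : (fun z => _) = (fun z => f z 0 i * g z 0 i) +
    (fun z => \sum_(j <- e) f z 0 j * g z 0 j)); last first.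
  by apply/funext => z; rewrite big_cons.
have cc (h : T -> V) : continuous h -> continuous (fun z => h z 0 i).
  by move=> ch z; exact: (continuous_comp (ch z) (@coord_continuous R 1 d 0 i (h z))).
by move=> z; apply: continuousD; [apply: continuousM; exact: cc|exact: IH].
Qed.

Lemma compact_ball (r : R) : compact [set x : V | dotp x x <= r].
Proof.
apply: bounded_closed_compact; last first.
  have : closed ((fun x : V => dotp x x) @^-1` [set y | y <= r]).
    apply: preimage_closed (@closed_le _ r) => x _.
    by apply: continuous_dotp => y; exact: cvg_id.
  by [].
exists (Num.sqrt r); split => [|M rM x /= xr]; first exact: num_real.
apply: le_trans (ltW rM); apply: le_trans (normr_le_enorm _) _.
by rewrite /enorm; apply: ler_wsqrtr.
Qed.

Lemma holder_continuous th (J : set R) (u : R -> V -> R) t : 0 < th ->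
  parabolic_holder_loc th J u -> J t -> continuous (u t).
Proof.
move=> th0 Hu Jt x; apply/(@cvgrPdist_le _ _ _ (nbhs x)) => e e0.
pose r := dotp x x + 1.
have cK : compact ([set t] `*` [set y : V | dotp y y <= r]).
  by apply: compact_setX; [exact: compact_set1|exact: compact_ball].
have [|M HM] := Hu _ cK; first by move=> [t' y] /= [-> _].
have M0 : 0 < `|M| + 1 by rewrite ltr_wpDl.
pose c := (e / (`|M| + 1)) `^ th^-1.
have c0 : 0 < c by rewrite powR_gt0 // divr_gt0.
have cc : c `^ th = e / (`|M| + 1).
  by rewrite -powRrM mulVf ?gt_eqF // powRr1 // ltW // divr_gt0.
have near1 : \forall y \near x, dotp y y < r.
  have cd : {for x, continuous (fun y : V => dotp y y)}.
    by apply: continuous_dotp => y; exact: cvg_id.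
  by apply: (cvgr_lt _ cd); rewrite ltrDl.
have near2 : \forall y \near x, dotp (x - y) (x - y) < c ^+ 2.
  have cd : {for x, continuous (fun y : V => dotp (x - y) (x - y))}.
    have cxy : continuous (fun y : V => x - y).
      by move=> y; apply: continuousB; [exact: cst_continuous|exact: cvg_id].
    exact: continuous_dotp.
  by apply: (cvgr_lt _ cd); rewrite subrr dotp0l exprn_gt0.
near=> y.
have yr : dotp y y <= r by apply: ltW; near: y.
have yc : enorm (x - y) <= c.
  rewrite /enorm -[leRHS](ger0_norm (ltW c0)) -sqrtr_sqr ler_wsqrtr //.
  by apply: ltW; near: y.
apply: le_trans (HM t x t y _ _) _; [by split => //=; rewrite lerDl|by []|].
rewrite subrr normr0 powR0 ?add0r; last by rewrite gt_eqF // divr_gt0.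
have : enorm (x - y) `^ th <= c `^ th.
  by apply: ge0_ler_powR; rewrite ?nnegrE ?enorm_ge0 // ltW.
rewrite cc ler_pdivlMr // => h.
have := powR_ge0 (enorm (x - y)) th; have := ler_norm M.
by nra.
Unshelve. all: by end_near. Qed.

Lemma holder_bounded th (u : R -> V -> R) tau s T : 0 < th -> tau < s ->
  parabolic_holder_loc th `]tau, +oo[ u ->
  exists C, forall t, s <= t <= T -> `|u t 0| <= C.
Proof.
move=> th0 taus Hu.
have cK : compact (`[s, T] `*` [set (0 : V)]).
  by apply: compact_setX; [exact: segment_compact|exact: compact_set1].
have [|M HM] := Hu _ cK.
  move=> [t' y] /= [+ _]; rewrite /= !in_itv /= andbT => /andP[st _].
  by split => //; exact: lt_le_trans st.
exists (`|u s 0| + `|M| * (T - s) `^ (th / 2)) => t /andP[st tT].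
have -> : u t 0 = u s 0 + (u t 0 - u s 0) by ring.
apply: le_trans (ler_normD _ _) _; rewrite lerD2l.
apply: le_trans (HM t 0 s 0 _ _) _.
- by split => //=; rewrite in_itv /= st.
- by split => //=; rewrite in_itv /= lexx (le_trans st).
rewrite subrr /enorm dotp0l sqrtr0 powR0 ?gt_eqF // addr0 ger0_norm ?subr_ge0 //.
apply: le_trans (ler_wpM2r (powR_ge0 _ _) (ler_norm M)) _.
apply: ler_wpM2l => //; apply: ge0_ler_powR; rewrite ?nnegrE ?subr_ge0 //; last by rewrite lerD2r.
- by rewrite ltW // divr_gt0.
- exact: le_trans tT.
Qed.

(** Freezing the function before time s makes continuity on a half-space global, so that suprema
  over compact sets can be taken without subspace topologies. *)
Lemma continuous_clamp (E : topologicalType) (f : R -> E -> R) s :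
  {within `[s, +oo[ `*` [set: E], continuous (fun z : R * E => f z.1 z.2)} ->
  continuous (fun z : R * E => f (Num.max s z.1) z.2).
Proof.
move=> /subspace_continuousP cf z.
pose c := fun z : R * E => (Num.max s z.1, z.2).
have cz : c @ z --> within (`[s, +oo[ `*` [set: E]) (nbhs (c z)).
  have cc : {for z, continuous c}.
    have c1 : {for z, continuous (fun z : R * E => Num.max s z.1)}.
      apply: (@continuous_max _ _ (cst s) (fun z : R * E => z.1)); first exact: cst_continuous.
      exact: cvg_fst.
    exact: (cvg_pair c1 cvg_snd).
  move=> A /cc; rewrite /nbhs /=; apply: filterS => y.
  by apply; split => //=; rewrite in_itv /= andbT le_max lexx.
apply: (cvg_comp _ _ cz (cf (c z) _)).
by split => //=; rewrite in_itv /= andbT le_max lexx.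
Qed.

(** The values outside K are dominated by one value inside, so the maximum over the compact set
  [s, T] x K is global. *)
Lemma coercive_max (E : topologicalType) (W : R -> E -> R) s T (K : set E) e0 :
  s <= T -> continuous (fun z : R * E => W z.1 z.2) -> compact K -> K e0 ->
  (forall t e, s <= t <= T -> ~ K e -> W t e <= W s e0) ->
  exists t e, s <= t <= T /\ forall t' e', s <= t' <= T -> W t' e' <= W t e.
Proof.
move=> sT cW cK Ke0 out.
have [] := @compact_EVT_max _ R (fun z : R * E => W z.1 z.2) (`[s, T] `*` K).
- by exists (s, e0); split => //=; rewrite in_itv /= lexx.
- apply: compact_setX => //; exact: segment_compact.
- by apply: continuous_subspaceT.
move=> [t e]; rewrite inE => -[/= tI Ke] tmax.
exists t, e; split; first by move: tI; rewrite /= in_itv.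
move=> t' e' t'I; have [Ke'|nKe'] := pselect (K e').
  by apply: (tmax (t', e')); rewrite inE; split => //=; rewrite in_itv.
apply: le_trans (out _ _ t'I nKe') _.
by apply: (tmax (s, e0)); rewrite inE; split => //=; rewrite in_itv /= lexx.
Qed.

End SpaceTime.

(** * The maximum principle *)

Section Kolmogorov.
Context {R : realType} {d : nat}.
Notation V := 'rV[R]_d.
Context {tau theta : R} {Q : R -> 'M[R]_d} {b : R -> V -> V}.
Hypothesis standing : standing_assumptions theta `]tau, +oo[ Q b.
Implicit Types (f : V -> R) (x y xi : V) (s t T : R).

Let inI t : (`]tau, +oo[%classic t) = (tau < t) :> Prop.
Proof. by rewrite /= in_itv /= andbT. Qed.

Let theta0 : 0 < theta. Proof. by have /andP[] := theta_range standing. Qed.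

Lemma ellipticity : exists eta0 Lam : R, [/\ 0 < eta0, 0 < Lam &
  forall t x, tau < t -> eta0 * dotp x x <= dotp (x *m Q t) x <= Lam * dotp x x].
Proof.
have [eta0 [Lam [/andP[e0 eL] H]]] := Q_elliptic standing.
exists eta0, Lam; split => // [|t x tt]; first exact: lt_trans eL.
have := H t x; rewrite inI => /(_ tt).
by rewrite (Q_sym standing) ?inI // enormE.
Qed.

Lemma diffusion_sym t : tau < t -> (Q t)^T = Q t.
Proof. by move=> tt; apply: (Q_sym standing); rewrite inI. Qed.

Lemma diffusion_pos t x : tau < t -> x != 0 -> 0 < dotp (x *m Q t) x.
Proof.
have [eta0 [Lam [e0 _ H]]] := ellipticity => tt x0.
have /andP[+ _] := H t x tt; apply: lt_le_trans.
rewrite mulr_gt0 // -enormE exprn_gt0 //.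
by apply: lt_le_trans (normr_le_enorm _); rewrite normr_gt0.
Qed.

Lemma tr_diffusion_le t Lam : tau < t -> (forall x, dotp (x *m Q t) x <= Lam * dotp x x) ->
  \tr (Q t) <= d%:R * Lam.
Proof.
move=> tt H; rewrite /mxtrace mulr_natl -[X in _ *+ X]card_ord -sumr_const.
apply: ler_sum => i _; have := H (delta_mx 0 i).
by rewrite !dotp_delta -rowE !mxE !eqxx mulr1.
Qed.

Lemma tr_diffusion_le0 t (M : 'M[R]_d) : tau < t ->
  (forall xi, dotp (xi *m M) xi <= 0) -> \tr (Q t *m M) <= 0.
Proof.
move=> tt; apply: tr_mulmx_le0; first exact: diffusion_sym.
by move=> x; apply: diffusion_pos.
Qed.

(** The derivative of b along the segment from y to x is controlled by the dissipativity of the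
  Jacobian. *)
Lemma drift_monotone : exists2 k : R, 0 < k & forall t x y, tau < t ->
  dotp (b t x - b t y) (x - y) <= - k * dotp (x - y) (x - y).
Proof.
have [r0 [r00 H]] := b_dissipative standing.
exists (- r0) => [|t x y tt]; first by rewrite oppr_gt0.
rewrite opprK; pose xi := x - y.
have It : `]tau, +oo[%classic t by rewrite inI.
pose phi1 r := \sum_i \sum_j partial j (fun z => b t z 0 i) (r *: xi + y) * xi 0 j * xi 0 i.
have dphi (r : R) : is_derive r 1 (fun r => dotp (b t (r *: xi + y)) xi) (phi1 r).
  have Hi i : is_derive r 1 (fun r => b t (r *: xi + y) 0 i * xi 0 i)
      (xi 0 i * dotp (grad (fun z => b t z 0 i) (r *: xi + y)) xi).
    rewrite (_ : (fun r => _) = (fun r => xi 0 i * b t (r *: xi + y) 0 i)); last first.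
      by apply/funext => r'; rewrite mulrC.
    apply: is_deriveZ; apply: (is_derive_line (fun z => b t z 0 i)).
    apply: (is_derive_grad (fun z => b t z 0 i)) => [j z|j].
      exact: (b_derivable standing).
    exact: (holder_continuous theta _ (fun t => partial j (fun z => b t z 0 i)) _ theta0
      (db_holder standing i j) It).
  have {}Hi := @is_derive_sum _ _ _ _ _ _ _ _ Hi.
  rewrite (_ : (fun r => _) = \sum_(i < d) (fun r => b t (r *: xi + y) 0 i * xi 0 i)); last first.
    by apply/funext => r'; rewrite fct_sumE.
  apply: (is_derive_eq Hi); apply: eq_bigr => i _; rewrite mulr_sumr.
  by apply: eq_bigr => j _; rewrite !mxE; ring.
have [c _] := mvt_from0 _ _ dphi 1.
rewrite scale0r scale1r add0r subrK !mulr1 -/xi dotpBl => ->.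
by rewrite /phi1 -[in leRHS]enormE; exact: H.
Qed.

(** Compare b(t,x) with b(t,0), which is bounded for t in a compact interval, and absorb the
  linear term by Young's inequality. *)
Lemma drift_radial s T : tau < s -> exists C k : R, [/\ 0 <= C, 0 < k &
  forall t x, s <= t <= T -> dotp (b t x) x <= C - k * dotp x x].
Proof.
move=> taus; have [k k0 Hk] := drift_monotone.
have [C HC] : exists C, forall i t, s <= t <= T -> `|b t 0 0 i| <= C.
  have /choice[c Hc] i := holder_bounded _ _ _ _ T theta0 taus (b_holder standing i).
  exists (\sum_i `|c i|) => i t st; apply: le_trans (Hc i t st) _.
  by apply: le_trans (ler_norm _) _; rewrite (bigD1 i) //= lerDl sumr_ge0.
exists (k^-1 / 2 * (d%:R * `|C| ^+ 2)), (k / 2); split => //.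
- by rewrite !mulr_ge0 ?invr_ge0 // ltW.
- by rewrite divr_gt0.
move=> t x /[dup] st /andP[st' _].
have tt : tau < t by apply: lt_le_trans st'.
have := Hk t x 0 tt; rewrite subr0 dotpBl => H.
have B0 : dotp (b t 0) (b t 0) <= d%:R * `|C| ^+ 2.
  rewrite /dotp mulr_natl -[X in _ *+ X]card_ord -sumr_const; apply: ler_sum => i _.
  rewrite -expr2 -real_normK ?num_real // lerXn2r ?nnegrE //.
  by apply: le_trans (HC i t st) _; exact: ler_norm.
have := dotp_young x (b t 0) _ k0; rewrite (dotpC x).
have : k^-1 * dotp (b t 0) (b t 0) <= k^-1 * (d%:R * `|C| ^+ 2).
  by rewrite ler_wpM2l // invr_ge0 ltW.
lra.
Qed.

(** The penalty eps (|x|^2 + C1 (t - s)) makes the function coercive, and it is a strict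
  supersolution for C1 large: by dissipativity of the drift, A(t)|x|^2 is bounded above on compact
  time intervals. *)
Lemma max_principle s (w : R -> V -> R) M : tau < s ->
  continuous (fun z : R * V => w (Num.max s z.1) z.2) ->
  (forall t x, s <= t -> w t x <= M) -> (forall x, w s x <= 0) ->
  (forall t x, s < t -> exists l g H, [/\ is_derive t 1 (fun r => w r x) l,
     vjet (w t) x g H & l <= \tr (Q t *m H) + dotp (b t x) g]) ->
  forall t x, s <= t -> w t x <= 0.
Proof.
move=> taus cw wM ws Hw T x0 sT.
have [eta0 [Lam [_ Lam0 Hell]]] := ellipticity.
have [C [k [C0 k0 Hb]]] := drift_radial _ T taus.
pose C1 := 2 * (d%:R * Lam) + 2 * C + 1.
have C10 : 0 < C1 by rewrite /C1 ltr_wpDl // addr_ge0 ?mulr_ge0 // ltW.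
suff H eps : 0 < eps -> w T x0 <= eps * (dotp x0 x0 + C1 * (T - s)).
  apply/ler_addgt0Pr => e e0; rewrite add0r.
  pose N := dotp x0 x0 + C1 * (T - s) + 1.
  have N0 : 0 < N.
    by rewrite ltr_wpDl // addr_ge0 ?dotp_ge0 // mulr_ge0 // ?subr_ge0 // ltW.
  apply: le_trans (H (e / N) _) _; first exact: divr_gt0.
  rewrite mulrAC ler_pdivrMr //; apply: ler_wpM2l; [exact: ltW|by rewrite /N lerDl].
move=> eps0.
pose W t x := w t x - eps * (dotp x x + C1 * (t - s)).
have cW : continuous (fun z : R * V => w (Num.max s z.1) z.2 - eps * (dotp z.2 z.2 + C1 * (z.1 - s))).
  apply: contB => //; apply: contM; first exact: contC.
  apply: contD; first by apply: continuous_dotp => z; exact: cvg_snd.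
  apply: contM; first exact: contC.
  by apply: contB; [move=> z; exact: cvg_fst|exact: contC].
have Ws : W s x0 <= M.
  rewrite /W subrr mulr0 addr0; apply: le_trans (wM s x0 (lexx _)).
  by rewrite gerBl mulr_ge0 ?dotp_ge0 // ltW.
have [] := coercive_max _ (fun t x => w (Num.max s t) x - eps * (dotp x x + C1 * (t - s)))
   s T [set x : V | dotp x x <= (M - W s x0) / eps + dotp x0 x0] x0 sT cW (compact_ball _).
- by rewrite /= lerDr divr_ge0 ?subr_ge0 // ltW.
- move=> t x /andP[st _] /negP; rewrite /= -ltNge => xout.
  rewrite maxxx (max_idPr st) -/(W s x0).
  have xout' : (M - W s x0) / eps < dotp x x.
    by apply: le_lt_trans xout; rewrite lerDl dotp_ge0.
  rewrite lerBlDr; apply: le_trans (wM t x st) _; rewrite -lerBlDl.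
  move: xout'; rewrite ltr_pdivrMr // mulrC => /ltW /le_trans; apply.
  by rewrite ler_wpM2l ?(ltW eps0) // lerDl mulr_ge0 ?(ltW C10) // subr_ge0.
move=> t [x [/andP[st tT] Wmax]].
have {}Wmax t' x' : s <= t' <= T -> W t' x' <= W t x.
  move=> /[dup] st' /andP[st'' _].
  by have := Wmax t' x' st'; rewrite /W (max_idPr st'') (max_idPr st).
have [ts|ts] := eqVneq t s.
  have : W T x0 <= 0.
    apply: le_trans (Wmax T x0 _) _; first by rewrite sT lexx.
    rewrite ts /W subrr mulr0 addr0 -(subr0 0); apply: lerB => //.
    by rewrite mulr_ge0 ?dotp_ge0 // ltW.
  by rewrite subr_le0.
have {}st : s < t by rewrite lt_def ts.
exfalso.
have [l [g [H [dl J lle]]]] := Hw t x st.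
have dW : is_derive t 1 (fun r => W r x) (l - eps * C1).
  apply: is_deriveB; apply: is_deriveZ.
  rewrite -[X in is_derive _ _ _ X]add0r; apply: is_deriveD.
  rewrite -[X in is_derive _ _ _ X]mulr1; apply: is_deriveZ.
  rewrite -[X in is_derive _ _ _ X]subr0; apply: is_deriveB.
have l0 : 0 <= l - eps * C1.
  apply: is_derive_left_max dW st _ => r sr rt; apply: Wmax.
  by rewrite sr (le_trans rt).
have JW := vjetB _ _ _ _ _ _ _ J
  (vjetZ eps _ _ _ _ (vjetD _ _ _ _ _ _ _ (vjet_sq x) (vjet_cst (C1 * (t - s)) x))).
have [|g0 H0] := vjet_max _ _ _ _ JW.
  by move=> y; apply: (Wmax t y); rewrite (ltW st).
have tt : tau < t by apply: lt_trans st.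
have trle := tr_diffusion_le0 _ _ tt H0.
move/eqP: g0; rewrite addr0 subr_eq0 => /eqP gE.
have := Hb t x; rewrite (ltW st) tT => /(_ isT) Hbx.
have trQ := tr_diffusion_le t Lam tt (fun y => proj2 (andP (Hell t y tt))).
move: trle; rewrite addr0 mulmxBr -scalemxAr mul_mx_scalar !raddfB /= !mxtraceZ => trle.
move: lle; rewrite gE !dotpZr => lle.
have xx := dotp_ge0 x.
have kxx : 0 <= k * dotp x x by rewrite mulr_ge0 // ltW.
have : eps * C1 <= eps * (2 * \tr (Q t) + 2 * dotp (b t x) x) by lra.
rewrite ler_pM2l // /C1; lra.
Qed.

Section Solution.
Context {s : R} {f : V -> R} {u : R -> V -> R}.
Hypotheses (taus : tau < s) (sol : bounded_classical_solution theta Q b s f u).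

Lemma sol_time_derivative t x : s < t ->
  is_derive t 1 (fun r => u r x) (kolmogorov Q b t (u t) x).
Proof.
move=> st; have [H _ _ _] := sol_regular sol.
rewrite -(sol_equation sol) // derive1E; apply: derivableP; apply: H.
by rewrite /= in_itv /= st.
Qed.

Lemma sol_vjet t x : s < t -> vjet (u t) x (grad (u t) x) (hess (u t) x).
Proof.
move=> st; have [_ H1 H2 [_ _ H3 H4]] := sol_regular sol.
have It : `]s, +oo[%classic t by rewrite /= in_itv /= st.
apply: vjet_C2 => [i y|i|i j y|i j].
- exact: H1.
- exact: (holder_continuous _ _ _ _ theta0 (H3 i) It).
- exact: H2.
- exact: (holder_continuous _ _ _ _ theta0 (H4 i j) It).
Qed.

End Solution.
End Kolmogorov.

(** * Comparison of solutions *)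

Section QForm.
Context {R : realType} {d : nat}.
Variable A : 'M[R]_d.
Hypotheses (Asym : A^T = A) (Apos : forall x : 'rV[R]_d, 0 <= dotp (x *m A) x).
Implicit Types (x y : 'rV[R]_d) (k : R).

Lemma qform_sym x y : dotp (x *m A) y = dotp (y *m A) x.
Proof. by rewrite -qform_trmx Asym. Qed.

Lemma qform_young x y k : 0 < k ->
  2 * dotp (x *m A) y <= k * dotp (x *m A) x + k^-1 * dotp (y *m A) y.
Proof.
move=> k0; have := Apos (k *: x - y).
rewrite mulmxBl -scalemxAl !(dotpBl, dotpBr, dotpZl, dotpZr) (qform_sym y x) => h.
have : 0 <= k^-1 * (k * (k * dotp (x *m A) x) - k * dotp (x *m A) y -
    (k * dotp (x *m A) y - dotp (y *m A) y)).
  by apply: mulr_ge0; [rewrite invr_ge0 ltW|lra].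
rewrite (_ : k^-1 * _ = k * dotp (x *m A) x + k^-1 * dotp (y *m A) y - 2 * dotp (x *m A) y).
  by rewrite subr_ge0.
by field; rewrite gt_eqF.
Qed.

Lemma qformD_le x y k : 0 < k -> dotp ((x + y) *m A) (x + y) <=
  (1 + k) * dotp (x *m A) x + (1 + k^-1) * dotp (y *m A) y.
Proof.
move=> k0; have := qform_young x y _ k0.
by rewrite mulmxDl !(dotpDl, dotpDr) (qform_sym y x); lra.
Qed.

Lemma qformB_ge x y k : 0 < k ->
  (1 - k) * dotp (x *m A) x - k^-1 * dotp (y *m A) y <= dotp ((x - y) *m A) (x - y).
Proof.
move=> k0; have := qform_young x y _ k0; have := Apos y.
by rewrite mulmxBl !(dotpBl, dotpBr) (qform_sym y x); lra.
Qed.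

Lemma tr_mulmx_rank1 x : \tr (A *m (x^T *m x)) = dotp (x *m A) x.
Proof.
by rewrite mulmxA mxtrace_mulC mulmxA dotp_mx /mxtrace big_ord_recl big_ord0 addr0.
Qed.

End QForm.

Lemma qform_rank1 {R : realType} {d} (x xi : 'rV[R]_d) :
  dotp (xi *m (x^T *m x)) xi = dotp x xi ^+ 2.
Proof.
rewrite mulmxA (mx11_scalar (xi *m x^T)) mul_scalar_mx dotpZl -dotp_mx.
by rewrite (dotpC xi) expr2.
Qed.

Section Comparison.
Context {R : realType} {d : nat}.
Notation V := 'rV[R]_d.
Context {tau theta : R} {Q : R -> 'M[R]_d} {b : R -> V -> V}.
Hypothesis standing : standing_assumptions theta `]tau, +oo[ Q b.
Implicit Types (f : V -> R) (x y xi : V) (s t T : R).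
Notation solution := (bounded_classical_solution theta Q b).

Lemma sol_clamp_continuous s f u : solution s f u ->
  continuous (fun z : R * V => u (Num.max s z.1) z.2).
Proof. by move=> /sol_continuous/continuous_clamp. Qed.

(** The factor c = -1 gives the bound of |u| by the solution issued from |f|. *)
Lemma sol_compare s c f1 f2 u1 u2 : tau < s -> solution s f1 u1 -> solution s f2 u2 ->
  (forall x, c * f1 x <= f2 x) -> forall t x, s <= t -> c * u1 t x <= u2 t x.
Proof.
move=> taus S1 S2 f12 t x st; rewrite -subr_le0.
have [M1 HM1] := sol_bounded S1; have [M2 HM2] := sol_bounded S2.
apply: (max_principle standing s (fun t x => c * u1 t x - u2 t x) (`|c| * M1 + M2)) st => //.
- apply: contB; last exact: (sol_clamp_continuous _ _ _ S2).
  by apply: contM; [exact: contC|exact: (sol_clamp_continuous _ _ _ S1)].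
- move=> r y sr; apply: le_trans (ler_norm _) _.
  apply: le_trans (ler_normB _ _) _; rewrite lerD ?HM2 // normrM ler_wpM2l //.
  exact: HM1.
- by move=> y; rewrite (sol_initial S1) (sol_initial S2) subr_le0.
move=> r y sr.
exists (c * kolmogorov Q b r (u1 r) y - kolmogorov Q b r (u2 r) y).
exists (c *: grad (u1 r) y - grad (u2 r) y), (c *: hess (u1 r) y - hess (u2 r) y); split.
- apply: is_deriveB; last exact: (sol_time_derivative S2).
  by apply: is_deriveZ; exact: (sol_time_derivative S1).
- apply: vjetB; last exact: (sol_vjet standing S2).
  by apply: vjetZ; exact: (sol_vjet standing S1).
- rewrite /kolmogorov mulmxBr -scalemxAr !raddfB /= mxtraceZ dotpBr dotpZr.
  by rewrite mulrDr opprD addrACA.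
Qed.

Lemma sol_scaled_ge s c k f u : tau < s -> solution s f u -> (forall x, c <= k * f x) ->
  forall t x, s <= t -> c <= k * u t x.
Proof.
move=> taus S cf t x st; rewrite -subr_le0.
have [M HM] := sol_bounded S.
apply: (max_principle standing s (fun t x => c - k * u t x) (`|c| + `|k| * M)) st => //.
- apply: contB; first exact: contC.
  by apply: contM; [exact: contC|exact: (sol_clamp_continuous _ _ _ S)].
- move=> r y sr; apply: le_trans (ler_norm _) _.
  apply: le_trans (ler_normB _ _) _; rewrite lerD // normrM ler_wpM2l //.
  exact: HM.
- by move=> y; rewrite (sol_initial S) subr_le0.
move=> r y sr.
exists (0 - k * kolmogorov Q b r (u r) y), (0 - k *: grad (u r) y), (0 - k *: hess (u r) y); split.
- by apply: is_deriveB; apply: is_deriveZ; exact: (sol_time_derivative S).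
- by apply: vjetB; [exact: vjet_cst|apply: vjetZ; exact: (sol_vjet standing S)].
- rewrite /kolmogorov mulmxBr mulmx0 -scalemxAr !raddfB /= mxtrace0 mxtraceZ dotpBr (dotpC _ 0) dotp0l dotpZr.
  by rewrite !sub0r mulrDr opprD.
Qed.

Lemma sol_ge s c f u : tau < s -> solution s f u -> (forall x, c <= f x) ->
  forall t x, s <= t -> c <= u t x.
Proof.
move=> taus S cf t x st; rewrite -[u t x]mul1r.
by apply: (sol_scaled_ge s c 1 f u taus S _ t x st) => y; rewrite mul1r.
Qed.

Lemma sol_le s c f u : tau < s -> solution s f u -> (forall x, f x <= c) ->
  forall t x, s <= t -> u t x <= c.
Proof.
move=> taus S fc t x st; rewrite -lerN2 -[- u t x]mulN1r.
by apply: (sol_scaled_ge s (- c) (-1) f u taus S _ t x st) => y; rewrite mulN1r lerN2.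
Qed.

End Comparison.

(** * Harnack inequality by doubling of variables *)

Lemma qform_comb {R : realType} {d} (A B C D : 'M[R]_d) (a b c e : R) (xi : 'rV[R]_d) :
  dotp (xi *m (a *: A - b *: B - c *: C + D - e%:M)) xi =
  a * dotp (xi *m A) xi - b * dotp (xi *m B) xi - c * dotp (xi *m C) xi
    + dotp (xi *m D) xi - e * dotp xi xi.
Proof.
by rewrite !(mulmxBr, mulmxDr) -!scalemxAr mul_mx_scalar !(dotpBl, dotpDl) !dotpZl.
Qed.

Lemma trace_comb {R : realType} {d} (Q A B C D : 'M[R]_d) (a b c e : R) :
  \tr (Q *m (a *: A - b *: B - c *: C + D - e%:M)) =
  a * \tr (Q *m A) - b * \tr (Q *m B) - c * \tr (Q *m C) + \tr (Q *m D) - e * \tr Q.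
Proof.
rewrite !(mulmxBr, mulmxDr) -!scalemxAr mul_mx_scalar.
by rewrite !(raddfB, raddfD) /= !mxtraceZ.
Qed.

Section Harnack.
Context {R : realType} {d : nat}.
Notation V := 'rV[R]_d.
Context {tau theta : R} {Q : R -> 'M[R]_d} {b : R -> V -> V}.
Hypothesis standing : standing_assumptions theta `]tau, +oo[ Q b.
Implicit Types (f : V -> R) (x y xi : V) (s t T : R).
Notation solution := (bounded_classical_solution theta Q b).

(** The terms left at an interior maximum of the doubled function, once the gradients al and be of
  p ln u and ln v have been computed from the first-order conditions. With z = 2h(x - y), the two
  quadratic gradient terms leave a negative multiple of |z|^2, which pays for the derivative in
  time of the penalty h |x - y|^2; the errors of order eps^2 (|x|^2 + |y|^2) are absorbed by the
  radial dissipation of the drift, for eps small. *)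
Lemma coupling_estimate (p eta0 Lam C k eps h t : R) x y :
  1 < p -> 0 < Lam -> 0 < k -> tau < t ->
  (forall x, eta0 * dotp x x <= dotp (x *m Q t) x <= Lam * dotp x x) ->
  dotp (b t x) x <= C - k * dotp x x -> dotp (b t y) y <= C - k * dotp y y ->
  0 < eps -> eps * (2 * (1 + (2 * (p + 1) / (p - 1))) * Lam) <= k ->
  let al := (2 * h) *: (x - y) + (2 * eps) *: x in
  let be := (2 * h) *: (x - y) - (2 * eps) *: y in
  0 <= h ->
  p^-1 * dotp (al *m Q t) al - dotp (be *m Q t) be + 4 * eps * \tr (Q t)
    + (dotp (b t x) al - dotp (b t y) be)
    + 4 * ((p - 1) / (2 * p) * eta0) * h ^+ 2 * dotp (x - y) (x - y)
  <= eps * (4 * C + 4 * (d%:R * Lam)).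
Proof.
move=> p1 Lam0 k0 tt Hell bx by_ eps0 epsk al be h0.
have p0 : 0 < p by apply: lt_trans p1.
have Asym := diffusion_sym standing t tt.
have Apos z : 0 <= dotp (z *m Q t) z.
  have [->|z0] := eqVneq z 0; first by rewrite mul0mx dotp0l.
  by apply: ltW; exact: (diffusion_pos standing).
pose z := (2 * h) *: (x - y).
(* this K solves (1 + K) / p - (1 - K) = - (p - 1) / (2 p) *)
pose K := (p - 1) / (2 * (p + 1)).
have K0 : 0 < K by rewrite divr_gt0 ?subr_gt0 // mulr_gt0 // addr_gt0.
have KV0 : 0 <= 1 + K^-1 by rewrite addr_ge0 // invr_ge0 ltW.
have KV : K^-1 = 2 * (p + 1) / (p - 1) by rewrite /K invf_div.
have alE := qformD_le _ Asym Apos z ((2 * eps) *: x) K K0.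
have beE := qformB_ge _ Asym Apos z ((2 * eps) *: y) K K0.
rewrite -/al in alE; rewrite -/be in beE.
have qZ (c : R) (w : V) : dotp ((c *: w) *m Q t) (c *: w) = c ^+ 2 * dotp (w *m Q t) w.
  by rewrite -scalemxAl dotpZl dotpZr mulrA expr2.
rewrite qZ in alE; rewrite qZ in beE.
have qz : 4 * h ^+ 2 * (eta0 * dotp (x - y) (x - y)) <= dotp (z *m Q t) z.
  rewrite qZ exprMn (_ : 2 ^+ 2 = 4); last by rewrite -natrX.
  apply: ler_wpM2l; first by rewrite mulr_ge0 // sqr_ge0.
  by have /andP[] := Hell (x - y).
have trQ := tr_diffusion_le t Lam tt (fun w => proj2 (andP (Hell w))).
have qx : dotp (x *m Q t) x <= Lam * dotp x x by have /andP[] := Hell x.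
have qy : dotp (y *m Q t) y <= Lam * dotp y y by have /andP[] := Hell y.
have mono : dotp (b t x) z - dotp (b t y) z <= 0.
  rewrite -dotpBl dotpZr; apply: mulr_ge0_le0; first by rewrite mulr_ge0.
  have [k' k'0 Hk'] := drift_monotone standing.
  apply: le_trans (Hk' t x y tt) _.
  by rewrite mulNr oppr_le0 mulr_ge0 ?dotp_ge0 // ltW.
have bE : dotp (b t x) al - dotp (b t y) be =
    (dotp (b t x) z - dotp (b t y) z) + 2 * eps * (dotp (b t x) x + dotp (b t y) y).
  by rewrite /al /be dotpDr dotpBr !dotpZr; ring.
rewrite bE.
have qz0 := Apos z; have qx0 := Apos x; have qy0 := Apos y.
have xx := dotp_ge0 x; have yy := dotp_ge0 y.
move: alE beE qz trQ qx qy mono bx by_ qz0 qx0 qy0 xx yy.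
move: (dotp (al *m Q t) al) (dotp (be *m Q t) be) (dotp (z *m Q t) z) (\tr (Q t))
  (dotp (x *m Q t) x) (dotp (y *m Q t) y) (dotp (b t x) z - dotp (b t y) z)
  (dotp (b t x) x) (dotp (b t y) y) (dotp x x) (dotp y y) (dotp (x - y) (x - y)) (d%:R * Lam).
move=> qal qbe qz tr qx qy bb bx by_ xx yy xy dL alE beE qzE trQ qxE qyE mono bxE byE qz0 qx0 qy0 xx0 yy0.
have step1 : p^-1 * qal - qbe <= - ((p - 1) / (2 * p)) * qz + (1 + K^-1) * (2 * eps) ^+ 2 * (qx + qy).
  have h1 : p^-1 * qal <= p^-1 * ((1 + K) * qz) + (1 + K^-1) * ((2 * eps) ^+ 2 * qx).
    have e1 : p^-1 * qal <= p^-1 * ((1 + K) * qz + (1 + K^-1) * ((2 * eps) ^+ 2 * qx)).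
      by rewrite ler_wpM2l // invr_ge0 ltW.
    apply: le_trans e1 _; rewrite mulrDr lerD2l ler_piMl //.
      by apply: mulr_ge0 => //; rewrite mulr_ge0 // sqr_ge0.
    by rewrite invf_le1 // ltW.
  have h2 : 0 <= (2 * eps) ^+ 2 * qy by rewrite mulr_ge0 // sqr_ge0.
  have h3 : p^-1 * ((1 + K) * qz) - (1 - K) * qz = - ((p - 1) / (2 * p)) * qz.
    by rewrite /K; field; lra.
  lra.
have step2 : (1 + K^-1) * (2 * eps) ^+ 2 * (qx + qy) <= 2 * eps * k * (xx + yy).
  have e1 : (1 + K^-1) * (2 * eps) ^+ 2 * (qx + qy) <= (1 + K^-1) * (2 * eps) ^+ 2 * (Lam * (xx + yy)).
    apply: ler_wpM2l; last by lra.
    by rewrite mulr_ge0 // sqr_ge0.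
  apply: le_trans e1 _.
  have -> : (1 + K^-1) * (2 * eps) ^+ 2 * (Lam * (xx + yy)) =
     2 * eps * (eps * (2 * (1 + K^-1) * Lam)) * (xx + yy) by ring.
  apply: ler_wpM2r; first exact: addr_ge0.
  by apply: ler_wpM2l; [lra|rewrite KV].
have step3 : 4 * eps * tr <= 4 * eps * dL by apply: ler_wpM2l => //; lra.
have step4 : 2 * eps * (bx + by_) <= 2 * eps * (2 * C - k * (xx + yy)) by apply: ler_wpM2l; lra.
have m0 : 0 <= (p - 1) / (2 * p) by rewrite divr_ge0; lra.
have step5 := ler_wpM2l m0 qzE.
move: step1 step2 step3 step4 step5 mono; clear.
lra.
Qed.

(** The second-derivative test is used along the directions (xi, xi) of the doubled space, along
  which |x - y|^2 is constant; summed against Q(t) it bounds the difference of the two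
  second-order terms. *)
Lemma harnack_no_interior_max (p eta0 Lam C k eps sig c C1 s T t : R) (f g : V -> R)
    (u v : R -> V -> R) x y :
  tau < s -> s < t -> t <= T -> 1 < p -> 0 < Lam -> 0 < k -> 0 < eps -> 0 < sig -> 0 < c ->
  (forall x, eta0 * dotp x x <= dotp (x *m Q t) x <= Lam * dotp x x) ->
  (forall x, dotp (b t x) x <= C - k * dotp x x) ->
  eps * (2 * (1 + (2 * (p + 1) / (p - 1))) * Lam) <= k ->
  4 * ((p - 1) / (2 * p) * eta0) * c = 1 ->
  4 * C + 4 * (d%:R * Lam) < C1 ->
  solution s f u -> solution s g v ->
  (forall x, 0 < u t x) -> (forall y, 0 < v t y) ->
  let W r x y := p * ln (u r x) - ln (v r y) - c / (r - s + sig) * dotp (x - y) (x - y)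
     - eps * (dotp x x + dotp y y + C1 * (r - s)) in
  (forall r x' y', s <= r <= T -> W r x' y' <= W t x y) -> False.
Proof.
move=> taus st tT p1 Lam0 k0 eps0 sig0 c0 Hell Hb epsk cE C1E Su Sv upos vpos W Wmax.
have tt : tau < t by apply: lt_trans st.
have tsT : s <= t <= T by rewrite (ltW st) tT.
have ts0 : 0 < t - s + sig by rewrite addr_gt0 // subr_gt0.
pose h := c / (t - s + sig).
have h0 : 0 < h by rewrite divr_gt0.
have [gu [Hu [ju Ku]]] : exists gu Hu, (forall xi, jet (fun r => ln (u t (r *: xi + x)))
      (dotp gu xi / u t x) (dotp (xi *m Hu) xi / u t x - (dotp gu xi / u t x) ^+ 2)) /\
    kolmogorov Q b t (u t) x = \tr (Q t *m Hu) + dotp (b t x) gu.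
  exists (grad (u t) x), (hess (u t) x); split=> // xi.
  have := jet_ln _ _ _ (sol_vjet standing Su t x st xi) (fun r => upos _).
  by rewrite scale0r add0r.
have [gv [Hv [jv Kv]]] : exists gv Hv, (forall xi, jet (fun r => ln (v t (r *: xi + y)))
      (dotp gv xi / v t y) (dotp (xi *m Hv) xi / v t y - (dotp gv xi / v t y) ^+ 2)) /\
    kolmogorov Q b t (v t) y = \tr (Q t *m Hv) + dotp (b t y) gv.
  exists (grad (v t) y), (hess (v t) y); split=> // xi.
  have := jet_ln _ _ _ (sol_vjet standing Sv t y st xi) (fun r => vpos _).
  by rewrite scale0r add0r.
have [al alD] : exists al, al = (p / u t x) *: gu by eexists.
have [be beD] : exists be, be = (v t y)^-1 *: gv by eexists.
have alE : al = (2 * h) *: (x - y) + (2 * eps) *: x.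
  apply: dotp_eq => xi.
  have J := jetB (jetB (jetB (jetZ p (ju xi)) (jet_cst (ln (v t y)))) (jetZ h (jet_sq (x - y) xi)))
    (jetZ eps (jetD (jetD (jet_sq x xi) (jet_cst (dotp y y))) (jet_cst (C1 * (t - s))))).
  have [|+ _] := jet_max J.
    move=> r; have := Wmax t (r *: xi + x) y tsT.
    by rewrite /W -/h !scale0r !add0r addrA.
  have key (a1 a2 a3 a4 : R) : p * (a1 / a2) - 0 - h * (2 * a3) - eps * (2 * a4 + 0 + 0) = 0 ->
      p / a2 * a1 = 2 * h * a3 + 2 * eps * a4.
    by have -> : p / a2 * a1 = p * (a1 / a2); [ring|lra].
  by move=> /key E; rewrite alD dotpDl !dotpZl.
have beE : be = (2 * h) *: (x - y) - (2 * eps) *: y.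
  apply: dotp_eq => xi.
  have J := jetB (jetB (jetB (jet_cst (p * ln (u t x))) (jv xi)) (jetZ h (jet_sq (y - x) xi)))
    (jetZ eps (jetD (jetD (jet_cst (dotp x x)) (jet_sq y xi)) (jet_cst (C1 * (t - s))))).
  have [|+ _] := jet_max J.
    have dsym (z w : V) : dotp (z - w) (z - w) = dotp (w - z) (w - z).
      by rewrite -(opprB w) dotpNl dotpNr opprK.
    move=> r; have := Wmax t x (r *: xi + y) tsT.
    by rewrite /W -/h !scale0r !add0r (dsym x (_ + y)) (dsym x y) addrA.
  have key (a1 a2 a3 a4 : R) : 0 - a1 / a2 - h * (2 * - a3) - eps * (0 + 2 * a4 + 0) = 0 ->
      a2^-1 * a1 = 2 * h * a3 - 2 * eps * a4.
    by rewrite mulrC; lra.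
  by rewrite -[y - x]opprB dotpNl => /key E; rewrite beD dotpBl !dotpZl.
(* the Hessian of the doubled function on the diagonal directions *)
pose M := (p / u t x) *: Hu - p^-1 *: (al^T *m al) - (v t y)^-1 *: Hv + be^T *m be - (4 * eps)%:M.
have M0 xi : dotp (xi *m M) xi <= 0.
  have J := jetB (jetB (jetB (jetZ p (ju xi)) (jv xi)) (jet_cst (h * dotp (x - y) (x - y))))
    (jetZ eps (jetD (jetD (jet_sq x xi) (jet_sq y xi)) (jet_cst (C1 * (t - s))))).
  have [|_ +] := jet_max J.
    move=> r; have := Wmax t (r *: xi + x) (r *: xi + y) tsT.
    have e (z : V) : (z + x) - (z + y) = x - y by rewrite opprD addrACA subrr add0r.
    by rewrite /W -/h !scale0r !add0r e.
  rewrite /M qform_comb !qform_rank1 alD beD (dotpZl _ gu) (dotpZl _ gv).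
  have key (U W' a1 a2 a3 a4 a5 : R) : 0 < U -> 0 < W' ->
    p * (a1 / U - (a4 / U) ^+ 2) - (a2 / W' - (a5 / W') ^+ 2) - 0 - eps * (2 * a3 + 2 * a3 + 0) =
    p / U * a1 - p^-1 * (p / U * a4) ^+ 2 - W'^-1 * a2 + (W'^-1 * a5) ^+ 2 - 4 * eps * a3.
    by move=> U0 W0; field; rewrite !gt_eqF //; apply: lt_trans p1.
  by rewrite (key _ _ _ _ _ _ _ (upos x) (vpos y)).
have trle := tr_diffusion_le0 standing _ _ tt M0.
have Wt : is_derive t 1 (fun r => W r x y)
   (p * (kolmogorov Q b t (u t) x / u t x) - kolmogorov Q b t (v t) y / v t y
     + c / (t - s + sig) ^+ 2 * dotp (x - y) (x - y) - eps * C1).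
  have D1 : is_derive t 1 (fun r => ln (u r x)) ((u t x)^-1 * kolmogorov Q b t (u t) x).
    apply: (is_derive1_comp (f := @ln R)); first exact: is_derive1_ln.
    exact: (sol_time_derivative Su).
  have D2 : is_derive t 1 (fun r => ln (v r y)) ((v t y)^-1 * kolmogorov Q b t (v t) y).
    apply: (is_derive1_comp (f := @ln R)); first exact: is_derive1_ln.
    exact: (sol_time_derivative Sv).
  have Dt : is_derive t 1 (fun r => r - s + sig) 1.
    rewrite -[X in is_derive _ _ _ X]addr0; apply: is_deriveD.
    rewrite -[X in is_derive _ _ _ X]subr0; apply: is_deriveB.
  have D3 := @is_deriveV _ (fun r => r - s + sig) t 1 1 (lt0r_neq0 ts0) Dt.
  have D4 : is_derive t 1 (fun r => dotp x x + dotp y y + C1 * (r - s)) (C1 * 1).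
    rewrite -[X in is_derive _ _ _ X]add0r; apply: is_deriveD; apply: is_deriveZ.
    rewrite -[X in is_derive _ _ _ X]subr0; apply: is_deriveB.
  have D5 : is_derive t 1 (fun r => c / (r - s + sig) * dotp (x - y) (x - y))
      (c * dotp (x - y) (x - y) * (- (t - s + sig) ^- 2 * 1)).
    rewrite (_ : (fun r => _) = (fun r => c * dotp (x - y) (x - y) * (r - s + sig)^-1)); last first.
      by apply/funext => r; rewrite mulrAC.
    exact: is_deriveZ.
  have D : is_derive t 1 (fun r => W r x y) (p * ((u t x)^-1 * kolmogorov Q b t (u t) x) -
      (v t y)^-1 * kolmogorov Q b t (v t) y -
      c * dotp (x - y) (x - y) * (- (t - s + sig) ^- 2 * 1) - eps * (C1 * 1)).
    exact: is_deriveB.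
  apply: (is_derive_eq D); clear.
  have key (a1 a2 a3 a4 a5 a6 : R) : p * (a1^-1 * a2) - a3^-1 * a4 - c * a5 * (- a6 * 1) - eps * (C1 * 1)
     = p * (a2 / a1) - a4 / a3 + c * a6 * a5 - eps * C1 by ring.
  exact: key.
have l0 : 0 <= p * (kolmogorov Q b t (u t) x / u t x) - kolmogorov Q b t (v t) y / v t y
     + c / (t - s + sig) ^+ 2 * dotp (x - y) (x - y) - eps * C1.
  apply: is_derive_left_max Wt st _ => r sr rt; apply: Wmax.
  by rewrite sr (le_trans rt).
have est := coupling_estimate p eta0 Lam C k eps h t x y p1 Lam0 k0 tt Hell (Hb x) (Hb y) eps0 epsk (ltW h0).
rewrite /= -alE -beE in est.
have hE : 4 * ((p - 1) / (2 * p) * eta0) * h ^+ 2 = c / (t - s + sig) ^+ 2.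
  have -> : 4 * ((p - 1) / (2 * p) * eta0) * h ^+ 2 =
      4 * ((p - 1) / (2 * p) * eta0) * c * (c / (t - s + sig) ^+ 2).
    by rewrite /h; field; apply/andP; split; apply: lt0r_neq0 => //; apply: lt_trans p1.
  by rewrite cE mul1r.
rewrite hE in est.
rewrite /M trace_comb !tr_mulmx_rank1 in trle.
have C1eps : eps * (4 * C + 4 * (d%:R * Lam)) < eps * C1 by rewrite ltr_pM2l.
have kuE : p * (kolmogorov Q b t (u t) x / u t x) =
   p / u t x * \tr (Q t *m Hu) + dotp (b t x) al.
  by rewrite Ku alD dotpZr mulrDl mulrDr; congr (_ + _); rewrite mulrCA mulrC -mulrA mulrC.
have kvE : kolmogorov Q b t (v t) y / v t y =
   (v t y)^-1 * \tr (Q t *m Hv) + dotp (b t y) be.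
  by rewrite Kv beD dotpZr mulrC mulrDr.
rewrite kuE kvE in l0.
have key (a1 a2 a3 a4 a5 a6 a7 a8 a9 a10 : R) :
  a1 - a2 + 4 * eps * a3 + (a4 - a5) + a6 <= a7 -> a8 - a1 - a9 + a2 - 4 * eps * a3 <= 0 ->
  a7 < a10 -> 0 <= a8 + a4 - (a9 + a5) + a6 - a10 -> False by clear; lra.
exact: key est trle C1eps l0.
Qed.

End Harnack.
Section HarnackThm.
Context {R : realType} {d : nat}.
Notation V := 'rV[R]_d.
Context {tau theta : R} {Q : R -> 'M[R]_d} {b : R -> V -> V}.
Hypothesis standing : standing_assumptions theta `]tau, +oo[ Q b.
Implicit Types (f : V -> R) (x y xi : V) (s t T : R).
Notation solution := (bounded_classical_solution theta Q b).

(** The singularity of the penalty at t = s is moved to s - sig. At the initial time the doubled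
  function is then at most p L |x - y| - (c / sig) |x - y|^2 <= sig (p L)^2 / (4c), which vanishes
  with sig. *)
Lemma harnack p : 1 < p -> exists2 c : R, 0 < c &
  forall s f u v del L, tau < s -> 0 < del -> (forall x, del <= f x) ->
  (forall x y, ln (f x) - ln (f y) <= L * enorm (x - y)) ->
  solution s f u -> solution s (fun x => f x `^ p) v ->
  forall t x y, s < t -> p * ln (u t x) - ln (v t y) <= c / (t - s) * dotp (x - y) (x - y).
Proof.
move=> p1; have [eta0 [Lam [eta00 Lam0 Hell]]] := ellipticity standing.
have p0 : 0 < p by apply: lt_trans p1.
pose m := 4 * ((p - 1) / (2 * p) * eta0).
have m0 : 0 < m by rewrite !mulr_gt0 // ?subr_gt0 // invr_gt0 mulr_gt0.
exists m^-1; first by rewrite invr_gt0.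
move=> s f u v del L taus del0 fdel fL Su Sv T x0 y0 sT.
set c := m^-1; have c0 : 0 < c by rewrite invr_gt0.
have mc : m * c = 1 by rewrite mulfV // gt_eqF.
have [C [k [C0 k0 Hb]]] := drift_radial standing _ T taus.
pose C1 := 4 * C + 4 * (d%:R * Lam) + 1.
have C10 : 0 < C1 by rewrite ltr_wpDl // addr_ge0 ?mulr_ge0 // ltW.
pose kap := 2 * (1 + (2 * (p + 1) / (p - 1))) * Lam.
have kap0 : 0 < kap.
  by rewrite mulr_gt0 // mulr_gt0 // addr_gt0 // divr_gt0 ?subr_gt0 // mulr_gt0 // addr_gt0.
have udel t x : s <= t -> del <= u t x by apply: (sol_ge standing _ _ _ _ taus Su).
have vdel t x : s <= t -> del `^ p <= v t x.
  apply: (sol_ge standing _ _ _ _ taus Sv) => y.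
  by apply: ge0_ler_powR; rewrite ?nnegrE // ?ltW // (lt_le_trans del0).
have delp0 : 0 < del `^ p by rewrite powR_gt0.
have [M HM] := sol_bounded Su.
have uM t x : s <= t -> u t x <= M by move=> st; apply: le_trans (ler_norm _) (HM _ _ st).
pose B0 := p * ln M - ln (del `^ p).
have NB0 t x y : s <= t -> p * ln (u t x) - ln (v t y) <= B0.
  move=> st; have u0 := lt_le_trans del0 (udel t x st).
  have v0 := lt_le_trans delp0 (vdel t y st).
  apply: lerB; last by rewrite ler_ln ?posrE // vdel.
  apply: ler_wpM2l; first exact: ltW.
  by rewrite ler_ln ?posrE ?uM // (lt_le_trans u0) ?uM.
have claim eps sig : 0 < eps -> eps * kap <= k -> 0 < sig ->
    p * ln (u T x0) - ln (v T y0) - c / (T - s + sig) * dotp (x0 - y0) (x0 - y0)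
    - eps * (dotp x0 x0 + dotp y0 y0 + C1 * (T - s)) <= sig * ((p * L) ^+ 2 / (4 * c)).
  move=> eps0 epsk sig0.
  pose W t x y := p * ln (u t x) - ln (v t y) - c / (t - s + sig) * dotp (x - y) (x - y)
     - eps * (dotp x x + dotp y y + C1 * (t - s)).
  pose W' t (z : V * V) := p * ln (u (Num.max s t) z.1) - ln (v (Num.max s t) z.2)
     - c / (Num.max s t - s + sig) * dotp (z.1 - z.2) (z.1 - z.2)
     - eps * (dotp z.1 z.1 + dotp z.2 z.2 + C1 * (t - s)).
  have W'E t z : s <= t -> W' t z = W t z.1 z.2 by move=> st; rewrite /W' (max_idPr st).
  have cW : continuous (fun z : R * (V * V) => W' z.1 z.2).
    have ct : continuous (fun z : R * (V * V) => z.1) by move=> z; exact: cvg_fst.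
    have c2 : continuous (fun z : R * (V * V) => z.2) by move=> z; exact: cvg_snd.
    have cx : continuous (fun z : R * (V * V) => z.2.1).
      by move=> z; apply: (continuous_comp (c2 z)); exact: cvg_fst.
    have cy : continuous (fun z : R * (V * V) => z.2.2).
      by move=> z; apply: (continuous_comp (c2 z)); exact: cvg_snd.
    have ctx : continuous (fun z : R * (V * V) => (z.1, z.2.1)).
      by move=> z; exact: (cvg_pair (ct z) (cx z)).
    have cty : continuous (fun z : R * (V * V) => (z.1, z.2.2)).
      by move=> z; exact: (cvg_pair (ct z) (cy z)).
    have cm : continuous (fun z : R * (V * V) => Num.max s z.1).
      move=> z; apply: (@continuous_max _ _ (cst s) (fun z : R * (V * V) => z.1)); last exact: ct.
      exact: cst_continuous.
    have smax r : s <= Num.max s r by rewrite le_max lexx.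
    apply: contB.
      apply: contB.
        apply: contB.
          apply: contM; first exact: contC.
          apply: cont_ln; last by move=> z; apply: lt_le_trans del0 (udel _ _ _).
          exact: (cont_comp _ _ _ (sol_clamp_continuous _ _ _ Su) ctx).
        apply: cont_ln; last by move=> z; apply: lt_le_trans delp0 (vdel _ _ _).
        exact: (cont_comp _ _ _ (sol_clamp_continuous _ _ _ Sv) cty).
      apply: contM.
        apply: contM; first exact: contC.
        apply: contV; last by move=> z; rewrite gt_eqF // ltr_wpDl // subr_ge0.
        by apply: contD; [apply: contB; [exact: cm|exact: contC]|exact: contC].
      have cxy : continuous (fun z : R * (V * V) => z.2.1 - z.2.2).
        by move=> z; exact: (continuousB (cx z) (cy z)).
      exact: continuous_dotp.
    apply: contM; first exact: contC.
    apply: contD; first by apply: contD; [exact: (continuous_dotp _ _ _ cx cx)|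
      exact: (continuous_dotp _ _ _ cy cy)].
    by apply: contM; [exact: contC|apply: contB; [exact: ct|exact: contC]].
  have Wle t x y : s <= t -> W t x y <= B0 - eps * (dotp x x + dotp y y).
    move=> st; apply: lerB.
      rewrite -[leRHS]subr0; apply: lerB; first exact: NB0.
      rewrite mulr_ge0 ?dotp_ge0 // divr_ge0 ?ltW // ltr_wpDl // subr_ge0 //.
    by rewrite ler_wpM2l ?(ltW eps0) // lerDl mulr_ge0 ?(ltW C10) // subr_ge0.
  pose rho := (B0 - W s x0 y0) / eps + (dotp x0 x0 + dotp y0 y0).
  have W0B : W s x0 y0 <= B0.
    apply: le_trans (Wle _ _ _ (lexx s)) _.
    by rewrite gerBl mulr_ge0 ?(ltW eps0) // addr_ge0 ?dotp_ge0.
  have rho1 : (B0 - W s x0 y0) / eps <= rho by rewrite lerDl addr_ge0 ?dotp_ge0.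
  have rho2 : dotp x0 x0 + dotp y0 y0 <= rho.
    by rewrite lerDr divr_ge0 ?(ltW eps0) // subr_ge0.
  have [] := coercive_max _ W' s T ([set x | dotp x x <= rho] `*` [set y | dotp y y <= rho])
      (x0, y0) (ltW sT) cW.
  - by apply: compact_setX; exact: compact_ball.
  - split=> /=; apply: le_trans rho2; first by rewrite lerDl dotp_ge0.
    by rewrite lerDr dotp_ge0.
  - move=> t [x y] /andP[st _] out; rewrite !W'E //=.
    apply: le_trans (Wle _ _ _ st) _.
    have xyrho : rho <= dotp x x + dotp y y.
      rewrite leNgt; apply/negP => lt; apply: out; split => /=; apply: ltW; apply: le_lt_trans lt.
        by rewrite lerDl dotp_ge0.
      by rewrite lerDr dotp_ge0.
    have := le_trans rho1 xyrho; rewrite ler_pdivrMr // mulrC; lra.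
  move=> t [[x y] [/andP[st tT] Wmax]].
  have {}Wmax r x' y' : s <= r <= T -> W r x' y' <= W t x y.
    by move=> /[dup] /andP[sr _] rI; have := Wmax r (x', y') rI; rewrite !W'E.
  have [ts|ts] := eqVneq t s; last first.
    exfalso; have {}st : s < t by rewrite lt_def ts.
    have tt := lt_trans taus st.
    apply: (harnack_no_interior_max standing p eta0 Lam C k eps sig c C1 s T t f
      (fun x => f x `^ p) u v x y taus st tT) => //.
    - by move=> z; exact: Hell.
    - by move=> z; apply: Hb; rewrite (ltW st).
    - by rewrite /C1 ltrDl.
    - by move=> z; apply: lt_le_trans del0 (udel _ _ (ltW st)).
    - by move=> z; apply: lt_le_trans delp0 (vdel _ _ (ltW st)).
  apply: le_trans (Wmax T x0 y0 _) _; first by rewrite (ltW sT) lexx.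
  rewrite ts /W subrr add0r mulr0 addr0 (sol_initial Su) (sol_initial Sv) ln_powR -mulrBr.
  have h1 : p * (ln (f x) - ln (f y)) <= p * (L * enorm (x - y)).
    by apply: ler_wpM2l; [exact: ltW|exact: fL].
  have h2 : 0 <= eps * (dotp x x + dotp y y) by rewrite mulr_ge0 ?(ltW eps0) // addr_ge0 ?dotp_ge0.
  rewrite -[dotp (x - y) (x - y)]enormE; set e := enorm (x - y).
  have h3 : p * (L * e) - c / sig * e ^+ 2 <= sig * ((p * L) ^+ 2 / (4 * c)).
    rewrite -subr_ge0.
    have -> : sig * ((p * L) ^+ 2 / (4 * c)) - (p * (L * e) - c / sig * e ^+ 2) =
       sig / (4 * c) * (p * L - 2 * c / sig * e) ^+ 2.
      by field; rewrite !gt_eqF.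
    by rewrite mulr_ge0 ?sqr_ge0 // divr_ge0 ?(ltW sig0) // mulr_ge0 // ltW.
  by move: h1 h2 h3; rewrite -/e; clear; lra.
apply/ler_addgt0Pr => e e0.
pose B := dotp x0 x0 + dotp y0 y0 + C1 * (T - s) + (p * L) ^+ 2 / (4 * c).
have B0' : 0 <= B.
  rewrite !addr_ge0 ?dotp_ge0 //; first by rewrite mulr_ge0 ?(ltW C10) // subr_ge0 ltW.
  by rewrite divr_ge0 ?sqr_ge0 // mulr_ge0 // ltW.
pose eps := Num.min (k / kap) (e / (B + 1)).
have B1 : 0 < B + 1 by rewrite ltr_wpDl.
have eps0 : 0 < eps by rewrite lt_min !divr_gt0.
have epsk : eps * kap <= k by rewrite -ler_pdivlMr // /eps ge_min lexx.
have epse : eps * B <= e.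
  apply: le_trans (_ : eps * (B + 1) <= _); first by rewrite ler_wpM2l ?(ltW eps0) // lerDl.
  by rewrite -ler_pdivlMr // /eps ge_min lexx orbT.
have := claim eps eps eps0 epsk eps0.
have h1 : c / (T - s + eps) * dotp (x0 - y0) (x0 - y0) <= c / (T - s) * dotp (x0 - y0) (x0 - y0).
  rewrite ler_wpM2r ?dotp_ge0 // ler_wpM2l ?(ltW c0) // lef_pV2 ?posrE ?subr_gt0 //.
    by rewrite lerDl ltW.
  by rewrite addr_gt0 // subr_gt0.
by move: h1 epse; rewrite /B; clear; lra.
Qed.

End HarnackThm.

(** * A Lyapunov function constant on a large ball *)

Section PositivePart.
Context {R : realType}.

(** Both one-sided derivatives at 0 vanish. *)
Lemma is_derive_pospart (H H1 : R -> R) : (forall z : R, is_derive z 1 H (H1 z)) ->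
  H1 0 = 0 -> forall z : R, is_derive z 1 (fun z => H (Num.max z 0)) (H1 (Num.max z 0)).
Proof.
move=> HH H10 z; apply/is_derive_epsP => e e0.
have [del del0 Hd] := (is_derive_epsP _ _ _ _).2 (HH (Num.max z 0)) _ e0.
have [z0|z0|z0] := ltrgtP z 0.
- exists (- z) => [|h h0]; first by rewrite oppr_gt0.
  rewrite ltr_norml [h *: 1]mulr1 => /andP[_ hz].
  have -> : Num.max (h + z) 0 = 0 by apply/max_idPr; lra.
  by rewrite H10 !subr0 subrr mulr0 normr0 ltW.
- have zz : Num.max z 0 = z by apply/max_idPl/ltW.
  rewrite zz in Hd; exists (Num.min del z) => [|h h0]; first by rewrite lt_min del0.
  rewrite lt_min => /andP[hd]; rewrite ltr_norml [h *: 1]mulr1 => /andP[hz _].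
  have -> : Num.max (h + z) 0 = h + z by apply/max_idPl; lra.
  by have := Hd h h0 hd; rewrite [h *: 1]mulr1.
- rewrite z0 maxxx in Hd *; exists del => // h h0 hd.
  rewrite [h *: 1]mulr1 addr0; have [hn|hp] := leP h 0.
    by rewrite H10 subr0 subrr mulr0 normr0 ltW.
  by have := Hd h h0 hd; rewrite [h *: 1]mulr1 addr0.
Qed.

End PositivePart.

Section Exponential.
Context {R : realType}.
Variable l : R.
Hypothesis l0 : 0 < l.

(** The exponential minus its Taylor polynomial of degree 2 vanishes to second order at 0, so its
  composition with the positive part is twice differentiable. *)
Definition exp_rem (z : R) := expR (l * z) - 1 - l * z - (l * z) ^+ 2 / 2.
Definition dexp_rem (z : R) := l * (expR (l * z) - 1 - l * z).
Definition ddexp_rem (z : R) := l ^+ 2 * (expR (l * z) - 1).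

Let is_derive_lin (z : R) : is_derive z 1 (fun z => l * z) l.
Proof. by rewrite -[X in is_derive _ _ _ X]mulr1; apply: is_deriveZ. Qed.

Let is_derive_explin (z : R) : is_derive z 1 (fun z => expR (l * z)) (expR (l * z) * l).
Proof. by apply: (is_derive1_comp (f := @expR R)). Qed.

Lemma is_derive_exp_rem (z : R) : is_derive z 1 exp_rem (dexp_rem z).
Proof.
have D2 : is_derive z 1 (fun z => (l * z) ^+ 2 / 2) (l * (l * z)).
  rewrite (_ : (fun _ => _) = (fun z => 2^-1 * ((l * z) * (l * z)))); last first.
    by apply/funext => y; rewrite mulrC expr2.
  have -> : l * (l * z) = 2^-1 * ((l * z) * l + (l * z) * l) by field.
  by apply: is_deriveZ; apply: is_deriveM.
have D : is_derive z 1 exp_rem (expR (l * z) * l - 0 - l - l * (l * z)).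
  have Da : is_derive z 1 (fun z => expR (l * z) - 1) (expR (l * z) * l - 0).
    exact: is_deriveB.
  have Db : is_derive z 1 (fun z => expR (l * z) - 1 - l * z) (expR (l * z) * l - 0 - l).
    exact: is_deriveB.
  exact: is_deriveB.
by apply: (is_derive_eq D); rewrite /dexp_rem; ring.
Qed.

Lemma is_derive_dexp_rem (z : R) : is_derive z 1 dexp_rem (ddexp_rem z).
Proof.
have D : is_derive z 1 dexp_rem (l * (expR (l * z) * l - 0 - l)).
  have Da : is_derive z 1 (fun z => expR (l * z) - 1) (expR (l * z) * l - 0).
    exact: is_deriveB.
  have Db : is_derive z 1 (fun z => expR (l * z) - 1 - l * z) (expR (l * z) * l - 0 - l).
    exact: is_deriveB.
  exact: is_deriveZ.
by apply: (is_derive_eq D); rewrite /ddexp_rem; ring.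
Qed.

Lemma dexp_rem0 : dexp_rem 0 = 0. Proof. by rewrite /dexp_rem mulr0 expR0; ring. Qed.
Lemma ddexp_rem0 : ddexp_rem 0 = 0. Proof. by rewrite /ddexp_rem mulr0 expR0; ring. Qed.
Lemma exp_rem0 : exp_rem 0 = 0. Proof. by rewrite /exp_rem mulr0 expR0; ring. Qed.

Lemma expR_ge_sq (X : R) : 0 <= X -> (1 + X / 2) ^+ 2 <= expR X.
Proof.
move=> X0; have -> : expR X = expR (X / 2) ^+ 2 by rewrite -expRM_natl; congr expR; field.
rewrite lerXn2r ?nnegrE ?expR_ge0 //; first by rewrite addr_ge0 // divr_ge0.
exact: expR_ge1Dx.
Qed.

Lemma expR_ge_cube (X : R) : 0 <= X -> (1 + X / 3) ^+ 3 <= expR X.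
Proof.
move=> X0; have -> : expR X = expR (X / 3) ^+ 3 by rewrite -expRM_natl; congr expR; field.
rewrite lerXn2r ?nnegrE ?expR_ge0 //; first by rewrite addr_ge0 // divr_ge0.
exact: expR_ge1Dx.
Qed.

Lemma exp_rem_ge0 z : 0 <= z -> 0 <= exp_rem z.
Proof.
move=> z0; have -> : exp_rem z = exp_rem z - exp_rem 0 by rewrite exp_rem0 subr0.
have [|c] := @MVT_segment R exp_rem dexp_rem 0 z z0 (fun x _ => is_derive_exp_rem x).
  by apply: derivable_within_continuous => x _; have [] := is_derive_exp_rem x.
rewrite in_itv /= => /andP[c0 _] ->; rewrite subr0 mulr_ge0 // /dexp_rem mulr_ge0 ?(ltW l0) //.
by have := expR_ge1Dx (l * c); lra.
Qed.

(** The cubic term of the exponential series dominates the subtracted quadratic polynomial, up to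
  a constant. *)
Lemma expR_le_exp_rem z : 0 <= z -> expR (l * z) <= 2 * exp_rem z + 100.
Proof.
move=> z0; rewrite /exp_rem.
have X0 : 0 <= l * z by rewrite mulr_ge0 // ltW.
have := expR_ge_cube _ X0; move: (l * z) (expR _) X0 => X e X0 he.
suff : 2 + 2 * X + X ^+ 2 - 100 <= (1 + X / 3) ^+ 3 by lra.
have [X67|X67] := leP X 67.
  have : 0 <= (X - 12) ^+ 2 * (X + 6) by rewrite mulr_ge0 ?sqr_ge0 //; lra.
  lra.
nra.
Qed.

End Exponential.

Section Lyapunov.
Context {R : realType} {d : nat}.
Notation V := 'rV[R]_d.
Context {tau theta : R} {Q : R -> 'M[R]_d} {b : R -> V -> V}.
Hypothesis standing : standing_assumptions theta `]tau, +oo[ Q b.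
Implicit Types (f : V -> R) (x y xi : V) (s t T l rho : R).
Notation solution := (bounded_classical_solution theta Q b).
Hypothesis hb : exists K1 R0 : R, [/\ 0 < K1, 1 < R0 &
      forall t x, tau < t -> R0 <= enorm x ->
        dotp (b t x) x <= - K1 * enorm x ^+ 2 * ln (enorm x)].

(** Constant for |x|^2 <= rho, and of the order of exp(l |x|^2) at infinity. *)
Definition lyap l rho x := exp_rem l (Num.max (dotp x x - rho) 0).

Let z_ rho x : R := Num.max (dotp x x - rho) 0.

Lemma lyap_ge0 l rho x : 0 < l -> 0 <= lyap l rho x.
Proof. by move=> l0; rewrite /lyap exp_rem_ge0 // le_max lexx orbT. Qed.

Lemma lyap_continuous l rho : continuous (lyap l rho).
Proof.
have c1 : continuous (fun z : R => exp_rem l (Num.max z 0)).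
  move=> z; apply: differentiable_continuous; apply/derivable1_diffP.
  by have [] := is_derive_pospart _ _ (is_derive_exp_rem l) (dexp_rem0 l) z.
have c2 : continuous (fun x : V => dotp x x - rho).
  by apply: contB; [apply: continuous_dotp => x; exact: cvg_id|exact: contC].
exact: (cont_comp _ _ _ c1 c2).
Qed.

Lemma lyap_le l rho r x : 0 < l -> 0 <= rho -> dotp x x <= r -> lyap l rho x <= expR (l * r).
Proof.
move=> l0 rho0 xr; rewrite /lyap /exp_rem -/(z_ rho x).
have z0 : 0 <= z_ rho x by rewrite /z_ le_max lexx orbT.
have zr : z_ rho x <= r.
  by rewrite /z_ ge_max; apply/andP; split; [lra|apply: le_trans xr; exact: dotp_ge0].
have : expR (l * z_ rho x) <= expR (l * r) by rewrite ler_expR ler_wpM2l // ltW.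
have : 0 <= l * z_ rho x by rewrite mulr_ge0 // ltW.
have := sqr_ge0 (l * z_ rho x); lra.
Qed.

Lemma lyap_vjet l rho x : vjet (lyap l rho) x ((2 * dexp_rem l (z_ rho x)) *: x)
  ((2 * dexp_rem l (z_ rho x))%:M + (4 * ddexp_rem l (z_ rho x)) *: (x^T *m x)).
Proof.
move=> xi.
have J1 := jetB (jet_sq x xi) (jet_cst rho).
have D1 := is_derive_pospart _ _ (is_derive_exp_rem l) (dexp_rem0 l).
have D2 := is_derive_pospart _ _ (is_derive_dexp_rem l) (ddexp_rem0 l).
have := jet_comp (fun z => exp_rem l (Num.max z 0)) (fun z => dexp_rem l (Num.max z 0)) _ _ _ _ J1
  (fun r => D1 _) (D2 _).
rewrite scale0r add0r -/(z_ rho x) => J; apply: (jet_eq J).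
  by rewrite dotpZl; ring.
rewrite mulmxDr mul_mx_scalar -scalemxAr dotpDl !dotpZl qform_rank1; ring.
Qed.

(** Outside the ball |x|^2 <= rho the radial drift is at most - K1 N |x|^2 with N = ln (rho) / 2
  as large as desired, and this dominates the second-order terms, which are of order |x|^2 times
  the same exponential; inside the ball all derivatives vanish. *)
Lemma lyap_drift l : 0 < l -> exists a rho : R, [/\ 0 <= a, 0 <= rho & forall t x, tau < t ->
  \tr (Q t *m ((2 * dexp_rem l (z_ rho x))%:M + (4 * ddexp_rem l (z_ rho x)) *: (x^T *m x)))
   + dotp (b t x) ((2 * dexp_rem l (z_ rho x)) *: x) <= a - lyap l rho x].
Proof.
move=> l0; have [eta0 [Lam [eta00 Lam0 Hell]]] := ellipticity standing.
have [K1 [R0 [K10 R01 Hb]]] := hb.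
(* N makes the coefficient of the radial drift beat all second-order terms, and expR N >= R0 *)
pose N := (2 * (d%:R * Lam) + 8 * l * Lam + 4 * Lam + l^-1) / (2 * K1) + ln R0.
pose rho := expR N ^+ 2.
have lnR0 : 0 <= ln R0 by apply: ln_ge0; exact: ltW.
have N0 : 0 <= N.
  by rewrite addr_ge0 // divr_ge0 ?mulr_ge0 ?(ltW K10) // !addr_ge0 ?mulr_ge0 ?invr_ge0 // ltW.
have rho1 : 1 <= rho by rewrite /rho -[leLHS](expr1n _ 2) lerXn2r ?nnegrE ?expR_ge0 // -expR0 ler_expR.
have KN : 2 * (d%:R * Lam) + 8 * l * Lam + 4 * Lam + l^-1 <= 2 * K1 * N.
  rewrite /N mulrDr [X in _ <= X + _]mulrC divfK ?gt_eqF ?mulr_gt0 // lerDl.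
  by rewrite !mulr_ge0 // ltW.
exists (4 * l ^+ 2 * Lam * rho + 4 * l * Lam), rho; split.
- by rewrite !addr_ge0 // !mulr_ge0 // ?sqr_ge0 // ltW.
- by apply: le_trans rho1.
move=> t x tt.
have [zle|zgt] := leP (dotp x x - rho) 0.
  have z0 : z_ rho x = 0 by apply/max_idPr.
  rewrite /lyap -/(z_ rho x) z0 dexp_rem0 ddexp_rem0 exp_rem0 !mulr0 !scale0r addr0 subr0.
  rewrite dotpC dotp0l addr0 (_ : 0%:M = 0) ?mulmx0 ?mxtrace0; last first.
    by apply/matrixP => i j; rewrite !mxE mul0rn.
  by rewrite !addr_ge0 // !mulr_ge0 // ?sqr_ge0 // ltW.
have zE : z_ rho x = dotp x x - rho by apply/max_idPl/ltW.
have enN : expR N <= enorm x.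
  rewrite -[leLHS]ger0_norm ?expR_ge0 // -sqrtr_sqr /enorm; apply: ler_wsqrtr.
  by rewrite -/rho; lra.
have lnN : N <= ln (enorm x).
  by rewrite -[leLHS]expRK ler_ln ?posrE ?expR_gt0 // (lt_le_trans (expR_gt0 _) enN).
have R0x : R0 <= enorm x.
  apply: le_trans enN; rewrite -[leLHS]lnK ?posrE ?(lt_trans ltr01) // ler_expR.
  by rewrite /N lerDr divr_ge0 ?mulr_ge0 ?(ltW K10) // !addr_ge0 ?mulr_ge0 ?invr_ge0 // ltW.
have bx : dotp (b t x) x <= - (K1 * N) * dotp x x.
  apply: le_trans (Hb t x tt R0x) _; rewrite enormE !mulNr lerN2 -!mulrA ler_wpM2l ?(ltW K10) //.
  by rewrite mulrC ler_wpM2l ?dotp_ge0.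
have trQ := tr_diffusion_le t Lam tt (fun w => proj2 (andP (Hell t w tt))).
have qx : dotp (x *m Q t) x <= Lam * dotp x x by have /andP[] := Hell t x tt.
rewrite mulmxDr mul_mx_scalar -scalemxAr raddfD /= !mxtraceZ tr_mulmx_rank1 dotpZr.
rewrite /lyap -/(z_ rho x) /dexp_rem /ddexp_rem /exp_rem.
have X0 : 0 <= l * z_ rho x by rewrite zE mulr_ge0 // ltW.
have hX := expR_ge_sq _ X0.
have rE : dotp x x = rho + (l * z_ rho x) / l by rewrite zE mulrAC mulfV ?gt_eqF // mul1r addrC subrK.
move: bx trQ qx X0 hX rE.
move: (l * z_ rho x) (expR _) (dotp x x) (dotp (b t x) x) (\tr (Q t)) (dotp (x *m Q t) x).
move=> X eX r bx tr q bxE trE qE X0 hX rE.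
set E := eX - 1 - X.
have EX : X <= E + 1.
  have : 0 <= (X / 2 - 1) ^+ 2 by exact: sqr_ge0.
  by rewrite /E; lra.
have E0 : 0 <= E by have := sqr_ge0 (X / 2); rewrite /E; lra.
have eXE : eX - 1 = E + X by rewrite /E; ring.
rewrite eXE.
have r1 : 1 <= r by rewrite rE; apply: le_trans rho1 _; rewrite lerDl divr_ge0 // ltW.
have rrho : r <= rho + (E + 1) / l by rewrite rE lerD2l ler_pM2r ?invr_gt0.
have s1 : 2 * (l * E) * tr <= 2 * (l * E) * (d%:R * Lam) * r.
  have e1 : 2 * (l * E) * tr <= 2 * (l * E) * (d%:R * Lam).
    by rewrite ler_wpM2l // !mulr_ge0 // ltW.
  by apply: le_trans e1 _; rewrite ler_peMr // !mulr_ge0 // ltW.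
have s2 : 4 * (l ^+ 2 * (E + X)) * q <= 4 * (l ^+ 2 * (2 * E + 1)) * (Lam * r).
  have e1 : 4 * (l ^+ 2 * (E + X)) * q <= 4 * (l ^+ 2 * (E + X)) * (Lam * r).
    by apply: ler_wpM2l => //; apply: mulr_ge0 => //; apply: mulr_ge0; [exact: sqr_ge0|exact: addr_ge0].
  apply: le_trans e1 _; apply: ler_wpM2r; first by rewrite mulr_ge0 ?(ltW Lam0) // (le_trans _ r1).
  by apply: ler_wpM2l => //; apply: ler_wpM2l; [exact: sqr_ge0|lra].
have s3 : 2 * (l * E) * bx <= - (2 * K1 * N) * (l * E) * r.
  have -> : - (2 * K1 * N) * (l * E) * r = 2 * (l * E) * (- (K1 * N) * r) by ring.
  by rewrite ler_wpM2l // !mulr_ge0 // ltW.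
have s4 : - (2 * K1 * N) * (l * E) * r <=
   - (2 * (d%:R * Lam) + 8 * l * Lam + 4 * Lam + l^-1) * (l * E) * r.
  apply: ler_wpM2r; first by apply: le_trans r1.
  by apply: ler_wpM2r; [rewrite mulr_ge0 // ltW|rewrite lerN2].
have s5 : 4 * l ^+ 2 * Lam * r <= 4 * l ^+ 2 * Lam * rho + 4 * l * Lam * (E + 1).
  have -> : 4 * l ^+ 2 * Lam * rho + 4 * l * Lam * (E + 1) = 4 * l ^+ 2 * Lam * (rho + (E + 1) / l).
    by field; rewrite gt_eqF.
  by rewrite ler_wpM2l // !mulr_ge0 // ?(ltW Lam0) // ltW.
have s6 : (4 * l * Lam + 1) * E <= (4 * Lam + l^-1) * (l * E) * r.
  have -> : (4 * l * Lam + 1) * E = (4 * Lam + l^-1) * (l * E) by field; rewrite gt_eqF.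
  by rewrite ler_peMr // !mulr_ge0 // ?(ltW l0) // addr_ge0 ?mulr_ge0 ?invr_ge0 // ltW.
have s7 := sqr_ge0 X.
move: s1 s2 s3 s4 s5 s6 s7; clear; lra.
Qed.

(** The right-hand side dominates exp(s - t) psi + a (1 - exp(s - t)), a supersolution by
  [lyap_drift]. *)
Lemma lyap_bound l : 0 < l -> exists a rho : R, [/\ 0 <= a, 0 <= rho &
  forall s f u, tau < s -> solution s f u -> (forall x, f x <= lyap l rho x) ->
  forall t x, s <= t -> u t x <= expR (s - t) * lyap l rho x + a].
Proof.
move=> l0; have [a [rho [a0 rho0 Hd]]] := lyap_drift l l0.
exists a, rho; split => // s f u taus S fle t x st.
have [M HM] := sol_bounded S.
pose e r : R := expR (s - r).
suff : u t x - (e t * lyap l rho x + a * (1 - e t)) <= 0.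
  rewrite subr_le0 => /le_trans; apply; rewrite lerD2l ler_piMr // gerBl.
  exact: expR_ge0.
apply: (max_principle standing s (fun t x => u t x - (e t * lyap l rho x + a * (1 - e t))) M) st => //.
- have ce : continuous (fun z : R * V => e (Num.max s z.1)).
    have ct : continuous (fun z : R * V => Num.max s z.1).
      move=> z; apply: (@continuous_max _ _ (cst s) (fun z : R * V => z.1)); last exact: cvg_fst.
      exact: cst_continuous.
    exact: (cont_comp _ _ _ (@continuous_expR R) (contB _ _ (contC s) ct)).
  apply: contB; first exact: (sol_clamp_continuous _ _ _ S).
  apply: contD; first apply: contM => //.
    by apply: (cont_comp _ _ _ (lyap_continuous l rho)) => z; exact: cvg_snd.
  by apply: contM; [exact: contC|apply: contB; [exact: contC|exact: ce]].
- move=> r y sr; apply: le_trans (_ : u r y <= _); last exact: le_trans (ler_norm _) (HM _ _ sr).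
  rewrite gerBl addr_ge0 ?mulr_ge0 ?expR_ge0 ?lyap_ge0 // subr_ge0 /e -expR0 ler_expR.
  by rewrite subr_le0.
- by move=> y; rewrite (sol_initial S) /e subrr expR0 subrr mulr0 mul1r addr0 subr_le0.
move=> r y sr.
pose g := (2 * dexp_rem l (z_ rho y)) *: y.
pose H := (2 * dexp_rem l (z_ rho y))%:M + (4 * ddexp_rem l (z_ rho y)) *: (y^T *m y).
have de : is_derive r 1 e (- e r).
  have -> : - e r = expR (s - r) * (0 - 1) by rewrite sub0r mulrN1.
  by apply: (is_derive1_comp (f := @expR R) (g := fun r => s - r)); apply: is_deriveB.
have dS : is_derive r 1 (fun r => e r * lyap l rho y + a * (1 - e r))
   (lyap l rho y * (- e r) + a * (0 - - e r)).
  have d1 : is_derive r 1 (fun r => 1 - e r) (0 - - e r) by exact: is_deriveB.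
  have d2 : is_derive r 1 (fun r => a * (1 - e r)) (a * (0 - - e r)) by exact: is_deriveZ.
  have d3 : is_derive r 1 (fun r => e r * lyap l rho y) (lyap l rho y * (- e r)).
    rewrite (_ : (fun _ => _) = (fun r => lyap l rho y * e r)); last by apply/funext => r'; rewrite mulrC.
    exact: is_deriveZ.
  exact: is_deriveD.
have [Ku [gu [Hu [duE Ju KuE]]]] : exists Ku gu Hu, [/\ is_derive r 1 (fun r => u r y) Ku,
    vjet (u r) y gu Hu & Ku = \tr (Q r *m Hu) + dotp (b r y) gu].
  exists (kolmogorov Q b r (u r) y), (grad (u r) y), (hess (u r) y); split=> //.
    exact: (sol_time_derivative S).
  exact: (sol_vjet standing S).
exists (Ku - (lyap l rho y * (- e r) + a * (0 - - e r))), (gu - (e r *: g + 0)), (Hu - (e r *: H + 0)); split.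
- exact: is_deriveB.
- apply: vjetB => //; apply: vjetD; last exact: vjet_cst.
  by apply: vjetZ; exact: lyap_vjet.
- have := Hd r y (lt_trans taus sr); rewrite -/H -/g => drift.
  have := ler_wpM2l (expR_ge0 (s - r)) drift; rewrite -/(e r) => {}drift.
  rewrite KuE !addr0 mulmxBr -scalemxAr !raddfB /= mxtraceZ dotpBr dotpZr.
  have key (a1 a2 a3 a4 a5 a6 : R) : a1 * (a2 + a3) <= a1 * (a - a4) ->
    a5 + a6 - (a4 * - a1 + a * (0 - - a1)) <= a5 - a1 * a2 + (a6 - a1 * a3) by clear; lra.
  exact: key.
Qed.

End Lyapunov.

(** * Exponential moments of the evolution system *)

Section Measure.
Context {R : realType} {d : nat}.
Notation V := 'rV[R]_d.
Implicit Types (f g : V -> R) (P : probability (borelRd R d) R).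

Lemma open_borel (A : set V) : open A -> measurable (A : set (borelRd R d)).
Proof. by move=> oA; apply: sub_sigma_algebra. Qed.

Lemma continuous_borel f : continuous f -> measurable_fun setT (f : borelRd R d -> R).
Proof.
move=> /continuousP cf mD; apply: (measurability _ (RGenOpens.measurableE R)); last exact: mD.
move=> _ [_ [a [b ->] <-]]; rewrite setTI; apply: open_borel.
by apply: cf; exact: interval_open.
Qed.

Lemma enorm_ball_borel (r : R) : measurable ([set x | enorm x < r] : set (borelRd R d)).
Proof.
apply: open_borel.
have cn : continuous (fun x : V => enorm x).
  apply: (cont_comp _ _ _ (@sqrt_continuous R)).
  by apply: (continuous_dotp _ id id) => y; exact: cvg_id.
by move/continuousP: cn => /(_ _ (@open_lt R r)).
Qed.

Lemma integral_cst_prob P (c : \bar R) : (\int[P]_x c = c)%E.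
Proof.
rewrite (integral_cst P (@measurableT _ (borelRd R d))).
rewrite [X in (_ * X)%E](_ : _ = 1%E) ?mule1 //; exact: probability_setT.
Qed.

Lemma integral_setC_le P (A : set (borelRd R d)) (eps : R) : measurable A ->
  ((1 - eps)%:E <= P A)%E -> (\int[P]_x (\1_(~` A) x)%:E <= eps%:E)%E.
Proof.
move=> mA PA; rewrite integral_indic ?setIT //; last exact: measurableC.
rewrite [X in (X <= _)%E](_ : _ = (1 - P A)%E); last exact: probability_setC.
move: PA; case: (P A) => [x| |] //=.
- by rewrite -EFinB !lee_fin; lra.
- by rewrite leNye.
Qed.

End Measure.

Section Integrability.
Context {R : realType} {d : nat}.
Notation V := 'rV[R]_d.
Context {tau theta : R} {Q : R -> 'M[R]_d} {b : R -> V -> V}.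
Context {G : R -> R -> (V -> R) -> (V -> R)} {mu : R -> probability (borelRd R d) R}.
Hypothesis standing : standing_assumptions theta `]tau, +oo[ Q b.
Hypothesis hG : is_evolution_operator theta `]tau, +oo[ Q b G.
Hypothesis hmu : tight_evolution_system `]tau, +oo[ G mu.
Hypothesis hb : exists K1 R0 : R, [/\ 0 < K1, 1 < R0 &
      forall t x, tau < t -> R0 <= enorm x ->
        dotp (b t x) x <= - K1 * enorm x ^+ 2 * ln (enorm x)].
Implicit Types (f g : V -> R) (x y : V) (s t T : R).

Lemma evolution_solution s f : tau < s -> Cb f ->
  bounded_classical_solution theta Q b s f (fun t => G t s f).
Proof. by move=> ts; apply: hG; rewrite /= in_itv /= ts. Qed.

Lemma evolution_continuous s t f : tau < s -> s < t -> Cb f -> continuous (G t s f).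
Proof.
move=> taus st cf x.
have := sol_clamp_continuous _ _ _ (evolution_solution s f taus cf).
move=> /(_ (t, x)) c; have : {for x, continuous (fun y : V => (t, y))}.
  have c1 : {for x, continuous (fun _ : V => t)} by exact: cst_continuous.
  have c2 : {for x, continuous (fun y : V => y)} by exact: cvg_id.
  exact: (cvg_pair c1 c2).
move=> ct; have := continuous_comp ct c.
by rewrite /comp /= (max_idPr (ltW st)).
Qed.

Lemma evolution_invariant s t f : tau < s -> s < t -> Cb f ->
  (\int[mu t]_x (G t s f x)%:E = \int[mu s]_x (f x)%:E)%E.
Proof. by move=> ts; apply: (proj2 hmu); rewrite /= in_itv /= ts. Qed.

Lemma tightness (eps : R) : 0 < eps -> exists2 r : R, 0 < r &
  forall t, tau < t -> ((1 - eps)%:E <= mu t [set x | (enorm x < r)%R])%E.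
Proof.
move=> e0; have [r r0 H] := proj1 hmu eps e0; exists r => // t tt.
by apply: H; rewrite /= in_itv /= tt.
Qed.

(** By invariance the integral is that of u = G(t,s) min(psi,n) against mu_t for any t > s. On a
  ball of mass almost 1, u is at most a plus a term that vanishes as t grows; elsewhere u <= n,
  and the mass of the complement is small uniformly in t. *)
Lemma lyap_truncated_bound (l a rho n : R) : 0 < l -> 0 <= a -> 0 <= rho -> 0 <= n ->
  (forall s f u, tau < s -> bounded_classical_solution theta Q b s f u ->
   (forall x, f x <= lyap l rho x) ->
   forall t x, s <= t -> u t x <= expR (s - t) * lyap l rho x + a) ->
  forall s, tau < s -> (\int[mu s]_x (Num.min (lyap l rho x) n)%:E <= a%:E)%E.
Proof.
move=> l0 a0 rho0 n0 H s taus.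
pose f x := Num.min (lyap l rho x) n.
have f0 x : 0 <= f x by rewrite le_min n0 lyap_ge0.
have cf : Cb f.
  split; last by exists n => x; rewrite ger0_norm // ge_min lexx orbT.
  by move=> x; apply: continuous_min; [exact: lyap_continuous|exact: cst_continuous].
apply/lee_addgt0Pr => e e0.
have e2 : 0 < e / 2 by rewrite divr_gt0.
pose eps := e / 2 / (n + 1).
have eps0 : 0 < eps by rewrite divr_gt0 // ltr_wpDl.
have [r r0 Hr] := tightness _ eps0.
(* since exp y >= y, this t satisfies exp(s - t) exp(l r^2) <= e / 2 *)
pose t := s + expR (l * r ^+ 2) * (2 / e).
have st : s < t by rewrite ltrDl mulr_gt0 ?expR_gt0 // divr_gt0.
have tt := lt_trans taus st.
have S := evolution_solution s f taus cf.
set B := [set x : borelRd R d | enorm x < r].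
have mB : measurable B := enorm_ball_borel r.
have u0 x : 0 <= G t s f x by apply: (sol_ge standing _ _ _ _ taus S) (ltW st).
have un x : G t s f x <= n.
  by apply: (sol_le standing _ _ _ _ taus S _ _ _ (ltW st)) => y; rewrite ge_min lexx orbT.
have uB x : enorm x < r -> G t s f x <= e / 2 + a.
  move=> xr; apply: le_trans (H s f _ taus S _ _ _ (ltW st)) _.
    by move=> y; rewrite ge_min lexx.
  rewrite lerD2r.
  have xr2 : dotp x x <= r ^+ 2.
    by rewrite -enormE lerXn2r ?nnegrE ?enorm_ge0 // ltW.
  apply: le_trans (_ : expR (s - t) * expR (l * r ^+ 2) <= _).
    by rewrite ler_wpM2l ?expR_ge0 // lyap_le.
  rewrite /t opprD addrA subrr sub0r expRN mulrC ler_pdivrMr ?expR_gt0 //.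
  have := expR_ge1Dx (expR (l * r ^+ 2) * (2 / e)).
  set E := expR (l * r ^+ 2); set F := expR _ => EF.
  have : e / 2 * (E * (2 / e)) <= e / 2 * F by apply: ler_wpM2l; [exact: ltW|lra].
  have -> : e / 2 * (E * (2 / e)) = E by field; rewrite gt_eqF.
  by [].
rewrite -(evolution_invariant s t f taus st cf).
have mG : measurable_fun setT (G t s f : borelRd R d -> R).
  by apply: continuous_borel; exact: evolution_continuous.
apply: le_trans (_ : \int[mu t]_x ((e / 2 + a)%:E + n%:E * (\1_(~` B) x)%:E) <= _)%E.
  apply: ge0_le_integral => //.
  - by move=> x _; rewrite lee_fin.
  - exact/measurable_EFinP.
  - apply: emeasurable_funD => //; apply: emeasurable_funM => //.
    by apply/measurable_EFinP; apply: measurable_indic; exact: measurableC.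
  - move=> x _; rewrite -EFinM -EFinD lee_fin indicE.
    have [xB|xB] := boolP (x \in ~` B); rewrite ?mulr1 ?mulr0 ?addr0.
      by apply: le_trans (un x) _; rewrite lerDr addr_ge0 // ltW.
    apply: uB; apply: contrapT => nB; move/negP: xB; apply.
    by rewrite inE.
rewrite ge0_integralD //; last first.
- apply: emeasurable_funM => //.
  by apply/measurable_EFinP; apply: measurable_indic; exact: measurableC.
- by move=> x _; rewrite mule_ge0 // lee_fin.
- by move=> x _; rewrite lee_fin addr_ge0 // ltW.
rewrite integral_cst_prob ge0_integralZl //; last first.
- by apply/measurable_EFinP; apply: measurable_indic; exact: measurableC.
apply: le_trans (_ : (e / 2 + a)%:E + n%:E * eps%:E <= _)%E.
  by rewrite leeD2l // lee_wpmul2l ?lee_fin // integral_setC_le // Hr.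
rewrite -EFinM -!EFinD lee_fin.
have : n * eps <= e / 2.
  by rewrite /eps mulrA ler_pdivrMr ?ltr_wpDl //; lra.
lra.
Qed.

Lemma exp_integrable (l : R) : 0 < l -> exists M : R, forall s, tau < s ->
  (\int[mu s]_x (expR (l * dotp x x))%:E <= M%:E)%E.
Proof.
move=> l0; have [a [rho [a0 rho0 H]]] := lyap_bound standing hb l l0.
exists (expR (l * rho) * (2 * a + 100)) => s taus.
pose f (n : nat) (x : borelRd R d) := (Num.min (lyap l rho x) n%:R)%:E.
have mly : measurable_fun setT (lyap l rho : borelRd R d -> R).
  by apply: continuous_borel; exact: lyap_continuous.
have mf n : measurable_fun setT (f n).
  apply/measurable_EFinP; apply: continuous_borel => x.
  by apply: continuous_min; [exact: lyap_continuous|exact: cst_continuous].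
have f0 n x : setT x -> (0 <= f n x)%E.
  by move=> _; rewrite lee_fin le_min lyap_ge0 //=.
have fnd x : setT x -> {homo f ^~ x : n m / (n <= m)%N >-> (n <= m)%E}.
  move=> _ n m nm; rewrite lee_fin le_min ge_min lexx /= ge_min.
  by rewrite ler_nat nm orbT.
have flim x : limn (fun n => f n x) = (lyap l rho x)%:E.
  apply/cvg_lim => //; apply: cvg_near_cst.
  have [N lN] : exists N : nat, lyap l rho x <= N%:R.
    exists (Num.truncn (lyap l rho x)).+1.
    exact/ltW/truncnS_gt.
  near=> n; rewrite /f; congr EFin; apply/min_idPl; apply: le_trans lN _.
  by rewrite ler_nat; near: n; exact: nbhs_infty_ge.
have lyint : (\int[mu s]_x (lyap l rho x)%:E <= a%:E)%E.
  have -> : (\int[mu s]_x (lyap l rho x)%:E = \int[mu s]_x limn (fun n => f n x))%E.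
    by apply: eq_integral => x _; rewrite flim.
  rewrite (monotone_convergence (mu s) measurableT mf f0 fnd).
  apply: lime_le.
    apply: ereal_nondecreasing_is_cvgn => n m nm; apply: ge0_le_integral => //.
    - by move=> x _; exact: f0.
    - by move=> x _; exact: fnd.
  by near=> n; exact: lyap_truncated_bound.
have lg x : 0 <= lyap l rho x by exact: lyap_ge0.
apply: le_trans (_ : \int[mu s]_x ((expR (l * rho))%:E * (2%:E * (lyap l rho x)%:E + 100%:E)) <= _)%E.
  apply: ge0_le_integral => //.
  - apply/measurable_EFinP; apply: continuous_borel.
    apply: (cont_comp _ _ _ (@continuous_expR R)); apply: contM; first exact: contC.
    by apply: (continuous_dotp _ id id) => x; exact: cvg_id.
  - apply: emeasurable_funM => //; apply: emeasurable_funD => //.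
    by apply: emeasurable_funM => //; exact/measurable_EFinP.
  - move=> x _; rewrite [leRHS](_ : _ = (expR (l * rho) * (2 * lyap l rho x + 100))%:E) // lee_fin.
    have z0 : 0 <= Num.max (dotp x x - rho) 0 by rewrite le_max lexx orbT.
    have := expR_le_exp_rem _ l0 _ z0; rewrite -/(lyap l rho x) => h.
    apply: le_trans (_ : expR (l * rho) * expR (l * Num.max (dotp x x - rho) 0) <= _).
      rewrite -expRD ler_expR -mulrDr ler_wpM2l ?(ltW l0) //.
      by rewrite addrC -lerBlDr le_max lexx.
    by rewrite ler_wpM2l ?expR_ge0.
have mly2 : measurable_fun setT (fun x : borelRd R d => (2%:E * (lyap l rho x)%:E)%E).
  by apply: emeasurable_funM => //; exact/measurable_EFinP.
rewrite ge0_integralZl //; last first.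
- by move=> x _; rewrite adde_ge0 ?mule_ge0 // lee_fin.
- exact: emeasurable_funD.
rewrite ge0_integralD //; last by move=> x _; rewrite mule_ge0 // lee_fin.
have mly1 : measurable_fun setT (fun x : borelRd R d => (lyap l rho x)%:E) by exact/measurable_EFinP.
rewrite ge0_integralZl //; last by move=> x _; rewrite lee_fin.
rewrite integral_cst_prob EFinM; apply: lee_wpmul2l; first by rewrite lee_fin expR_ge0.
rewrite [leRHS](_ : _ = 2%:E * a%:E + 100%:E)%E //; apply: leeD => //.
exact: lee_wpmul2l.
Unshelve. all: by end_near. Qed.

End Integrability.

(** * Smoothing of bounded Lipschitz data *)

Lemma powR_homo {R : realType} (r x y : R) : 0 <= r -> 0 <= x -> x <= y -> x `^ r <= y `^ r.
Proof.
by move=> r0 x0 xy; apply: ge0_ler_powR; rewrite ?nnegrE //; exact: le_trans xy.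
Qed.

Section Lnorm.
Context {R : realType} {d : nat}.
Notation V := 'rV[R]_d.
Implicit Types (f g : borelRd R d -> R) (P : probability (borelRd R d) R).

Lemma LnormE P (r : R) f :
  ('N[P]_r%:E[EFin \o f] = (\int[P]_x (`|f x| `^ r)%:E) `^ r^-1)%E.
Proof. by rewrite unlock /Lnorm. Qed.

Lemma measurable_normpow (r : R) f : measurable_fun setT f ->
  measurable_fun setT (fun x => (`|f x| `^ r)%:E).
Proof.
move=> mf; apply/measurable_EFinP.
apply: (measurableT_comp (measurable_powR r)); exact: measurableT_comp.
Qed.

Lemma le_poweR (x y : \bar R) (r : R) : 0 <= r -> (0 <= x)%E -> (x <= y)%E -> (x `^ r <= y `^ r)%E.
Proof.
move=> r0 x0 xy; apply: gt0_ler_poweR => //; rewrite in_itv /= leey andbT //.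
exact: le_trans xy.
Qed.

Lemma Lnorm_le P (r : R) f g : 0 < r -> measurable_fun setT f -> measurable_fun setT g ->
  (forall x, `|f x| <= `|g x|) -> ('N[P]_r%:E[EFin \o f] <= 'N[P]_r%:E[EFin \o g])%E.
Proof.
move=> r0 mf mg fg; rewrite !LnormE; apply: le_poweR.
- by rewrite invr_ge0 ltW.
- by apply: integral_ge0 => x _; rewrite lee_fin powR_ge0.
apply: ge0_le_integral => //; try exact: measurable_normpow.
by move=> x _; rewrite lee_fin; apply: powR_homo => //; exact: ltW.
Qed.

Lemma Lnorm_cst_prob P (r c : R) : 0 < r -> ('N[P]_r%:E[EFin \o cst c] = `|c|%:E)%E.
Proof.
move=> r0; rewrite LnormE /=.
rewrite integral_cst_prob poweR_EFin -powRrM mulfV ?gt_eqF // powRr1 //.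
Qed.

End Lnorm.

Definition lipschitz_bounded {R : realType} {d : nat} (f : 'rV[R]_d -> R) :=
  (exists M, forall x, `|f x| <= M) /\ exists L, forall x y, `|f x - f y| <= L * `|x - y|.

Section Smoothing.
Context {R : realType} {d : nat}.
Notation V := 'rV[R]_d.
Context {tau theta : R} {Q : R -> 'M[R]_d} {b : R -> V -> V}.
Context {G : R -> R -> (V -> R) -> (V -> R)} {mu : R -> probability (borelRd R d) R}.
Hypothesis standing : standing_assumptions theta `]tau, +oo[ Q b.
Hypothesis hG : is_evolution_operator theta `]tau, +oo[ Q b G.
Hypothesis hmu : tight_evolution_system `]tau, +oo[ G mu.
Implicit Types (f g : V -> R) (x y : V) (s t T : R).

Lemma lipschitz_bounded_Cb f : lipschitz_bounded f -> Cb f.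
Proof.
move=> [[M HM] [L HL]]; split; last by exists M.
move=> x; apply/(@cvgrPdist_le _ _ _ (nbhs x)) => e e0.
have L0 : 0 < `|L| + 1 by rewrite ltr_wpDl.
have near1 : \forall y \near x, `|x - y| < e / (`|L| + 1).
  apply/nbhs_ballP; exists (e / (`|L| + 1)); first exact: divr_gt0.
  by move=> y; rewrite -ball_normE.
near=> y; apply: le_trans (HL x y) _.
have : `|x - y| < e / (`|L| + 1) by near: y.
rewrite ltr_pdivlMr // => h.
have := normr_ge0 (x - y); have := ler_norm L; nra.
Unshelve. all: by end_near. Qed.

Lemma ln_sub_le (a c del : R) : 0 < del -> del <= a -> del <= c -> ln a - ln c <= `|a - c| / del.
Proof.
move=> del0 da dc.
have a0 : 0 < a by apply: lt_le_trans da.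
have c0 : 0 < c by apply: lt_le_trans dc.
have -> : ln a - ln c = ln (a / c) by rewrite ln_div ?posrE.
have ac0 : 0 < a / c by rewrite divr_gt0.
have := expR_ge1Dx (ln (a / c)); rewrite lnK ?posrE // => h.
apply: le_trans (_ : (a - c) / c <= _).
  by rewrite mulrBl mulfV ?gt_eqF // lerBrDl.
apply: le_trans (_ : `|a - c| / c <= _).
  by rewrite ler_pM2r ?invr_gt0 // ler_norm.
by rewrite ler_wpM2l // lef_pV2 ?posrE.
Qed.

(** Harnack's inequality for |f| + del is averaged in y over a ball that has mu_t-mass at least
  1/2 for every t; the mean of v(t,y) is that of (|f| + del)^p under mu_s. The shift del makes the
  logarithms Lipschitz. *)
Lemma evolution_pointwise_bound p : 1 < p -> exists c rho : R, [/\ 0 < c, 0 < rho &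
  forall s t f (del : R), tau < s -> s < t -> lipschitz_bounded f -> 0 < del -> forall x,
   ((`|G t s f x| `^ p)%:E <=
     (2 * expR (c * (2 * dotp x x + 2 * rho ^+ 2) / (t - s)))%:E *
      \int[mu s]_y (`| `|f y| + del | `^ p)%:E)%E].
Proof.
move=> p1; have p0 : 0 < p by apply: lt_trans p1.
have [c c0 Hc] := harnack standing p p1.
have h20 : (0 : R) < 1 / 2 by rewrite divr_gt0.
have [rho rho0 Hrho] := tightness hmu _ h20.
exists c, rho; split=> // s t f del taus st lf del0 x.
have tt := lt_trans taus st.
have [[M HM] [L HL]] := lf.
pose g y := `|f y| + del.
have gdel y : del <= g y by rewrite lerDr.
have g0 y : 0 < g y by apply: lt_le_trans (gdel y).
have gL y z : `|g y - g z| <= L * `|y - z|.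
  apply: le_trans (HL y z); rewrite /g opprD addrACA subrr addr0.
  exact: ler_dist_dist.
have lg : lipschitz_bounded g.
  split; last by exists L.
  by exists (M + del) => y; rewrite gtr0_norm // lerD2r.
have Cg := lipschitz_bounded_Cb g lg.
have Cf := lipschitz_bounded_Cb f lf.
have Cgp : Cb (fun y => g y `^ p).
  split.
    have -> : (fun y => g y `^ p) = (fun y => expR (p * ln (g y))).
      by apply/funext => y; rewrite /powR gt_eqF.
    apply: (cont_comp _ _ _ (@continuous_expR R)); apply: contM; first exact: contC.
    by apply: cont_ln => //; exact: (proj1 Cg).
  exists ((M + del) `^ p) => y; rewrite ger0_norm ?powR_ge0 //.
  have gM : g y <= M + del by rewrite lerD2r.
  by apply: powR_homo => //; exact: ltW.
have Sf := evolution_solution hG s f taus Cf.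
have Sg := evolution_solution hG s g taus Cg.
have Sgp := evolution_solution hG s _ taus Cgp.
set u := G t s g x; set v := G t s (fun y => g y `^ p).
have fu : `|G t s f x| <= u.
  rewrite ler_norml; apply/andP; split.
    rewrite lerNl -mulN1r; apply: (sol_compare standing _ (-1) _ _ _ _ taus Sf Sg _ _ _ (ltW st)) => y.
    rewrite mulN1r; apply: le_trans (ler_norm _) _; rewrite normrN lerDl ltW //.
  rewrite -[leLHS]mul1r; apply: (sol_compare standing _ 1 _ _ _ _ taus Sf Sg _ _ _ (ltW st)) => y.
  by rewrite mul1r; apply: le_trans (ler_norm _) _; rewrite lerDl ltW.
have u0 : 0 < u by apply: lt_le_trans del0 _; apply: (sol_ge standing _ _ _ _ taus Sg _ _ _ (ltW st)).
have v0 y : 0 < v y.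
  apply: (@lt_le_trans _ _ (del `^ p)); first exact: powR_gt0.
  apply: (sol_ge standing _ _ _ _ taus Sgp _ _ _ (ltW st)) => z.
  by apply: powR_homo => //; exact: ltW.
have gln y z : ln (g y) - ln (g z) <= (`|L| / del) * enorm (y - z).
  apply: le_trans (ln_sub_le _ _ _ del0 (gdel y) (gdel z)) _.
  rewrite mulrAC ler_pM2r ?invr_gt0 //; apply: le_trans (gL y z) _.
  apply: le_trans (_ : `|L| * `|y - z| <= _); first by rewrite ler_wpM2r // ler_norm.
  by rewrite ler_wpM2l // normr_le_enorm.
set E := expR (c * (2 * dotp x x + 2 * rho ^+ 2) / (t - s)).
have E0 : 0 < E by exact: expR_gt0.
have harn y : enorm y < rho -> u `^ p / E <= v y.
  move=> yrho.
  have H := Hc s g _ _ del _ taus del0 gdel gln Sg Sgp t x y st.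
  rewrite ler_pdivrMr // -[v y]lnK ?posrE // {1}/powR gt_eqF // /E -expRD ler_expR.
  rewrite -lerBlDl; apply: le_trans H _.
  rewrite mulrAC ler_pM2r ?invr_gt0 ?subr_gt0 // ler_wpM2l ?(ltW c0) //.
  have yr : dotp y y <= rho ^+ 2 by rewrite -enormE lerXn2r ?nnegrE ?enorm_ge0 ?ltW.
  have := dotp_ge0 (x + y); rewrite !(dotpDl, dotpDr, dotpBl, dotpBr) ?dotpNl ?dotpNr (dotpC y x).
  by lra.
have cv : continuous v by exact: (evolution_continuous hG).
have mv : measurable_fun setT (v : borelRd R d -> R) by exact: continuous_borel.
set B := [set y : borelRd R d | enorm y < rho].
have mB : measurable B := enorm_ball_borel rho.
have intv : ((u `^ p / (2 * E))%:E <= \int[mu t]_y (v y)%:E)%E.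
  apply: le_trans (_ : \int[mu t]_(y in B) (v y)%:E <= _)%E; last first.
    apply: ge0_subset_integral => //; first exact/measurable_EFinP.
    by move=> y _; rewrite lee_fin ltW.
  apply: le_trans (_ : \int[mu t]_(y in B) (u `^ p / E)%:E <= _)%E; last first.
    apply: ge0_le_integral => //.
    - by move=> y _; rewrite lee_fin divr_ge0 ?powR_ge0 // ltW.
    - by apply/measurable_EFinP; apply: measurable_funS mv.
  rewrite (integral_cst (mu t) mB).
  apply: le_trans (_ : (u `^ p / E)%:E * (1 / 2)%:E <= _)%E.
    by rewrite -EFinM lee_fin invfM; lra.
  apply: lee_wpmul2l; first by rewrite lee_fin divr_ge0 ?powR_ge0 // ltW.
  by apply: le_trans (Hrho t tt); rewrite lee_fin; lra.
have intJ : (\int[mu t]_y (v y)%:E = \int[mu s]_y (`| `|f y| + del | `^ p)%:E)%E.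
  rewrite (evolution_invariant hmu _ _ _ taus st Cgp).
  by apply: eq_integral => y _; rewrite (gtr0_norm (g0 y)).
rewrite -intJ; apply: le_trans (_ : (2 * E)%:E * (u `^ p / (2 * E))%:E <= _)%E; last first.
  by apply: lee_wpmul2l => //; rewrite lee_fin mulr_ge0 // ltW.
rewrite -EFinM lee_fin mulrC divfK ?gt_eqF ?mulr_gt0 //.
by apply: powR_homo => //; exact: ltW.
Qed.

End Smoothing.
Section LqBound.
Context {R : realType} {d : nat}.
Notation V := 'rV[R]_d.
Context {tau theta : R} {Q : R -> 'M[R]_d} {b : R -> V -> V}.
Context {G : R -> R -> (V -> R) -> (V -> R)} {mu : R -> probability (borelRd R d) R}.
Hypothesis standing : standing_assumptions theta `]tau, +oo[ Q b.
Hypothesis hG : is_evolution_operator theta `]tau, +oo[ Q b G.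
Hypothesis hmu : tight_evolution_system `]tau, +oo[ G mu.
Hypothesis hb : exists K1 R0 : R, [/\ 0 < K1, 1 < R0 &
      forall t x, tau < t -> R0 <= enorm x ->
        dotp (b t x) x <= - K1 * enorm x ^+ 2 * ln (enorm x)].
Implicit Types (f g : V -> R) (x y : V) (s t T : R).

(** The Gaussian factor of the pointwise bound decreases with t - s, so one constant serves all
  pairs with t - s >= r0; its power q/p is integrable by [exp_integrable]. *)
Lemma evolution_Lq_bound p q r0 : 1 < p -> p < q -> 0 < r0 -> exists2 A : R, 0 < A &
  forall s t f (del : R), tau < s -> r0 <= t - s -> lipschitz_bounded f -> 0 < del ->
   ('N[mu t]_q%:E[EFin \o (G t s f : borelRd R d -> R)] <=
     A%:E * 'N[mu s]_p%:E[EFin \o ((fun x => `|f x| + del)%R : borelRd R d -> R)])%E.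
Proof.
move=> p1 pq r00; have p0 : 0 < p by apply: lt_trans p1.
have q0 : 0 < q by apply: lt_trans pq.
have [c [rho [c0 rho0 Hpt]]] := evolution_pointwise_bound standing hG hmu p p1.
pose k := q / p; have k0 : 0 < k by rewrite divr_gt0.
pose l := k * (2 * c) / r0.
have c20 : 0 < 2 * c by rewrite mulr_gt0.
have l0 : 0 < l by rewrite /l divr_gt0 // mulr_gt0.
pose k2 := k * (2 * c * rho ^+ 2) / r0.
have [M0 HM0] := exp_integrable standing hG hmu hb l l0.
pose M := Num.max M0 1; have M1 : 0 < M by rewrite lt_max ltr01 orbT.
have HM s : tau < s -> (\int[mu s]_x (expR (l * dotp x x))%:E <= M%:E)%E.
  by move=> /HM0 /le_trans; apply; rewrite lee_fin le_max lexx.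
pose K := 2 `^ k * expR k2 * M.
have K0 : 0 < K by rewrite !mulr_gt0 ?powR_gt0 ?expR_gt0.
exists (K `^ q^-1); first exact: powR_gt0.
move=> s t f del taus r0ts lf del0.
have st : s < t by rewrite -subr_gt0; apply: lt_le_trans r0ts.
have tt := lt_trans taus st.
have := Hpt s t f del taus st lf del0.
rewrite [X in (_ <= _ * X)%E]LnormE /=.
have : (0 <= \int[mu s]_y (`| `|f y| + del | `^ p)%:E)%E.
  by apply: integral_ge0 => y _; rewrite lee_fin powR_ge0.
case: (integral _ _ _) => [j| |] //=; last first.
  by move=> _ _; rewrite invr_eq0 (gt_eqF p0) gt0_muley ?leey // lte_fin powR_gt0.
rewrite lee_fin => j0 Hx.
have mG : measurable_fun setT (G t s f : borelRd R d -> R).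
  by apply: continuous_borel; apply: (evolution_continuous hG) => //; exact: lipschitz_bounded_Cb.
have Hq x : `|G t s f x| `^ q <= 2 `^ k * expR k2 * j `^ k * expR (l * dotp x x).
  have -> : `|G t s f x| `^ q = (`|G t s f x| `^ p) `^ k.
    by rewrite -powRrM /k mulrC divfK // gt_eqF.
  have := Hx x; rewrite -EFinM lee_fin => h.
  apply: le_trans (powR_homo k _ _ (ltW k0) (powR_ge0 _ _) h) _.
  have e0 := expR_ge0 (c * (2 * dotp x x + 2 * rho ^+ 2) / (t - s)).
  rewrite powRM ?mulr_ge0 // powRM //.
  have -> : 2 `^ k * expR k2 * j `^ k * expR (l * dotp x x) =
     2 `^ k * (expR k2 * expR (l * dotp x x)) * j `^ k by ring.
  apply: ler_wpM2r; first exact: powR_ge0.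
  apply: ler_wpM2l; first exact: powR_ge0.
  rewrite -expRM -expRD ler_expR.
  have -> : k2 + l * dotp x x = k * (c * (2 * dotp x x + 2 * rho ^+ 2) / r0).
    by rewrite /k2 /l; ring.
  rewrite mulrC; apply: ler_wpM2l; first exact: ltW.
  apply: ler_wpM2l.
    by rewrite mulr_ge0 ?(ltW c0) // addr_ge0 // mulr_ge0 ?dotp_ge0 ?sqr_ge0.
  by rewrite lef_pV2 // posrE subr_gt0.
rewrite LnormE; apply: le_trans (_ : ((K * j `^ k)%:E `^ q^-1 <= _)%E).
  apply: le_poweR; first by rewrite invr_ge0 ltW.
    by apply: integral_ge0 => x _; rewrite lee_fin powR_ge0.
  apply: le_trans (_ : \int[mu t]_x ((2 `^ k * expR k2 * j `^ k)%:E * (expR (l * dotp x x))%:E) <= _)%E.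
    apply: ge0_le_integral => //.
    - exact: measurable_normpow.
    - apply: emeasurable_funM => //; apply/measurable_EFinP; apply: continuous_borel.
      apply: (cont_comp _ _ _ (@continuous_expR R)); apply: contM; first exact: contC.
      by apply: (continuous_dotp _ id id) => x; exact: cvg_id.
    - by move=> x _; rewrite -EFinM lee_fin; exact: Hq.
  rewrite ge0_integralZl //.
  - rewrite (_ : K * j `^ k = 2 `^ k * expR k2 * j `^ k * M); last by rewrite /K; ring.
    rewrite [in leRHS]EFinM; apply: lee_wpmul2l; last exact: HM.
    by rewrite lee_fin !mulr_ge0 ?powR_ge0 ?expR_ge0.
  - apply/measurable_EFinP; apply: continuous_borel.
    apply: (cont_comp _ _ _ (@continuous_expR R)); apply: contM; first exact: contC.
    by apply: (continuous_dotp _ id id) => x; exact: cvg_id.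
  - by rewrite lee_fin !mulr_ge0 ?powR_ge0 ?expR_ge0.
rewrite poweR_EFin -EFinM lee_fin powRM ?powR_ge0 ?(ltW K0) //.
rewrite ler_pM2l ?powR_gt0 // -powRrM (_ : k / q = p^-1) //.
by rewrite /k mulrAC mulfV ?gt_eqF // mul1r.
Qed.

End LqBound.

(** * Density of bounded Lipschitz functions in L^p *)

Section Density.
Import HBNNSimple.
Context {R : realType} {d : nat}.
Notation V := 'rV[R]_d.
Notation T := (borelRd R d).
Variables (P : probability T R) (p : R).
Hypothesis p1 : 1 <= p.
Implicit Types (F H : T -> R) (f g : V -> R).

Let p0 : 0 < p. Proof. exact: lt_le_trans p1. Qed.

Lemma lipschitz_boundedD f g : lipschitz_bounded f -> lipschitz_bounded g ->
  lipschitz_bounded (fun x => f x + g x).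
Proof.
move=> [[M HM] [L HL]] [[M' HM'] [L' HL']]; split.
  by exists (M + M') => x; apply: le_trans (ler_normD _ _) _; rewrite lerD.
exists (L + L') => x y; rewrite opprD addrACA mulrDl.
by apply: le_trans (ler_normD _ _) _; rewrite lerD.
Qed.

Lemma lipschitz_boundedZ c f : lipschitz_bounded f -> lipschitz_bounded (fun x => c * f x).
Proof.
move=> [[M HM] [L HL]]; split.
  by exists (`|c| * M) => x; rewrite normrM ler_wpM2l.
by exists (`|c| * L) => x y; rewrite -mulrBr normrM -mulrA ler_wpM2l.
Qed.

Definition approximable F := measurable_fun setT F /\ forall e : R, 0 < e ->
  exists2 g, lipschitz_bounded g & ('N[P]_p%:E[EFin \o (fun x : T => F x - g x)%R] <= e%:E)%E.

Lemma lipschitz_bounded_measurable g : lipschitz_bounded g -> measurable_fun setT (g : T -> R).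
Proof. by move=> lg; apply: continuous_borel; have [] := lipschitz_bounded_Cb g lg. Qed.

Lemma approximable_lipschitz g : lipschitz_bounded g -> approximable g.
Proof.
move=> lg; split; first exact: lipschitz_bounded_measurable.
move=> e e0; exists g => //.
have -> : (EFin \o (fun x : T => g x - g x)) = (EFin \o cst 0) :> (T -> \bar R).
  by apply/funext => x /=; rewrite subrr.
by rewrite Lnorm_cst_prob // normr0 lee_fin ltW.
Qed.

Lemma approximableD F H : approximable F -> approximable H -> approximable (fun x => F x + H x).
Proof.
move=> [mF aF] [mH aH]; split; first exact: measurable_funD.
move=> e e0; have e20 : 0 < e / 2 by rewrite divr_gt0.
have [g lg Ng] := aF _ e20; have [h lh Nh] := aH _ e20.
exists (fun x => g x + h x); first exact: lipschitz_boundedD.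
have -> : (EFin \o (fun x : T => F x + H x - (g x + h x))) =
   (EFin \o ((fun x => F x - g x) \+ (fun x => H x - h x))) :> (T -> \bar R).
  by apply/funext => x /=; congr EFin; ring.
rewrite [leRHS](_ : _ = (e / 2)%:E + (e / 2)%:E)%E; last by rewrite -EFinD -splitr.
apply: le_trans (minkowski_EFin P _ _ p1) _.
- by apply: measurable_funB => //; exact: lipschitz_bounded_measurable.
- by apply: measurable_funB => //; exact: lipschitz_bounded_measurable.
- exact: leeD.
Qed.

Lemma LnormZ_fun (c : R) F : measurable_fun setT F ->
  ('N[P]_p%:E[EFin \o (fun x => c * F x)%R] = `|c|%:E * 'N[P]_p%:E[EFin \o F])%E.
Proof.
move=> mF; rewrite !LnormE.
have -> : (\int[P]_x (`|c * F x| `^ p)%:E = (`|c| `^ p)%:E * \int[P]_x (`|F x| `^ p)%:E)%E.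
  rewrite -ge0_integralZl //.
  - by apply: eq_integral => x _; rewrite normrM powRM // EFinM.
  - exact: measurable_normpow.
rewrite poweRM ?lee_fin ?powR_ge0 //.
  by rewrite poweR_EFin -powRrM mulfV ?gt_eqF // powRr1.
by apply: integral_ge0 => x _; rewrite lee_fin powR_ge0.
Qed.

Lemma approximableZ c F : approximable F -> approximable (fun x => c * F x).
Proof.
move=> [mF aF]; split; first exact: measurable_funM.
move=> e e0; have c1 : 0 < `|c| + 1 by rewrite ltr_wpDl.
have e20 : 0 < e / (`|c| + 1) by rewrite divr_gt0.
have [g lg Ng] := aF _ e20.
exists (fun x => c * g x); first exact: lipschitz_boundedZ.
have -> : (EFin \o (fun x : T => c * F x - c * g x)) =
   (EFin \o (fun x => c * (F x - g x))) :> (T -> \bar R).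
  by apply/funext => x /=; rewrite mulrBr.
rewrite LnormZ_fun; last by apply: measurable_funB => //; exact: lipschitz_bounded_measurable.
apply: le_trans (_ : `|c|%:E * (e / (`|c| + 1))%:E <= _)%E.
  by apply: lee_wpmul2l => //; rewrite lee_fin.
rewrite -EFinM lee_fin mulrA ler_pdivrMr // mulrC ler_wpM2l ?(ltW e0) // lerDl //.
Qed.

(** Dominated convergence with the majorant (2H)^p. *)
Lemma approximable_limit (F_ : nat -> T -> R) F H : (forall n, approximable (F_ n)) ->
  measurable_fun setT F -> (forall x, F_ n x @[n --> \oo] --> F x) ->
  (forall n x, `|F_ n x| <= H x) -> (forall x, `|F x| <= H x) ->
  P.-integrable setT (fun x => (H x `^ p)%:E) -> approximable F.
Proof.
move=> aF mF Flim FnH FH iH; split=> // e e0.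
have e20 : 0 < e / 2 by rewrite divr_gt0.
have mB n : measurable_fun setT (fun x => F x - F_ n x).
  by apply: measurable_funB => //; have [] := aF n.
have H0 x : 0 <= H x by apply: le_trans (FH x).
have [] := @dominated_convergence _ _ R P setT measurableT
   (fun n x => (`|F x - F_ n x| `^ p)%:E) (cst 0%E) (fun x => (2 `^ p)%:E * (H x `^ p)%:E)%E.
- by move=> n; exact: measurable_normpow.
- exact: measurable_cst.
- apply: aeW => x _; apply: cvg_EFin; first by apply: nearW.
  apply/cvgrPdist_le => r r0.
  have rp0 : 0 < r `^ p^-1 by exact: powR_gt0.
  have /cvgrPdist_le/(_ _ rp0) := Flim x; apply: filterS => n h /=.
  rewrite sub0r normrN ger0_norm ?powR_ge0 //.
  apply: le_trans (powR_homo p _ _ (ltW p0) (normr_ge0 _) h) _.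
  by rewrite -powRrM mulVf ?gt_eqF // powRr1 // ltW.
- exact: integrableZl.
- apply: aeW => x n _; rewrite gee0_abs ?lee_fin ?powR_ge0 // -powRM //.
  apply: powR_homo => //; first exact: ltW.
  by apply: le_trans (ler_normB _ _) _; rewrite mulr_natl mulr2n lerD.
move=> _ _; rewrite integral0 => /fine_cvgP [fin0 /cvgrPdist_le lim0].
have ep0 : 0 < (e / 2) `^ p by exact: powR_gt0.
have [N _ HN] := filterI fin0 (lim0 _ ep0).
have /= [finN leN] := HN N (leqnn N).
have [g lg Ng] := (aF N).2 _ e20.
exists g => //.
have -> : (EFin \o (fun x : T => F x - g x)) =
   (EFin \o ((fun x => F x - F_ N x) \+ (fun x => F_ N x - g x))) :> (T -> \bar R).
  by apply/funext => x /=; congr EFin; ring.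
rewrite [leRHS](_ : _ = (e / 2)%:E + (e / 2)%:E)%E; last by rewrite -EFinD -splitr.
apply: le_trans (minkowski_EFin P _ _ p1) _ => //.
  by apply: measurable_funB; [have [] := aF N|exact: lipschitz_bounded_measurable].
apply: leeD => //; rewrite LnormE.
have I0 : (0 <= \int[P]_x (`|F x - F_ N x| `^ p)%:E)%E.
  by apply: integral_ge0 => x _; rewrite lee_fin powR_ge0.
move: leN; rewrite sub0r normrN ger0_norm ?fine_ge0 // => leN.
apply: le_trans (_ : ((e / 2) `^ p)%:E `^ p^-1 <= _)%E.
  apply: le_poweR => //; first by rewrite invr_ge0 ltW.
  by rewrite -(fineK finN) lee_fin.
by rewrite poweR_EFin -powRrM mulfV ?gt_eqF // powRr1 // ltW.
Qed.

Lemma integrable_powR_cst (c : R) : P.-integrable setT (fun x : T => (c `^ p)%:E).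
Proof.
apply/integrableP; split; first exact: measurable_cst.
by rewrite integral_cst_prob ltry.
Qed.

(** D is the distance to A. *)
Lemma dist_lipschitz (A : set V) : A !=set0 -> exists D : V -> R,
  [/\ forall x, 0 <= D x, forall x, A x -> D x = 0,
      forall x y, `|D x - D y| <= `|x - y| &
      forall x, closed A -> ~ A x -> 0 < D x].
Proof.
move=> [a Aa]; pose D x := inf [set `|x - y| | y in A].
have hi x : has_inf [set `|x - y| | y in A].
  split; first by exists `|x - a|; exists a.
  by exists 0 => _ [y _ <-].
have D0 x : 0 <= D x.
  by apply: lb_le_inf; [exact: (hi x).1|move=> _ [y _ <-]].
have Dle x y : D x <= D y + `|x - y|.
  rewrite -lerBlDr; apply: lb_le_inf; first exact: (hi y).1.
  move=> _ [z Az <-]; rewrite lerBlDr.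
  apply: le_trans (_ : `|x - z| <= _).
    by apply: ge_inf; [exact: (hi x).2|exists z].
  by rewrite [leRHS]addrC; apply: le_trans (ler_normD _ _); rewrite addrA subrK.
exists D; split => //.
- move=> x Ax; apply/eqP; rewrite eq_le D0 andbT.
  by apply: ge_inf; [exact: (hi x).2|exists x => //; rewrite subrr normr0].
- move=> x y; have := Dle x y; have := Dle y x; rewrite distrC ler_norml => h1 h2.
  by apply/andP; split; lra.
- move=> x cA nAx.
  have : open (~` A) by rewrite openC.
  rewrite openE => /(_ x nAx); rewrite /interior => /nbhs_ballP[e /= e0 He].
  apply: lt_le_trans e0 _; apply: lb_le_inf; first exact: (hi x).1.
  move=> _ [y Ay <-]; rewrite leNgt; apply/negP => xy.
  by apply: (He y) => //; rewrite -ball_normE.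
Qed.

Lemma min1_contract (a c : R) : `|Num.min 1 a - Num.min 1 c| <= `|a - c|.
Proof.
have := ler_norm (a - c); have := ler_norm (c - a); rewrite (distrC c) => h1 h2.
have h0 := normr_ge0 (a - c).
by rewrite ler_norml; case: (leP 1 a); case: (leP 1 c) => ? ?; apply/andP; split; lra.
Qed.

(** The functions min(1, n dist(x, U^c)) are Lipschitz and increase to the indicator of U. *)
Lemma approximable_open (U : set V) : open U -> approximable (\1_U : T -> R).
Proof.
move=> oU; have [->|nU] := eqVneq U setT.
  rewrite indicT; apply: approximable_lipschitz; split.
    by exists 1 => x; rewrite normr1.
  by exists 0 => x y; rewrite subrr normr0 mul0r.
have cU : closed (~` U) by rewrite closedC.
have [|D [D0 DA DL Dpos]] := dist_lipschitz (~` U).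
  by apply/set0P; apply: contra nU => /eqP h; rewrite -[U]setCK h setC0.
pose F_ n : T -> R := fun x => Num.min 1 (n%:R * D x).
have F0 n x : 0 <= F_ n x by rewrite le_min ler01 mulr_ge0.
have F1 n x : F_ n x <= 1 by rewrite ge_min lexx.
apply: (@approximable_limit F_ _ (cst 1)).
- move=> n; apply: approximable_lipschitz; split.
    by exists 1 => x; rewrite ger0_norm.
  exists n%:R => x y; apply: le_trans (_ : `|n%:R * D x - n%:R * D y| <= _).
    exact: min1_contract.
  by rewrite -mulrBr normrM ger0_norm // ler_wpM2l.
- by apply: measurable_indic; exact: open_borel.
- move=> x; rewrite indicE; have [xU|xU] := boolP (x \in U).
    have Dx : 0 < D x by apply: Dpos => //; rewrite inE in xU; exact.
    apply: cvg_near_cst; near=> n; rewrite /F_; apply/min_idPl.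
    rewrite -ler_pdivrMr // div1r; near: n; exact: nbhs_infty_ger.
  apply: cvg_near_cst; near=> n; rewrite /F_ DA ?mulr0; first by apply/min_idPr.
  by move=> xU'; move/negP: xU; apply; rewrite inE.
- by move=> n x; rewrite ger0_norm.
- by move=> x; rewrite indicE; case: (_ \in _); rewrite ?normr1 ?normr0.
- exact: integrable_powR_cst.
Unshelve. all: by end_near. Qed.

Lemma sum_indic_trivIset (F : nat -> set T) n x : trivIset [set: nat] F ->
  \sum_(i < n) \1_(F i) x = \1_(\bigcup_(i < n) F i) x :> R.
Proof.
move=> tF; rewrite [RHS]indicE; have [|xF] := boolP (x \in _).
  rewrite inE => -[i /= lin Fix]; rewrite (bigD1 (Ordinal lin)) //= indicE mem_set //.
  rewrite big1 ?addr0 // => j ji; rewrite indicE memNset // => Fjx.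
  have ij : nat_of_ord j = i by apply: (tF j i) => //; exists x.
  by move/eqP: ji; apply; apply: val_inj.
rewrite big1 // => i _; rewrite indicE memNset // => Fix.
by move/negP: xF; apply; rewrite inE; exists i => /=.
Qed.

Lemma approximable_sum (I : Type) (r : seq I) (F_ : I -> T -> R) :
  (forall i, approximable (F_ i)) -> approximable (fun x => \sum_(i <- r) F_ i x).
Proof.
move=> aF; elim: r => [|i r IH].
  rewrite (_ : (fun _ => _) = (fun=> 0)); last by apply/funext => x; rewrite big_nil.
  apply: approximable_lipschitz; split; first by exists 0 => x; rewrite normr0.
  by exists 0 => x y; rewrite subrr normr0 mul0r.
rewrite (_ : (fun _ => _) = (fun x => F_ i x + \sum_(j <- r) F_ j x)); last first.
  by apply/funext => x; rewrite big_cons.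
exact: approximableD.
Qed.

(** The class of approximable indicators contains the open sets, which are stable under
  intersection, and is a Dynkin system. *)
Lemma approximable_indic (A : set T) : measurable A -> approximable (\1_A : T -> R).
Proof.
move: A; apply: (@dynkin_induction _ T (@open V) (fun A => approximable (\1_A : T -> R))).
- by [].
- by move=> A B oA oB; exact: openI.
- by apply: approximable_open; exact: openT.
- by move=> U oU; exact: approximable_open.
- move=> S mS aS.
  rewrite (_ : \1_(~` S) = (fun x => \1_[set: T] x + (-1) * \1_S x)).
    apply: approximableD; last exact: approximableZ.
    by apply: approximable_open; exact: openT.
  by apply/funext => x; rewrite !indicE in_setC in_setT; case: (_ \in S) => /=; ring.
- move=> F mF tF aF.
  apply: (@approximable_limit (fun n x => \sum_(i < n) \1_(F i) x) _ (cst 1)).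
  + by move=> n; apply: approximable_sum.
  + by apply: measurable_indic; exact: bigcup_measurable.
  + move=> x; apply: cvg_near_cst.
    have [[m _ Fmx]|nF] := pselect ((\bigcup_k F k) x).
      near=> n; rewrite sum_indic_trivIset // !indicE !mem_set //; first by exists m.
      by exists m => //=; near: n; exact: nbhs_infty_gt.
    near=> n; rewrite sum_indic_trivIset // !indicE !memNset // => -[k _ Fkx].
    by apply: nF; exists k.
  + move=> n x; rewrite sum_indic_trivIset // indicE.
    by case: (_ \in _); rewrite ?normr1 ?normr0.
  + by move=> x; rewrite indicE; case: (_ \in _); rewrite ?normr1 ?normr0.
  + exact: integrable_powR_cst.
Unshelve. all: by end_near. Qed.

Lemma approximable_ge0 F : measurable_fun setT F -> (forall x, 0 <= F x) ->
  P.-integrable setT (fun x => (F x `^ p)%:E) -> approximable F.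
Proof.
move=> mF F0 iF.
have mEF : measurable_fun setT (EFin \o F) by exact/measurable_EFinP.
pose F_ n : T -> R := nnsfun_approx measurableT mEF n.
have F_lim x : F_ n x @[n --> \oo] --> F x.
  exact: (fine_cvg (cvg_nnsfun_approx measurableT mEF (fun x _ => F0 x) I)).
have F_le n x : F_ n x <= F x.
  have nd : {homo F_ ^~ x : n m / (n <= m)%N >-> n <= m}.
    by move=> k m km; have /lefP := nd_nnsfun_approx measurableT mEF km; apply.
  by rewrite -(cvg_lim _ (F_lim x)) //; apply: nondecreasing_cvgn_le => //; apply: cvgP (F_lim x).
apply: (@approximable_limit F_ _ F) => //.
- move=> n; have E := @fimfunEord T R (nnsfun_approx measurableT mEF n).
  rewrite /F_ (funext E); apply: approximable_sum => i.
  by apply: approximableZ; apply: approximable_indic.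
- by move=> n x; rewrite ger0_norm //; exact: fun_ge0.
- by move=> x; rewrite ger0_norm.
Qed.

Lemma lipschitz_dense F : F \in Lfun P p%:E -> approximable F.
Proof.
move=> LF; have iF := Lfun_integrable p1 LF.
have mF : measurable_fun setT F by move: LF; rewrite inE => /andP[]; rewrite inE.
rewrite -[F]funrposBneg.
rewrite (_ : F^\+ - F^\- = (fun x => F^\+ x + (-1) * F^\- x)); last first.
  by apply/funext => x; rewrite mulN1r.
have int (H : T -> R) : measurable_fun setT H -> (forall x, 0 <= H x <= `|F x|) ->
    P.-integrable setT (fun x => (H x `^ p)%:E).
  move=> mH HF; apply: le_integrable iF => //.
    apply/measurable_EFinP; exact: (measurableT_comp (measurable_powR p)).
  move=> x _; rewrite !gee0_abs ?lee_fin ?powR_ge0 //.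
  by have /andP[? ?] := HF x; apply: powR_homo => //; exact: ltW.
apply: approximableD; last apply: approximableZ; apply: approximable_ge0.
- exact: measurable_funrpos.
- exact: funrpos_ge0.
- apply: int; first exact: measurable_funrpos.
  by move=> x; rewrite funrpos_ge0 ge_max ler_norm normr_ge0.
- exact: measurable_funrneg.
- exact: funrneg_ge0.
- apply: int; first exact: measurable_funrneg.
  by move=> x; rewrite funrneg_ge0 ge_max normr_ge0 -normrN ler_norm.
Qed.

End Density.

(** * From Lipschitz data to L^p *)

Lemma min_normD {R : realType} (a c M : R) :
  Num.min `|a + c| M <= Num.min `|a| M + `|c|.
Proof.
have := ler_normD a c; have := normr_ge0 c.
by case: (leP `|a + c| M); case: (leP `|a| M); lra.
Qed.

Section LnormExtra.
Context {R : realType} {d : nat}.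
Notation S := (borelRd R d).
Implicit Types (f g : S -> R) (P : probability S R).

Lemma ae_imply2 P (A B C : S -> Prop) : {ae P, forall x, A x} -> {ae P, forall x, B x} ->
  (forall x, A x -> B x -> C x) -> {ae P, forall x, C x}.
Proof. by move=> pA pB ABC; apply: filterS2 pA pB; exact: ABC. Qed.

Lemma Lnorm_ae_le P (r : R) f g : 0 < r -> measurable_fun setT f -> measurable_fun setT g ->
  {ae P, forall x, `|f x| <= `|g x|} -> ('N[P]_r%:E[EFin \o f] <= 'N[P]_r%:E[EFin \o g])%E.
Proof.
move=> r0 mf mg fg; rewrite !LnormE; apply: le_poweR.
- by rewrite invr_ge0 ltW.
- by apply: integral_ge0 => x _; rewrite lee_fin powR_ge0.
apply: ae_ge0_le_integral => //; try exact: measurable_normpow.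
by apply: filterS fg => x h _; rewrite lee_fin; apply: powR_homo => //; exact: ltW.
Qed.

Lemma Lnorm_norm P (r : R) f : ('N[P]_r%:E[EFin \o (fun x => `|f x|)%R] = 'N[P]_r%:E[EFin \o f])%E.
Proof. by rewrite !LnormE; under eq_integral do rewrite normr_id. Qed.

Lemma Lnorm_powE P (r : R) f : 0 < r ->
  ('N[P]_r%:E[EFin \o f] `^ r = \int[P]_x (`|f x| `^ r)%:E)%E.
Proof. by move=> r0; rewrite poweR_Lnorm ?gt_eqF. Qed.

Lemma lipschitz_bounded_Lfun P (p : R) (g : 'rV[R]_d -> R) : 1 <= p -> lipschitz_bounded g ->
  (g : S -> R) \in Lfun P p%:E.
Proof.
move=> p1 lg; have mg := lipschitz_bounded_measurable g lg.
rewrite inE; apply/andP; split; rewrite inE /= ?inE //=.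
rewrite /finite_norm; have [[M HM] _] := lg.
apply: (@le_lt_trans _ _ ('N[P]_p%:E[EFin \o cst M])%E).
  apply: Lnorm_le => //; first exact: lt_le_trans p1.
  by move=> x /=; apply: le_trans (HM x) _; exact: ler_norm.
by rewrite Lnorm_cst_prob ?ltry //; exact: lt_le_trans p1.
Qed.

(** An L^p bound on a truncation controls its L^q norm, because min(a, M)^q <= M^(q-p) a^p. *)
Lemma Lnorm_truncation_le P (p q M : R) f : 0 < p -> p < q -> 0 < M -> measurable_fun setT f ->
  ('N[P]_q%:E[EFin \o (fun x => Num.min `|f x| M)%R] <=
   ((M `^ (q - p))%:E * 'N[P]_p%:E[EFin \o f] `^ p) `^ q^-1)%E.
Proof.
move=> p0 pq M0 mf; rewrite [leLHS]LnormE; have q0 := lt_trans p0 pq.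
apply: le_poweR; first by rewrite invr_ge0 ltW.
  by apply: integral_ge0 => x _; rewrite lee_fin powR_ge0.
rewrite poweR_Lnorm ?gt_eqF //.
have mp := measurable_normpow p f mf.
rewrite -ge0_integralZl //; last 2 first.
- by move=> x _; exact: poweR_ge0.
- by rewrite lee_fin powR_ge0.
apply: ge0_le_integral => //.
- apply: (measurable_normpow q (fun x => Num.min `|f x| M)); apply: measurable_minr => //.
  exact: measurableT_comp.
- apply: emeasurable_funM => //; exact: measurable_normpow.
move=> x _; rewrite /= -EFinM lee_fin.
have a0 : 0 <= Num.min `|f x| M by rewrite le_min normr_ge0 ltW.
rewrite ger0_norm // -{1}(subrK p q) [leLHS]powRD; last first.
  by rewrite subrK gt_eqF.
apply: ler_pM; rewrite ?powR_ge0 //.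
  by apply: powR_homo => //; [rewrite subr_ge0 ltW|rewrite ge_min lexx orbT].
by apply: powR_homo => //; [exact: ltW|rewrite ge_min lexx].
Qed.

End LnormExtra.

Section Extension.
Context {R : realType} {d : nat}.
Notation V := 'rV[R]_d.
Notation S := (borelRd R d).
Context {tau theta : R} {Q : R -> 'M[R]_d} {b : R -> V -> V}.
Context {G T : R -> R -> (V -> R) -> (V -> R)} {mu : R -> probability (borelRd R d) R}.
Hypothesis standing : standing_assumptions theta `]tau, +oo[ Q b.
Hypothesis hG : is_evolution_operator theta `]tau, +oo[ Q b G.
Hypothesis hmu : tight_evolution_system `]tau, +oo[ G mu.
Hypothesis hT : is_Lp_extension `]tau, +oo[ G mu T.
Hypothesis hb : exists K1 R0 : R, [/\ 0 < K1, 1 < R0 &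
      forall t x, tau < t -> R0 <= enorm x ->
        dotp (b t x) x <= - K1 * enorm x ^+ 2 * ln (enorm x)].
Implicit Types (s t : R).

Let inI t : tau < t -> `]tau, +oo[%classic t.
Proof. by move=> tt; rewrite /= in_itv /= tt. Qed.

Lemma Lfun_measurable (P : probability S R) r (f : S -> R) : f \in Lfun P r -> measurable_fun setT f.
Proof. by rewrite inE => /andP[]; rewrite inE. Qed.

Lemma Lfun_finite (P : probability S R) r (f : S -> R) : f \in Lfun P r ->
  ('N[P]_r[EFin \o f] < +oo)%E.
Proof. by rewrite inE => /andP[_]; rewrite inE. Qed.

(** Let g be Lipschitz and close to f. Then T f = T (f - g) + G g, and the truncation of T (f - g)
  at level M is small in L^q because T (f - g) is small in L^p. The truncation thus replaces
  almost everywhere convergence of a subsequence. *)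
Lemma truncated_extension_bound (p q A M e : R) s t (f : V -> R) :
  1 < p -> p < q -> 0 < A -> 0 < M -> 0 < e -> tau < s -> s < t ->
  (forall f (del : R), lipschitz_bounded f -> 0 < del ->
   ('N[mu t]_q%:E[EFin \o (G t s f : S -> R)] <=
     A%:E * 'N[mu s]_p%:E[EFin \o ((fun x => `|f x| + del)%R : S -> R)])%E) ->
  (f : S -> R) \in Lfun (mu s) p%:E ->
  ('N[mu t]_q%:E[EFin \o (fun x : S => Num.min `|T t s f x| M)%R] <=
    A%:E * 'N[mu s]_p%:E[EFin \o (f : S -> R)] + e%:E)%E.
Proof.
move=> p1 pq A0 M0 e0 taus st HG Lf.
have p0 : 0 < p by apply: lt_trans p1.
have q0 : 0 < q by apply: lt_trans pq.
have p1' : 1 <= p := ltW p1.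
have q1' : 1 <= q by apply: le_trans p1' (ltW pq).
(* del makes the two errors, 2 A del from the shift and N del^(p/q) from the truncation, at most e
  / 2 *)
pose N := (M `^ (q - p)) `^ q^-1.
have N0 : 0 < N by rewrite !powR_gt0.
pose del := Num.min (e / (4 * A)) ((e / (2 * N)) `^ (q / p)).
have eN0 : 0 < e / (2 * N) by rewrite divr_gt0 // mulr_gt0.
have del0 : 0 < del.
  by rewrite lt_min powR_gt0 // andbT divr_gt0 // mulr_gt0.
have delA : A * (2 * del) <= e / 2.
  have : del <= e / (4 * A) by rewrite ge_min lexx.
  by rewrite ler_pdivlMr ?mulr_gt0 //; lra.
have delN : N * del `^ (p / q) <= e / 2.
  have : del <= (e / (2 * N)) `^ (q / p) by rewrite ge_min lexx orbT.
  move=> /(powR_homo (p / q) _ _ (ltW (divr_gt0 p0 q0)) (ltW del0)).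
  rewrite -powRrM (_ : q / p * (p / q) = 1); last by field; rewrite !gt_eqF.
  by rewrite powRr1 ?(ltW eN0) // ler_pdivlMr ?mulr_gt0 //; lra.
have [mf' /(_ _ del0)[g lg Ng]] := lipschitz_dense (mu s) p p1' f Lf.
have mf := Lfun_measurable _ _ _ Lf.
have mg := lipschitz_bounded_measurable g lg.
have Lg := lipschitz_bounded_Lfun (mu s) p g p1' lg.
pose h : V -> R := fun y => -1 * g y + f y.
have Nh : ('N[mu s]_p%:E[EFin \o (h : S -> R)] <= del%:E)%E.
  by rewrite (_ : (h : S -> R) = (fun x => f x - g x)) //; apply/funext => x; rewrite /h mulN1r addrC.
have mh : measurable_fun setT (h : S -> R).
  by apply: measurable_funD => //; exact: measurable_funM.
have Lh : (h : S -> R) \in Lfun (mu s) p%:E.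
  rewrite inE; apply/andP; split; rewrite inE /= ?inE //=.
  by rewrite /finite_norm; apply: le_lt_trans Nh _; rewrite ltry.
have mU := Lfun_measurable _ _ _ (ext_Lp hT p1' (inI _ taus) st Lf).
have mW := Lfun_measurable _ _ _ (ext_Lp hT p1' (inI _ taus) st Lh).
have NW : ('N[mu t]_p%:E[EFin \o (T t s h : S -> R)] <= del%:E)%E.
  exact: le_trans (ext_contraction hT p1' (inI _ taus) st Lh) Nh.
have Cg := lipschitz_bounded_Cb g lg.
have mG : measurable_fun setT (G t s g : S -> R).
  by apply: continuous_borel; apply: (evolution_continuous hG).
have Tg := ext_Cb hT (inI _ taus) st Cg.
have Tlin := ext_linear hT (-1) p1' (inI _ taus) st Lg Lf.
have mmin (u : S -> R) : measurable_fun setT u -> measurable_fun setT (fun x => Num.min `|u x| M).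
  by move=> mu'; apply: measurable_minr => //; exact: measurableT_comp.
apply: le_trans (_ : 'N[mu t]_q%:E[EFin \o ((fun x : S => Num.min `|T t s h x| M) \+
    (fun x => `|G t s g x|))%R] <= _)%E.
  apply: Lnorm_ae_le => //.
  - exact: mmin.
  - by apply: measurable_funD; [exact: mmin|exact: measurableT_comp].
  apply: (ae_imply2 _ _ _ _ Tg Tlin) => x Tgx; rewrite -/h => Tlx.
  have -> : T t s f x = T t s h x + G t s g x by rewrite Tlx Tgx; ring.
  rewrite /=; move: (T t s h x) (G t s g x) => a c.
  have k1 : 0 <= Num.min `|a + c| M by rewrite le_min normr_ge0 ltW.
  have k2 : 0 <= Num.min `|a| M + `|c| by rewrite addr_ge0 // le_min normr_ge0 ltW.
  by rewrite (ger0_norm k1) (ger0_norm k2); exact: min_normD.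
apply: le_trans (minkowski_EFin (mu t) (mmin _ mW) _ q1') _; first exact: measurableT_comp.
rewrite addeC; have -> : e = e / 2 + e / 2 by rewrite -splitr.
rewrite EFinD addeA; apply: leeD.
  have -> : ('N[mu t]_q%:E[EFin \o (fun x => `|G t s g x|)%R] = 'N[mu t]_q%:E[EFin \o (G t s g : S -> R)])%E.
    exact: Lnorm_norm.
  apply: le_trans (HG g del lg del0) _.
  apply: le_trans (_ : A%:E * ('N[mu s]_p%:E[EFin \o (f : S -> R)] + (2 * del)%:E) <= _)%E.
    apply: lee_wpmul2l; first by rewrite lee_fin ltW.
    apply: le_trans (minkowski_EFin (mu s) _ _ p1' (f := fun x => `|g x|) (g := cst del)) _ => //.
      exact: measurableT_comp.
    rewrite Lnorm_cst_prob // ger0_norm ?(ltW del0) //.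
    have -> : (2 * del)%:E = (del%:E + del%:E)%E by rewrite -EFinD mulr_natl mulr2n.
    rewrite addeA; apply: leeD => //.
    have -> : ('N[mu s]_p%:E[EFin \o (fun x => `|g x|)%R] = 'N[mu s]_p%:E[EFin \o (g : S -> R)])%E.
      exact: Lnorm_norm.
    have -> : (EFin \o (g : S -> R)) = EFin \o ((f : S -> R) \+ (fun x => -1 * h x)).
      by apply/funext => x /=; congr EFin; rewrite /h; ring.
    apply: le_trans (minkowski_EFin (mu s) mf _ p1') _; first exact: measurable_funM.
    by apply: leeD => //; rewrite LnormZ_fun // normrN1 mul1e.
  have fin : ('N[mu s]_p%:E[EFin \o (f : S -> R)] \is a fin_num)%E.
    by rewrite ge0_fin_numE ?Lnorm_ge0 //; exact: Lfun_finite.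
  by rewrite -(fineK fin) -EFinD -!EFinM -EFinD lee_fin mulrDr lerD2l.
apply: le_trans (Lnorm_truncation_le (mu t) p q M _ p0 pq M0 mW) _.
apply: le_trans (_ : ((M `^ (q - p))%:E * (del `^ p)%:E) `^ q^-1 <= _)%E.
  apply: le_poweR; first by rewrite invr_ge0 ltW.
    by rewrite mule_ge0 ?poweR_ge0 // lee_fin powR_ge0.
  apply: lee_wpmul2l; first by rewrite lee_fin powR_ge0.
  by apply: le_poweR NW; [exact: ltW|exact: Lnorm_ge0].
by rewrite -EFinM poweR_EFin lee_fin powRM ?powR_ge0 // -/N -powRrM.
Qed.

(** Let M go to infinity in [truncated_extension_bound]. *)
Lemma extension_bound (p q A : R) s t (f : V -> R) :
  1 < p -> p < q -> 0 < A -> tau < s -> s < t ->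
  (forall f (del : R), lipschitz_bounded f -> 0 < del ->
   ('N[mu t]_q%:E[EFin \o (G t s f : S -> R)] <=
     A%:E * 'N[mu s]_p%:E[EFin \o ((fun x => `|f x| + del)%R : S -> R)])%E) ->
  (f : S -> R) \in Lfun (mu s) p%:E ->
  ('N[mu t]_q%:E[EFin \o (T t s f : S -> R)] <= A%:E * 'N[mu s]_p%:E[EFin \o (f : S -> R)])%E.
Proof.
move=> p1 pq A0 taus st HG Lf.
have q0 : 0 < q by apply: lt_trans pq; apply: lt_trans p1.
set B := (A%:E * _)%E.
have B0 : (0 <= B)%E by rewrite mule_ge0 ?Lnorm_ge0 // lee_fin ltW.
pose U : S -> R := T t s f.
have mU : measurable_fun setT U := Lfun_measurable _ _ _ (ext_Lp hT (ltW p1) (inI _ taus) st Lf).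
have HM (n : nat) : (\int[mu t]_x ((Num.min `|U x| n.+1%:R) `^ q)%:E <= B `^ q)%E.
  pose m : S -> R := fun x => Num.min `|U x| n.+1%:R.
  have m0 x : 0 <= m x by rewrite le_min normr_ge0 ler0n.
  have h : ('N[mu t]_q%:E[EFin \o m] <= B)%E.
    apply/lee_addgt0Pr => e e0.
    exact: (truncated_extension_bound p q A n.+1%:R e s t f).
  have -> : (\int[mu t]_x ((Num.min `|U x| n.+1%:R) `^ q)%:E = 'N[mu t]_q%:E[EFin \o m] `^ q)%E.
    rewrite (Lnorm_powE (mu t) q m q0); apply: eq_integral => x _.
    by rewrite (ger0_norm (m0 x)).
  by apply: le_poweR h; [exact: ltW|exact: Lnorm_ge0].
rewrite LnormE; have -> : B = ((B `^ q) `^ q^-1)%E.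
  by rewrite -poweRrM mulfV ?gt_eqF // poweRe1.
apply: le_poweR.
- by rewrite invr_ge0 ltW.
- by apply: integral_ge0 => x _; rewrite lee_fin powR_ge0.
pose F (n : nat) (x : S) := ((Num.min `|U x| n.+1%:R) `^ q)%:E.
have mF n : measurable_fun setT (F n).
  apply/measurable_EFinP; apply: (measurableT_comp (measurable_powR q)).
  by apply: measurable_minr => //; exact: measurableT_comp.
have F0 n x : setT x -> (0 <= F n x)%E by move=> _; rewrite lee_fin powR_ge0.
have Fnd x : setT x -> {homo F ^~ x : n m / (n <= m)%N >-> (n <= m)%E}.
  move=> _ n m nm; rewrite lee_fin; apply: powR_homo.
  - exact: ltW.
  - by rewrite le_min normr_ge0 ler0n.
  - by rewrite le_min ge_min lexx /= ge_min ler_nat ltnS nm orbT.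
have -> : (\int[mu t]_x (`|U x| `^ q)%:E = \int[mu t]_x limn (fun n => F n x))%E.
  apply: eq_integral => x _; apply/esym/cvg_lim => //; apply: cvg_near_cst.
  near=> n; rewrite /F; congr (_ `^ _)%:E; apply/min_idPl.
  apply: le_trans (ltW (truncnS_gt _)) _.
  by rewrite ler_nat ltnS; near: n; exact: nbhs_infty_ge.
rewrite (monotone_convergence (mu t) measurableT mF F0 Fnd).
apply: lime_le; last by near=> n; exact: HM.
apply: ereal_nondecreasing_is_cvgn => n m nm; apply: ge0_le_integral => //.
- by move=> x _; exact: F0.
- by move=> x _; exact: Fnd.
Unshelve. all: by end_near. Qed.

End Extension.

(** Take the infimum of the admissible bounds from r on, which is nonincreasing in r, and add 1/r
  to make it strictly decreasing and divergent at 0. *)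
Lemma decreasing_majorant {R : realType} (N : R -> \bar R -> Prop) :
  (forall r, 0 < r -> exists2 A : R, 0 < A & forall n r', r <= r' -> N r' n -> (n <= A%:E)%E) ->
  exists C : R -> R, [/\ forall r, 0 < r -> 0 < C r,
     forall r r', 0 < r -> r < r' -> C r' < C r,
     C r @[r --> 0^'+] --> +oo &
     forall r n, 0 < r -> N r n -> (n <= (C r)%:E)%E].
Proof.
move=> HN; pose B r := [set a : R | 0 <= a /\ forall n r', r <= r' -> N r' n -> (n <= a%:E)%E].
have hB r : 0 < r -> has_inf (B r).
  move=> r0; split; last by exists 0 => a [].
  by have [A A0 HA] := HN r r0; exists A; split => //; exact: ltW.
have inf0 r : 0 < r -> 0 <= inf (B r).
  by move=> r0; apply: lb_le_inf; [exact: (hB r r0).1|move=> a []].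
exists (fun r => inf (B r) + r^-1); split.
- by move=> r r0; rewrite ltr_wpDl ?inf0 // invr_gt0.
- move=> r r' r0 rr'; apply: ler_ltD; last by rewrite ltf_pV2 // posrE (lt_trans r0).
  apply: lb_le_inf; first exact: (hB r r0).1.
  move=> a [a0 Ha]; apply: ge_inf; first exact: (hB r' (lt_trans r0 rr')).2.
  by split => // n r'' r''r; apply: Ha; apply: le_trans r''r; exact: ltW.
- apply/cvgryPge => A.
  have A1 : 0 < `|A| + 1 by rewrite ltr_wpDl.
  near=> r; have r0 : 0 < r by near: r; exact: nbhs_right_gt.
  apply: le_trans (_ : r^-1 <= _); last by rewrite lerDr inf0.
  apply: le_trans (ler_norm A) _; apply: le_trans (_ : `|A| + 1 <= _); first by rewrite lerDl.
  rewrite -[leLHS]invrK lef_pV2 ?posrE ?invr_gt0 //.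
  by near: r; apply: nbhs_right_le; rewrite invr_gt0.
- move=> r n r0 Nrn.
  have ri0 : 0 < r^-1 by rewrite invr_gt0.
  have [a [a0 Ha] ale] := inf_adherent ri0 (hB r r0).
  apply: le_trans (Ha n r (lexx r) Nrn) _; rewrite lee_fin; exact: ltW.
Unshelve. all: by end_near. Qed.

Theorem theorem3p9 (R : realType) (d : nat) (tau theta : R)
    (Q : R -> 'M[R]_d) (b : R -> 'rV[R]_d -> 'rV[R]_d)
    (G T : R -> R -> ('rV[R]_d -> R) -> ('rV[R]_d -> R))
    (mu : R -> probability (borelRd R d) R)
    (hd : (0 < d)%N)
    (hstanding : standing_assumptions theta `]tau, +oo[ Q b)
    (hG : is_evolution_operator theta `]tau, +oo[ Q b G)
    (hmu : tight_evolution_system `]tau, +oo[ G mu)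
    (hT : is_Lp_extension `]tau, +oo[ G mu T)
    (hb : exists K1 R0 : R, [/\ 0 < K1, 1 < R0 &
      forall t x, tau < t -> R0 <= enorm x ->
        dotp (b t x) x <= - K1 * enorm x ^+ 2 * ln (enorm x)]) :
  supercontractive `]tau, +oo[ mu T.
Proof.
move=> p q p1 pq.
have key r0 : 0 < r0 -> exists2 A : R, 0 < A & forall s t f, tau < s -> r0 <= t - s ->
    f \in Lfun (mu s) p%:E ->
    ('N[mu t]_q%:E[EFin \o T t s f] <= A%:E * 'N[mu s]_p%:E[EFin \o f])%E.
  move=> r00; have [A A0 HA] := evolution_Lq_bound hstanding hG hmu hb p q r0 p1 pq r00.
  exists A => // s t f taus r0ts Lf.
  have st : s < t by rewrite -subr_gt0; apply: lt_le_trans r0ts.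
  by apply: (extension_bound hG hT p q A s t f p1 pq A0 taus st) => // g del; exact: HA.
split.
  move=> s t f; rewrite /= in_itv /= andbT => taus st Lf.
  have ts0 : 0 < t - s by rewrite subr_gt0.
  have [A A0 HA] := key _ ts0.
  have mU : measurable_fun setT (T t s f : borelRd R d -> R).
    apply: (Lfun_measurable (mu t) p%:E); apply: (ext_Lp hT) => //; first exact: ltW.
    by rewrite /= in_itv /= taus.
  rewrite inE; apply/andP; split; rewrite inE /= ?inE //=.
  rewrite /finite_norm; apply: le_lt_trans (HA s t f taus (lexx _) Lf) _.
  by rewrite lte_mul_pinfty ?lee_fin ?(ltW A0) //; exact: Lfun_finite.
have [r r0|C [C1 C2 C3 C4]] := decreasing_majorant
    (fun r n => exists s t, [/\ tau < s, r = t - s & n = Lp_opnorm p q (mu s) (mu t) (T t s)]).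
  have [A A0 HA] := key r r0; exists A => // n r' rr' [s [t [taus r'E ->]]].
  apply: ub_ereal_sup => _ [f [Lf f1] <-].
  apply: le_trans (HA s t f taus _ Lf) _; first by rewrite -r'E.
  by rewrite -[leRHS]mule1; apply: lee_wpmul2l => //; rewrite lee_fin ltW.
exists C; split => // s t; rewrite /= in_itv /= andbT => taus st.
by apply: C4; [rewrite subr_gt0|exists s, t].
Qed.
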